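(* Let $\alpha,\tilde\alpha\in(0,1)$ and let $(q,f,u_0),(\tilde q,\tilde f,\tilde u_0)\in\mathcal{Q}\times L^2(\Omega)\times L^2(\Omega)$. Let $h(t)=u(0,t)$ and $\tilde h(t)=\tilde u(0,t)$ be the observations corresponding to the data $(\alpha,q,f,u_0,g)$ and $(\tilde\alpha,\tilde q,\tilde f,\tilde u_0,\tilde g)$, respectively. Let $0\le T_1<T_2<\infty$, and suppose the boundary excitations satisfy $g=\tilde g=0$ for $t\in[0,T_2]$. Let $\lambda_k,\rho_k,\mathbb{K}$ (respectively $\tilde\lambda_k,\tilde\rho_k,\tilde{\mathbb{K}}$) be the quantities associated with $(q,f,u_0)$ (respectively $(\tilde q,\tilde f,\tilde u_0)$) defined in the context. If $\mathbb{K}\neq\emptyset$, then the identity $h(t)=\tilde h(t)$ for $t\in[T_1,T_2]$, $t>0$, implies $$\rho_0=\tilde\rho_0,\qquad \{(\rho_k,\lambda_k)\}_{k\in\mathbb{K}}=\{(\tilde\rho_k,\tilde\lambda_k)\}_{k\in\tilde{\mathbb{K}}}\qquad\text{and}\qquad \alpha=\tilde\alpha .$$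
   Context: Let $\Omega=(0,1)$, and let $a\in C^2(\overline\Omega)$ with $a\ge a_0>0$ be a fixed (known) coefficient, the same for both sets of data. Let $\mathcal{Q}=\{q\in C(\overline\Omega): q\ge 0\text{ in }\Omega\}$. For $q\in\mathcal{Q}$ put $\mathcal{A}u=\partial_x(a\,\partial_xu)-qu$. For $\alpha\in(0,1)$ the Djrbashian–Caputo derivative is $\partial_t^\alpha u(t)=\frac{1}{\Gamma(1-\alpha)}\int_0^t(t-s)^{-\alpha}u'(s)\,ds$. The direct problem with data $(\alpha,q,f,u_0,g)$, where $f=f(x)$ is time-independent, is, on a time interval $(0,T)$ with $T\ge T_2$, $$\partial_t^\alpha u-\mathcal{A}u=f\ \text{in }\Omega\times(0,T],\quad -a(0)\partial_xu(0,t)=g(t),\quad u(1,t)=0\ \text{ for }t\in(0,T],\quad u(\cdot,0)=u_0\ \text{in }\Omega .$$ Let $\{(\lambda_n,\varphi_n)\}_{n\ge1}$ be the eigenpairs of $-\mathcal{A}\varphi_n=\lambda_n\varphi_n$ in $\Omega$, $\varphi_n'(0)=0$, $\varphi_n(1)=0$, with $0<\lambda_1<\lambda_2<\cdots$ and $\{\varphi_n\}$ an orthonormal basis of $L^2(\Omega)$; $(\cdot,\cdot)$ is the $L^2(\Omega)$ inner product. The two-parameter Mittag-Leffler function is $E_{\alpha,\beta}(z)=\sum_{k=0}^\infty z^k/\Gamma(k\alpha+\beta)$. The solution is understood via its eigenfunction expansion $$u(x,t)=\sum_{n=1}^\infty (u_0,\varphi_n)E_{\alpha,1}(-\lambda_nt^\alpha)\varphi_n(x)+\sum_{n=1}^\infty\int_0^t(t-s)^{\alpha-1}E_{\alpha,\alpha}(-\lambda_n(t-s)^\alpha)\big[(f,\varphi_n)+\varphi_n(0)g(s)\big]ds\,\varphi_n(x),$$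 and the observation is $h(t)=u(0,t)$, $t>0$. Define $\lambda_0=0$, $\rho_0=\sum_{n=1}^\infty\lambda_n^{-1}(f,\varphi_n)\varphi_n(0)$, and $\rho_n=[(u_0,\varphi_n)-\lambda_n^{-1}(f,\varphi_n)]\varphi_n(0)$ for $n\ge1$, and $\mathbb{K}=\{k\in\mathbb{N}:\rho_k\ne0\}$ with $\mathbb{N}=\{1,2,\dots\}$. Quantities with a tilde are defined in the same way from the tilded data. *)

(* Defs.v *)
From mathcomp Require Import all_boot all_order all_algebra.
From mathcomp Require Import all_classical all_reals all_analysis.

Set Implicit Arguments.
Unset Strict Implicit.
Unset Printing Implicit Defensive.

Import Order.TTheory GRing.Theory Num.Theory.
Import numFieldNormedType.Exports.

Local Open Scope classical_set_scope.
Local Open Scope ring_scope.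

(* Functions on the domain Omega = (0,1), or on its closure, are total
   functions R -> R whose values elsewhere are never used. *)

Section Defs.
Variable R : realType.
Implicit Types (a q f g h u phi : R -> R) (lam : nat -> R) (Phi : nat -> R -> R).

Definition C0_closure f := {within `[0, 1], continuous f}.

(* The classical derivatives in the open interval extend continuously to the
   closed interval (f1 and f2 are the extensions). *)
Definition C2_closure f :=
  exists f1 f2 : R -> R,
    [/\ C0_closure f, C0_closure f1, C0_closure f2,
        {in `]0, 1[, forall x : R, is_derive x 1 f (f1 x)} &
        {in `]0, 1[, forall x : R, is_derive x 1 f1 (f2 x)}].

Definition classQ q := C0_closure q /\ {in `]0, 1[, forall x : R, 0 <= q x}.

Definition L2 f :=
  measurable_fun (`]0, 1[ : set R) f /\
  (@lebesgue_measure R).-integrable `]0, 1[ (EFin \o (fun x => f x ^+ 2)).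

Definition inner f g : R :=
  \int[@lebesgue_measure R]_(x in `]0, 1[) (f x * g x).

Definition opA a q u : R -> R :=
  fun x => derive1 (fun y => a y * derive1 u y) x - q x * u x.

Definition right_deriv0 phi (l : R) :=
  h^-1 * (phi h - phi 0) @[h --> (0 : R)^'+] --> l.

Definition eigenpair a q (l : R) phi :=
  [/\ C2_closure phi,
      {in `]0, 1[, forall x : R, - opA a q phi x = l * phi x},
      right_deriv0 phi 0 &
      phi 1 = 0].

(* Sums over n >= 1. *)
Definition sum_from1 (c : nat -> R) : R :=
  limn (fun N => \sum_(1 <= n < N.+1) c n).

Definition orthonormal_basis Phi :=
  [/\ (forall n, (0 < n)%N -> L2 (Phi n)),
      (forall m n, (0 < m)%N -> (0 < n)%N ->
         inner (Phi m) (Phi n) = (m == n)%:R) &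
      (forall f, L2 f ->
         let r N x := f x - \sum_(1 <= n < N.+1) inner f (Phi n) * Phi n x in
         inner (r N) (r N) @[N --> \oo] --> (0 : R))].

(* The eigenpairs are (lam n, Phi n) for n >= 1; lam 0 = 0 is a convention and
   Phi 0 is unconstrained. Since the Phi n form a basis, every eigenvalue is
   one of the lam n with n >= 1. *)
Definition eigensystem a q lam Phi :=
  [/\ lam 0%N = 0,
      (forall n, lam n < lam n.+1),
      (forall n, (0 < n)%N -> eigenpair a q (lam n) (Phi n)) &
      orthonormal_basis Phi].

Definition Gamma (s : R) : R :=
  \int[@lebesgue_measure R]_(x in `]0, +oo[) (x `^ (s - 1) * expR (- x)).

Definition mittag_leffler (alpha beta z : R) : R :=
  limn (series (fun k => z ^+ k / Gamma (k%:R * alpha + beta))).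

Definition solution (alpha : R) lam Phi f (u0 : R -> R) g (x t : R) : R :=
  sum_from1 (fun n =>
    inner u0 (Phi n) * mittag_leffler alpha 1 (- lam n * t `^ alpha)
    * Phi n x) +
  sum_from1 (fun n =>
    (\int[@lebesgue_measure R]_(s in `]0, t[)
       ((t - s) `^ (alpha - 1)
        * mittag_leffler alpha alpha (- lam n * (t - s) `^ alpha)
        * (inner f (Phi n) + Phi n 0 * g s)))
    * Phi n x).

Definition observation (T alpha : R) lam Phi f (u0 : R -> R) g h :=
  forall t : R, 0 < t <= T -> h t = solution alpha lam Phi f u0 g 0 t.

Definition rho lam Phi f (u0 : R -> R) (n : nat) : R :=
  if n == 0%N
  then sum_from1 (fun k => (lam k)^-1 * inner f (Phi k) * Phi k 0)
  else (inner u0 (Phi n) - (lam n)^-1 * inner f (Phi n)) * Phi n 0.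

Definition setK lam Phi f (u0 : R -> R) : set nat :=
  [set k | (0 < k)%N /\ rho lam Phi f u0 k != 0].

Definition spectral_data lam Phi f (u0 : R -> R) : set (R * R) :=
  [set (rho lam Phi f u0 k, lam k) | k in setK lam Phi f u0].

End Defs.

(* Main.v *)
Require Import Defs.
From mathcomp Require Import all_boot all_order all_algebra.
From mathcomp Require Import all_classical all_reals all_analysis.
From mathcomp Require Import measurable_realfun.
From mathcomp Require Import ring lra.

Set Implicit Arguments.
Unset Strict Implicit.
Unset Printing Implicit Defensive.

Import Order.TTheory GRing.Theory Num.Theory.
Import numFieldNormedType.Exports.

Local Open Scope classical_set_scope.
Local Open Scope ring_scope.

(** For t in (0, T2] the observation is the relaxation series
    h(t) = rho_0 + sum_n rho_n E(-lambda_n t^alpha), E = E_{alpha,1}. Testing the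
    eigenvalue equation with 1 - x gives a(0) phi_n(0) = lambda_n (1 - x, phi_n) - (w, phi_n)
    with w = a' + q (1 - x), so Bessel's inequality makes rho_n / lambda_n absolutely
    summable, while 0 <= E(-x) <= min (1, C / x) makes the series converge.

    Continuation in time without complex analysis: E(-x) is completely monotone
    because its resolvent kernel is nonnegative (a first-zero argument on the Volterra
    equation with log-convex kernel t^(alpha - 1)), and this bounds (x d/dx)^j E(-x) by
    3^j j! E(-x / 2). Hence u |-> h(t e^u) is a power series on |u| <= 1/6 for every t,
    and equality on an interval propagates to all t > 0 by steps of fixed length in u.

    The Laplace transform then gives, for all z > 0, equality of
    rho_0 + sum_n rho_n / (1 + lambda_n z^alpha), whose expansion at z = oo is in
    powers z^(-alpha k) with coefficients rho_0 and the inverse moments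
    sum_n rho_n lambda_n^(-k). These are eventually nonzero, which forces
    alpha = alpha'; the moments then determine the atoms (lambda_n, rho_n). *)

(** * Absolutely summable series *)

(** Only [rho_n / lambda_n] is known to be summable, not [rho_n], so exchanges of sums and limits
    are paid for with the decay [C / x] of the Mittag-Leffler function. The price is a factor
    [t^(-alpha)], integrable at 0 because [alpha < 1]. The bound on the iterated derivatives comes
    from positivity: all terms of the Taylor series at [x], evaluated at [x / 2], are nonnegative,
    so partial sums stay below the value at [x / 2], which has the same decay. The resulting radius
    in [u] does not depend on [t], so finitely many equal steps reach any given time. Continuation
    to all times is needed because the expansion at [z = oo] probes the Laplace transform near
    frequency 0, hence the whole half-line. The two families of exponents could a priori interlace.
    Two consecutive nonzero coefficients make [alpha] a natural multiple of [alpha']; with the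
    symmetric statement the two orders coincide. The moments are those of masses [rho_n / lambda_n]
    at the points [1 / lambda_n], which lie in a fixed compact interval because
    [lambda_n >= a_0 / 4]. *)

Section series_tools.
Variable R : realType.
Implicit Types (u v M : nat -> R).

Definition abs_summable u := cvgn (series (fun n => `|u n|)).

Lemma abs_summable_le u v :
  (forall n, `|u n| <= v n) -> cvgn (series v) -> abs_summable u.
Proof.
move=> uv cv; apply: series_le_cvg cv => //.
by move=> n; apply: le_trans (uv n).
Qed.

Lemma abs_summable_norm_le u v :
  abs_summable v -> (forall n, `|u n| <= `|v n|) -> abs_summable u.
Proof. by move=> sv uv; exact: abs_summable_le uv sv. Qed.

Lemma abs_summable_bounded u B :
  (forall N, \sum_(k < N) `|u k| <= B) -> abs_summable u.
Proof.
move=> uB; apply: nondecreasing_is_cvgn.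
  apply/nondecreasing_seqP => n; rewrite seriesSr lerDl.
  exact: normr_ge0.
exists B => _ [N _ <-]; rewrite seriesEord; exact: uB.
Qed.

Lemma abs_summable_cvg u : abs_summable u -> cvgn (series u).
Proof. exact: normed_cvg. Qed.

Lemma abs_summableZ k u : abs_summable u -> abs_summable (fun n => k * u n).
Proof.
move=> su; apply: (@abs_summable_le _ (`|k| *: (fun n => `|u n|))) => [n|].
  by rewrite normrM.
exact: is_cvg_seriesZ.
Qed.

Lemma abs_summableD u v :
  abs_summable u -> abs_summable v -> abs_summable (fun n => u n + v n).
Proof.
move=> su sv; apply: (@abs_summable_le _ ((fun n => `|u n|) + (fun n => `|v n|))).
  by move=> n; exact: ler_normD.
exact: is_cvg_seriesD.
Qed.

Lemma sumZ k u : abs_summable u ->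
  limn (series (fun n => k * u n)) = k * limn (series u).
Proof. by move=> /abs_summable_cvg su; exact: (lim_seriesZ k su). Qed.

Lemma sumD u v : abs_summable u -> abs_summable v ->
  limn (series (fun n => u n + v n)) = limn (series u) + limn (series v).
Proof. by move=> /abs_summable_cvg su /abs_summable_cvg sv; exact: lim_seriesD. Qed.

Lemma eq_sum u v : u =1 v -> limn (series u) = limn (series v).
Proof. by move=> /funext ->. Qed.

Lemma sum_recl u : abs_summable u ->
  limn (series u) = u 0%N + limn (series (fun n => u n.+1)).
Proof.
move=> /abs_summable_cvg cu; apply/cvg_lim => //.
rewrite -cvg_shiftS /=.
have -> : (fun n => series u n.+1) = (fun n => u 0%N + series (fun n => u n.+1) n).
  by apply/funext => n; rewrite !seriesEord /= big_ord_recl.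
apply: cvgD; first exact: cvg_cst.
have : cvgn (series (fun n => u n.+1)); last by [].
have -> : series (fun n => u n.+1) = (fun n => series u n.+1 - u 0%N).
  by apply/funext => n; rewrite !seriesEord /= big_ord_recl addrC addKr.
apply: is_cvgB; last exact: is_cvg_cst.
by apply/cvg_ex; case/cvg_ex: cu => l; rewrite -cvg_shiftS; exists l.
Qed.

Lemma abs_summable_shift u : abs_summable u -> abs_summable (fun n => u n.+1).
Proof.
rewrite /abs_summable => cu.
have -> : series (fun n => `|u n.+1|) = (fun n => series (fun n => `|u n|) n.+1 - `|u 0%N|).
  by apply/funext => n; rewrite !seriesEord /= big_ord_recl addrC addKr.
apply: is_cvgB; last exact: is_cvg_cst.
by apply/cvg_ex; case/cvg_ex: cu => l; rewrite -cvg_shiftS; exists l.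
Qed.

Lemma norm_tail_le u M K : (forall n, `|u n| <= M n) -> cvgn (series M) ->
  `|limn (series u) - series u K| <= limn (series M) - series M K.
Proof.
move=> uM cM; have cu := abs_summable_cvg (abs_summable_le uM cM).
have h : (fun n => `|series u n - series u K|) @ \oo -->
    `|limn (series u) - series u K|.
  by apply: cvg_norm; apply: cvgB => //; exact: cvg_cst.
have h' : (fun n => series M n - series M K) @ \oo -->
    limn (series M) - series M K.
  by apply: cvgB => //; exact: cvg_cst.
apply: (ler_cvg_to h h').
near=> n.
have Kn : (K <= n)%N by near: n; exact: nbhs_infty_ge.
rewrite !sub_series_geq//; apply: (le_trans (ler_norm_sum _ _ _)).
by apply: ler_sum => i _; exact: uM.
Unshelve. all: by end_near. Qed.

Lemma norm_sum_le u M : (forall n, `|u n| <= M n) -> cvgn (series M) ->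
  `|limn (series u)| <= limn (series M).
Proof.
move=> uM cM; have := norm_tail_le 0 uM cM.
by rewrite !seriesEord /= !big_ord0 !subr0.
Qed.

Lemma partial_sum_le u N : (forall n, 0 <= u n) -> cvgn (series u) ->
  \sum_(k < N) u k <= limn (series u).
Proof.
move=> u0 cu; have uu n : `|u n| <= u n by rewrite ger0_norm.
have := norm_tail_le N uu cu.
by move=> /(le_trans (normr_ge0 _)); rewrite subr_ge0 seriesEord.
Qed.

Lemma sum_ge0 u : (forall n, 0 <= u n) -> cvgn (series u) ->
  0 <= limn (series u).
Proof. by move=> u0 cu; have := partial_sum_le 0 u0 cu; rewrite big_ord0. Qed.

(** Dominated convergence for series along an arbitrary filter: cut at a rank beyond which the tail
    of [M] is below [e / 3], and pass to the limit in the finite sum. *)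
Lemma tannery (T : Type) (F : set_system T) {FF : ProperFilter F}
    (f : T -> nat -> R) u M :
  cvgn (series M) -> (\forall t \near F, forall n, `|f t n| <= M n) ->
  (forall n, f t n @[t --> F] --> u n) ->
  limn (series (f t)) @[t --> F] --> limn (series u).
Proof.
move=> cM fM fu.
have uM n : `|u n| <= M n.
  have h : `|f t n| @[t --> F] --> `|u n| by apply: cvg_norm; exact: fu.
  rewrite -(cvg_lim (@Rhausdorff R) h); apply: limr_le.
    by apply/cvg_ex; eexists; exact: h.
  by apply: filterS fM => t; exact.
apply/cvgrPdist_le => e e0; have e3 : 0 < e / 3 by rewrite divr_gt0.
have [K KM] : exists K, limn (series M) - series M K <= e / 3.
  have /cvgrPdist_le /(_ _ e3) [K _ KM] := cM.
  exists K; have := KM K (leqnn K); exact: le_trans (ler_norm _).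
have fK : (fun t => series (f t) K) @ F --> series u K.
  rewrite seriesEord; under eq_fun do rewrite seriesEord.
  by apply: cvg_big => [|i _]; [exact: add_continuous|exact: fu].
have /cvgrPdist_le /(_ _ e3) fK' := fK.
near=> t.
have h1 := le_trans (norm_tail_le K uM cM) KM.
have h2 : `|limn (series (f t)) - series (f t) K| <= e / 3.
  by apply: le_trans KM; apply: norm_tail_le => //; near: t.
have h3 : `|series u K - series (f t) K| <= e / 3 by near: t.
move: h1 h2 h3; rewrite !ler_norml => /andP[? ?] /andP[? ?] /andP[? ?].
by apply/andP; split; lra.
Unshelve. all: by end_near. Qed.

Lemma abs_summable0 : abs_summable (fun=> 0).
Proof. by apply: (@abs_summable_bounded _ 0) => N; rewrite big1// => i _; rewrite normr0. Qed.

Lemma abs_summable_big N (f : nat -> nat -> R) : (forall i, abs_summable (f i)) ->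
  abs_summable (fun n => \sum_(i < N) f i n).
Proof.
move=> sf; elim: N => [|N IH].
  by under eq_fun do rewrite big_ord0; exact: abs_summable0.
by under eq_fun do rewrite big_ord_recr; exact: abs_summableD.
Qed.

Lemma sum_big N (f : nat -> nat -> R) : (forall i, abs_summable (f i)) ->
  limn (series (fun n => \sum_(i < N) f i n)) = \sum_(i < N) limn (series (f i)).
Proof.
move=> sf; elim: N => [|N IH].
  rewrite big_ord0; apply/cvg_lim => //.
  have -> : series (fun n => \sum_(i < 0) f i n) = fun=> 0.
    by apply/funext => n; rewrite seriesEord /= big1// => i _; rewrite big_ord0.
  exact: cvg_cst.
rewrite big_ord_recr /= -IH -(sumD (@abs_summable_big N _ sf) (sf N)).
by apply: eq_sum => n; rewrite big_ord_recr.
Qed.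

(** The factor 2 is the bound of [1 / (1 - q)] for [q <= 1 / 2]. *)
Lemma geometric_tail (u : nat -> R) (C q : R) N : 0 <= q <= 1 / 2 ->
  (forall k, `|u k| <= C * q ^+ k) ->
  abs_summable u /\ `|limn (series u) - \sum_(k < N) u k| <= 2 * C * q ^+ N.
Proof.
move=> /andP[q0 q2] uC.
have q1 : `|q| < 1 by rewrite ger0_norm//; lra.
have cg := @is_cvg_geometric_series R C q q1.
have C0 : 0 <= C by have := le_trans (normr_ge0 _) (uC 0%N); rewrite expr0 mulr1.
split; first exact: abs_summable_le cg.
have := norm_tail_le N uC cg; rewrite [series u]seriesEord => /le_trans; apply.
have -> : limn (series (fun k => C * q ^+ k)) = C / (1 - q).
  by apply: cvg_lim => //; exact: cvg_geometric_series.
have q1' : q != 1 by rewrite lt_eqF//; lra.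
have -> : series (fun k => C * q ^+ k) N = C * (1 - q ^+ N) / (1 - q).
  by have /(congr1 (@^~ N)) := geometric_seriesE C q1'.
have -> : C / (1 - q) - C * (1 - q ^+ N) / (1 - q) = C * q ^+ N / (1 - q).
  by field; rewrite subr_eq0 eq_sym.
have CN : 0 <= C * q ^+ N by rewrite mulr_ge0// exprn_ge0.
rewrite ler_pdivrMr; last lra.
nra.
Qed.

End series_tools.

(** * Uniqueness of generalized power series and of moments *)

Section uniqueness.
Variable R : realType.

(** Induction on the sorted exponents: dividing by the smallest power [x^e0] and letting [x] tend to
    0 isolates its coefficient, which a bound of order [x^E] with [E > e0] forces to vanish; then
    [e0] is dropped. *)
Lemma powR_comb_coef0 (s : seq R) (c : R -> R) (D E : R) :
  sorted <%R s ->
  (\forall x \near 0^'+, `|\sum_(e <- s) c e * x `^ e| <= D * x `^ E) ->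
  forall e, e \in s -> e < E -> c e = 0.
Proof.
elim: s => // e0 s IH /= ps bound.
have gte0 e : e \in s -> e0 < e.
  by move: ps; rewrite (path_sortedE lt_trans) => /andP[/allP h _]; exact: h.
have [Ee0|e0E] := leP E e0.
  move=> e; rewrite inE => /predU1P[->|es] eE; first by have := lt_le_trans eE Ee0; rewrite ltxx.
  by have := lt_trans (le_lt_trans Ee0 (gte0 _ es)) eE; rewrite ltxx.
have ce0 : c e0 = 0.
  have lim1 : (fun x : R => `|c e0 + \sum_(e <- s) c e * x `^ (e - e0)|) x @[x --> 0^'+]
      --> `|c e0 + \sum_(e <- s) (if e \in s then 0 else 0)|.
    apply: cvg_norm; apply: cvgD; first exact: cvg_cst.
    rewrite big_seq; under eq_fun do rewrite big_seq.
    apply: cvg_big => [|e es]; first exact: add_continuous.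
    rewrite es -[X in _ --> X](mulr0 (c e)); apply: cvgMr.
    by apply: powR_cvg0; rewrite subr_gt0 gte0.
  have lim2 : (fun x : R => D * x `^ (E - e0)) x @[x --> 0^'+] --> D * 0.
    by apply: cvgMr; apply: powR_cvg0; rewrite subr_gt0.
  apply/eqP; rewrite -normr_le0.
  have -> : c e0 = c e0 + \sum_(e <- s) (if e \in s then 0 else 0).
    by rewrite big1 ?addr0// => i _; case: ifP.
  rewrite -[leRHS](mulr0 D); apply: (ler_cvg_to lim1 lim2).
  near=> x; have x0 : 0 < x by near: x; exact: nbhs_right_gt.
  have xe : 0 < x `^ e0 by rewrite powR_gt0.
  rewrite -(ler_pM2r xe) -mulrA -powRD ?(gt_eqF x0) ?implybT// subrK.
  rewrite -[X in _ * X](ger0_norm (ltW xe)) -normrM mulrDl mulr_suml.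
  have : `|\sum_(e <- e0 :: s) c e * x `^ e| <= D * x `^ E by near: x.
  rewrite big_cons; congr (`| _ + _ | <= _); apply: eq_bigr => e _.
  by rewrite -mulrA -powRD ?(gt_eqF x0) ?implybT// subrK.
move=> e; rewrite inE => /predU1P[->|es eE]; first by rewrite ce0.
apply: IH => //; first exact: path_sorted ps.
apply: filterS bound => x; by rewrite big_cons ce0 mul0r add0r.
Unshelve. all: by end_near. Qed.

(** Once [x <= 1] and [Q x^al <= 1 / 2], the geometric tail is a multiple of [x^(al N)], hence
    bounded by the same multiple of [x^E]. *)
Lemma powR_series_tail (a : nat -> R) (al C Q E : R) N : 0 < al -> 0 < Q ->
  (forall k, `|a k| <= C * Q ^+ k) -> E <= al * N%:R ->
  \forall x \near 0^'+,
    `|limn (series (fun k => a k * (x `^ al) ^+ k)) -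
      \sum_(k < N) a k * x `^ (al * k%:R)| <= 2 * C * Q ^+ N * x `^ E.
Proof.
move=> al0 Q0 aC EN.
have C0 : 0 <= C by have := le_trans (normr_ge0 _) (aC 0%N); rewrite expr0 mulr1.
have /cvgrPdist_le/(_ ((2 * Q)^-1)) := @powR_cvg0 R _ al0.
rewrite invr_gt0 mulr_gt0// => /(_ isT) small.
near=> x.
have x0 : 0 < x by near: x; exact: nbhs_right_gt.
have x1 : x <= 1 by near: x; apply: nbhs_right_le.
have y0 : 0 <= x `^ al by rewrite powR_ge0.
have yQ : Q * x `^ al <= 1 / 2.
  have : `|0 - x `^ al| <= (2 * Q)^-1 by near: x.
  rewrite sub0r normrN ger0_norm// invfM => h.
  by rewrite mulrC -ler_pdivlMr// mul1r.
have hq : 0 <= Q * x `^ al <= 1 / 2 by rewrite yQ mulr_ge0// ltW.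
have [] := @geometric_tail R (fun k => a k * (x `^ al) ^+ k) C (Q * x `^ al) N hq.
  move=> k; rewrite exprMn normrM mulrA; apply: ler_pM => //.
  by rewrite ger0_norm// exprn_ge0.
move=> _; have -> : \sum_(k < N) a k * (x `^ al) ^+ k =
    \sum_(k < N) a k * x `^ (al * k%:R).
  by apply: eq_bigr => k _; rewrite powRrM powR_mulrn.
move=> /le_trans; apply; rewrite exprMn -!mulrA ler_wpM2l// ler_wpM2l//.
rewrite ler_wpM2l ?exprn_ge0 ?(ltW Q0)//.
rewrite -powR_mulrn// -powRrM; apply: ger_powR => //.
by rewrite x0.
Unshelve. all: by end_near. Qed.

(* Both series are sums of real powers of [x] with discrete exponents, so the
   total coefficient of each power is determined. *)
Lemma powR_series_unique (a b : nat -> R) (al be C Q : R) :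
  0 < al -> 0 < be -> 0 < Q ->
  (forall k, `|a k| <= C * Q ^+ k) -> (forall k, `|b k| <= C * Q ^+ k) ->
  (\forall x \near 0^'+,
     limn (series (fun k => a k * (x `^ al) ^+ k)) =
     limn (series (fun k => b k * (x `^ be) ^+ k))) ->
  forall k, a k != 0 -> exists2 j, be * j%:R = al * k%:R & a k = b j.
Proof.
move=> al0 be0 Q0 aC bC ab k ak.
(* With [N] terms the remainder of the second series is of order [x^(al (k + 1))], like that of the
   first one. *)
have [N alN] : exists N, al * k.+1%:R <= be * N%:R.
  exists (Num.bound (al * k.+1%:R / be)); rewrite [leRHS]mulrC -ler_pdivrMr//.
  apply/ltW/archi_boundP.
  by rewrite divr_ge0 ?mulr_ge0// ltW.
(* [cf] collects the terms of a truncation that share the exponent [e], and [s] lists the exponents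
   of both truncations without repetition: the difference becomes one combination of distinct
   powers. *)
pose cf (x : nat -> R) (g : R) (e : R) n := \sum_(i < n | g * i%:R == e) x i.
pose s := sort <=%R (undup ([seq al * i%:R | i <- iota 0 k.+1] ++ [seq be * i%:R | i <- iota 0 N])).
have regroup (x : nat -> R) g n (y : R) : {subset [seq g * i%:R | i <- iota 0 n] <= s} ->
    \sum_(i < n) x i * y `^ (g * i%:R) = \sum_(e <- s) cf x g e n * y `^ e.
  move=> sub; under [RHS]eq_bigr do rewrite /cf mulr_suml.
  rewrite (exchange_big_dep xpredT)//=; apply: eq_bigr => i _.
  have us : uniq s by rewrite sort_uniq undup_uniq.
  have si : g * (val i)%:R \in s.
    by apply: sub; apply/mapP; exists (val i) => //; rewrite mem_iota add0n ltn_ord.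
  rewrite big_mkcond (bigD1_seq _ si us)//= eqxx big1 ?addr0// => e.
  by rewrite eq_sym => /negPf ->.
have suba : {subset [seq al * i%:R | i <- iota 0 k.+1] <= s}.
  by move=> e es; rewrite mem_sort mem_undup mem_cat es.
have subb : {subset [seq be * i%:R | i <- iota 0 N] <= s}.
  by move=> e es; rewrite mem_sort mem_undup mem_cat es orbT.
have cfE : cf a al (al * k%:R) k.+1 - cf b be (al * k%:R) N = 0.
  apply: (@powR_comb_coef0 s (fun e => cf a al e k.+1 - cf b be e N)
    (2 * C * Q ^+ k.+1 + 2 * C * Q ^+ N) (al * k.+1%:R)).
  - rewrite lt_sorted_uniq_le sort_uniq undup_uniq/=.
    by apply: sort_sorted; exact: le_total.
  - have ha := powR_series_tail al0 Q0 aC (lexx (al * k.+1%:R)).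
    have hb := powR_series_tail be0 Q0 bC alN.
    near=> x.
    have -> : \sum_(e <- s) (cf a al e k.+1 - cf b be e N) * x `^ e =
       \sum_(i < k.+1) a i * x `^ (al * i%:R) - \sum_(i < N) b i * x `^ (be * i%:R).
      rewrite (regroup a al)// (regroup b be)// -sumrB.
      by apply: eq_bigr => e _; rewrite mulrBl.
    have h1 : `|limn (series (fun k => a k * (x `^ al) ^+ k)) -
      \sum_(i < k.+1) a i * x `^ (al * i%:R)| <= 2 * C * Q ^+ k.+1 * x `^ (al * k.+1%:R) by near: x.
    have h2 : `|limn (series (fun k => b k * (x `^ be) ^+ k)) -
      \sum_(i < N) b i * x `^ (be * i%:R)| <= 2 * C * Q ^+ N * x `^ (al * k.+1%:R) by near: x.
    have h3 : limn (series (fun k => a k * (x `^ al) ^+ k)) =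
      limn (series (fun k => b k * (x `^ be) ^+ k)) by near: x.
    rewrite h3 in h1; rewrite mulrDl; move: h1 h2.
    rewrite !ler_norml => /andP[? ?] /andP[? ?]; apply/andP; split; lra.
  - by apply: suba; apply/mapP; exists k => //; rewrite mem_iota add0n ltnSn.
  - by rewrite ltr_pM2l// ltr_nat.
have inj g (g0 : 0 < g) i j : g * i%:R = g * j%:R :> R -> i = j.
  by move=> /(mulfI (lt0r_neq0 g0)) /eqP; rewrite eqr_nat => /eqP.
have cfa : cf a al (al * k%:R) k.+1 = a k.
  rewrite /cf (big_pred1 ord_max)// => i; apply/eqP/eqP => [/(inj _ al0) ik|->//].
  exact: val_inj.
move/eqP: cfE; rewrite cfa subr_eq0 => /eqP akE.
(* If no exponent [be j] equals [al k], the second series contributes nothing there and [a k] would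
   vanish. *)
case: (pickP (fun i : 'I_N => be * i%:R == al * k%:R)) => [j /eqP jk|none].
  exists (val j) => //; rewrite akE /cf (big_pred1 j)// => i.
  apply/eqP/eqP => [|-> //]; rewrite -jk => /(inj _ be0) ij; exact: val_inj.
by move: ak; rewrite akE /cf big_pred0 ?eqxx.
Unshelve. all: by end_near. Qed.

(** Comparison with the zero series at [al = be = 1]: a nonzero [a k] would have to equal one of its
    coefficients. *)
Lemma pseries_eq0 (a : nat -> R) (C Q : R) : 0 < Q ->
  (forall k, `|a k| <= C * Q ^+ k) ->
  (\forall x \near 0^'+, limn (series (fun k => a k * x ^+ k)) = 0) ->
  forall k, a k = 0.
Proof.
move=> Q0 aC a0 k; apply/eqP/negPn/negP => ak.
have [//||j _ akb] := @powR_series_unique a (fun=> 0) 1 1 C Q ltr01 ltr01 Q0 aC _ _ k ak.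
- by move=> i; rewrite normr0; exact: le_trans (aC i).
- near=> x; have x0 : 0 < x by near: x; exact: nbhs_right_gt.
  rewrite powRr1 ?(ltW x0)// (_ : (fun k => 0 * x ^+ k) = (fun=> 0)); last first.
    by apply/funext => i; rewrite mul0r.
  have -> : limn (series (fun k => a k * x ^+ k)) = 0 by near: x.
  rewrite (_ : series (fun=> 0) = fun=> 0) ?lim_cst//.
  by apply/funext => n; rewrite seriesEord /= big1.
- by rewrite akb eqxx in ak.
Unshelve. all: by end_near. Qed.

Lemma sum_horner (c x : nat -> R) (X : R) (p : {poly R}) :
  abs_summable c -> (forall n, `|x n| <= X) ->
  limn (series (fun n => c n * p.[x n])) =
  \sum_(i < size p) p`_i * limn (series (fun n => c n * x n ^+ i)).
Proof.
move=> sc xX; have X0 : 0 <= X := le_trans (normr_ge0 _) (xX 0%N).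
have sci i : abs_summable (fun n => c n * x n ^+ i).
  apply: (@abs_summable_le _ _ (fun n => X ^+ i * `|c n|)) => [n|].
    by rewrite normrM mulrC ler_wpM2r// normrX lerXn2r ?nnegrE.
  exact: is_cvg_seriesZ.
under [RHS]eq_bigr => i _ do rewrite -(sumZ p`_i (sci i)).
rewrite -(@sum_big _ _ (fun i n => p`_i * (c n * x n ^+ i))).
  apply: eq_sum => n; rewrite horner_coef mulr_sumr; apply: eq_bigr => i _.
  by rewrite mulrCA.
by move=> i; exact: abs_summableZ.
Qed.

(* The atom at [z] is the limit of the integrals of the polynomials
   [(1 - ((x - z) / X) ^ 2) ^ j], which peak at [z]. *)
Lemma moments_unique (c c' x x' : nat -> R) (X z : R) :
  0 < X -> 0 <= z <= X -> abs_summable c -> abs_summable c' ->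
  (forall n, 0 <= x n <= X) -> (forall n, 0 <= x' n <= X) ->
  (forall k, limn (series (fun n => c n * x n ^+ k)) =
             limn (series (fun n => c' n * x' n ^+ k))) ->
  limn (series (fun n => c n * (x n == z)%:R)) =
  limn (series (fun n => c' n * (x' n == z)%:R)).
Proof.
move=> X0 /andP[z0 zX] sc sc' xX xX' mom.
(* For [y] and [z] in [[0, X]] one has [|y - z| <= X], so [p] takes values in [[0, 1]] there and is
   1 only at [z]; its powers converge to the indicator of [z]. *)
pose p : {poly R} := 1 - X ^- 2 *: ('X - z%:P) ^+ 2.
have pE y : p.[y] = 1 - ((y - z) / X) ^+ 2.
  by rewrite /p hornerD hornerN hornerZ horner_exp hornerXsubC hornerC exprMn exprVn mulrC.
have lim (d y : nat -> R) : abs_summable d -> (forall n, 0 <= y n <= X) ->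
    limn (series (fun n => d n * (p ^+ j).[y n])) @[j --> \oo] -->
    limn (series (fun n => d n * (y n == z)%:R)).
  move=> sd yX; apply: (@tannery _ _ _ _ _ _ (fun n => `|d n|)) => //.
    apply: nearW => j n; rewrite normrM ler_piMr// horner_exp normrX.
    apply: exprn_ile1 => //; rewrite pE ler_norml.
    have /andP[y0 y1] := yX n.
    have w2 : ((y n - z) / X) ^+ 2 <= 1.
      rewrite -real_normK ?num_real// exprn_ile1// normf_div (gtr0_norm X0).
      by rewrite ler_pdivrMr// mul1r ler_norml; apply/andP; split; lra.
    have w0 : 0 <= ((y n - z) / X) ^+ 2 by rewrite sqr_ge0.
    by apply/andP; split; lra.
  move=> n; apply: cvgMr; have [->|yz] := eqVneq (y n) z.
    under eq_fun do rewrite horner_exp pE subrr mul0r expr0n subr0 expr1n.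
    exact: cvg_cst.
  under eq_fun do rewrite horner_exp pE.
  have w0 : 0 < ((y n - z) / X) ^+ 2.
    by rewrite exprn_even_gt0//= mulf_neq0 ?subr_eq0// invr_neq0// gt_eqF.
  have w2 : ((y n - z) / X) ^+ 2 <= 1.
    have /andP[y0 y1] := yX n.
    rewrite -real_normK ?num_real// exprn_ile1// normf_div (gtr0_norm X0).
    by rewrite ler_pdivrMr// mul1r ler_norml; apply/andP; split; lra.
  by apply: cvg_expr; rewrite ger0_norm; lra.
have := lim _ _ sc xX; have := lim _ _ sc' xX'.
have -> : (fun j => limn (series (fun n => c' n * (p ^+ j).[x' n]))) =
   (fun j => limn (series (fun n => c n * (p ^+ j).[x n]))).
  apply/funext => j; rewrite (@sum_horner c' x' X)//; last first.
    by move=> n; have /andP[? ?] := xX' n; rewrite ger0_norm.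
  rewrite (@sum_horner c x X)//; last first.
    by move=> n; have /andP[? ?] := xX n; rewrite ger0_norm.
  by apply: eq_bigr => i _; rewrite mom.
by move=> h1 h2; exact: (cvg_unique _ h2 h1).
Qed.

End uniqueness.

(** * Gamma and Beta integrals *)

Section lebesgue_affine.
Variable R : realType.
Local Notation mu := (@lebesgue_measure R).
Local Open Scope ereal_scope.

(** Uniqueness of the Lebesgue measure: the scaled pushforward under the affine map gives half-open
    intervals their length. *)
Lemma lebesgue_measure_affine (c d : R) (c0 : (0 < c)%R) A : measurable A ->
  c%:E * mu ((fun x => c * x + d)%R @^-1` A) = mu A.
Proof.
have mphi : measurable_fun [set: measurableTypeR R]
    ((fun x => c * x + d)%R : _ -> measurableTypeR R).
  apply: measurable_funD; last exact: measurable_cst.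
  apply: measurable_funM; [exact: measurable_cst|exact: measurable_id].
pose k : {nonneg R} := NngNum (ltW c0).
move=> mA.
rewrite -[LHS]/(pushforward (mscale k mu) ((fun x => c * x + d)%R : _ -> measurableTypeR R) A).
apply/esym; apply: lebesgue_measure_unique => //.
move=> _ [[a b]] _ <-.
rewrite /= /pushforward /mscale /=.
have -> : (fun x => c * x + d)%R @^-1` `]a, b] = `]((a - d) / c)%R, ((b - d) / c)%R]%classic.
  apply/seteqP; split => x /=; rewrite !in_itv/= => /andP[xa xb]; apply/andP; split.
  - by rewrite ltr_pdivrMr// ltrBlDr mulrC.
  - by rewrite ler_pdivlMr// lerBrDr mulrC.
  - by rewrite -ltrBlDr mulrC -ltr_pdivrMr.
  - by rewrite -lerBrDr mulrC -ler_pdivlMr.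
rewrite !lebesgue_measure_itv /= !lte_fin ltr_pM2r ?invr_gt0// ltrBlDr subrK.
case: ifP => _; last by rewrite mule0.
by rewrite -!EFinB -EFinM; congr EFin; field; rewrite gt_eqF.
Qed.

Lemma integral_affine (c d : R) (f : R -> \bar R) : (0 < c)%R ->
  measurable_fun setT f -> (forall x, 0 <= f x) ->
  c%:E * \int[mu]_x f (c * x + d)%R = \int[mu]_x f x.
Proof.
move=> c0 mf f0.
have mphi : measurable_fun [set: measurableTypeR R]
    ((fun x => c * x + d)%R : _ -> measurableTypeR R).
  apply: measurable_funD; last exact: measurable_cst.
  apply: measurable_funM; [exact: measurable_cst|exact: measurable_id].
pose k : {nonneg R} := NngNum (ltW c0).
have mfphi : measurable_fun setT (fun x => f (c * x + d)%R).
  exact: (measurableT_comp mf mphi).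
rewrite -(@ge0_integral_mscale _ _ _ mu setT measurableT k)//.
have := @ge0_integral_pushforward _ _ _ _ R _ mphi (mscale k mu) setT f measurableT mf.
rewrite preimage_setT => <-; last by move=> x _; exact: f0.
apply: eq_measure_integral => A mA _.
exact: lebesgue_measure_affine.
Qed.

(** Tonelli, then invariance of the inner integral under translation by [s]. *)
Lemma tonelli_convolution (K F : R -> \bar R) :
  measurable_fun setT K -> measurable_fun setT F ->
  (forall x, 0 <= K x) -> (forall x, 0 <= F x) ->
  \int[mu]_t \int[mu]_s (K (t - s)%R * F s) = (\int[mu]_t K t) * (\int[mu]_s F s).
Proof.
move=> mK mF K0 F0.
rewrite (@fubini_tonelli _ _ _ _ R mu mu (fun z => K (z.1 - z.2)%R * F z.2)); last 2 first.
- apply: emeasurable_funM.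
    apply: (measurableT_comp mK).
    by apply: measurable_funB; [exact: measurable_fst|exact: measurable_snd].
  apply: (measurableT_comp mF); exact: measurable_snd.
- by move=> z; rewrite mule_ge0.
under eq_integral => s _.
  rewrite /= ge0_integralZr//; last first.
    apply: (measurableT_comp mK).
    by apply: measurable_funB; [exact: measurable_id|exact: measurable_cst].
  have -> : \int[mu]_x K (x - s)%R = \int[mu]_x K x.
    rewrite -(@integral_affine 1 (- s) K)// mul1e.
    by apply: eq_integral => x _; rewrite mul1r.
  over.
by rewrite ge0_integralZl// integral_ge0.
Qed.

Lemma measurable_reflect (k : R -> R) (t : R) :
  measurable_fun (`]0%R, +oo[ : set R) k ->
  measurable_fun (`]0%R, t[ : set R) (fun s => k (t - s)%R).
Proof.
move=> mk; apply: (@measurable_comp _ _ _ _ _ _ (`]0%R, +oo[ : set R) k) => //.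
  move=> _ [s + <-] /=; rewrite !in_itv/= => /andP[_ st].
  by rewrite andbT subr_gt0.
by apply: measurable_funB; [exact: measurable_cst|exact: measurable_id].
Qed.

Lemma measurable_sub_itv (f : R -> R) (t : R) :
  measurable_fun (`]0%R, +oo[ : set R) f ->
  measurable_fun (`]0%R, t[ : set R) f.
Proof.
apply: measurable_funS => //.
by move=> s /=; rewrite !in_itv/= andbT => /andP[].
Qed.

(** Weighted and extended by 0, both functions form a convolution on the whole line, because
    [e^(-t) = e^(-(t - s)) e^(-s)]. The transform is taken at frequency 1 only; other frequencies
    are reached later by rescaling time. *)
Lemma laplace_convolution (k f : R -> R) :
  measurable_fun (`]0%R, +oo[ : set R) k -> measurable_fun (`]0%R, +oo[ : set R) f ->
  (forall x, 0 < x -> 0 <= k x)%R -> (forall x, 0 < x -> 0 <= f x)%R ->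
  \int[mu]_(t in `]0%R, +oo[)
     ((expR (- t))%:E * \int[mu]_(s in `]0%R, t[) (k (t - s) * f s)%:E) =
  (\int[mu]_(t in `]0%R, +oo[) (k t * expR (- t))%:E) *
  (\int[mu]_(t in `]0%R, +oo[) (f t * expR (- t))%:E).
Proof.
move=> mk mf k0 f0.
have me : measurable_fun [set: R] (fun x : R => expR (- x)).
  by apply: measurableT_comp => //; exact: measurable_funX.
pose ext (g : R -> R) := (fun x => (g x * expR (- x))%:E) \_ `]0%R, +oo[.
have ext_in g x : (0 < x)%R -> ext g x = (g x * expR (- x))%:E.
  by move=> x0; rewrite /ext patchE mem_set//= in_itv/= andbT.
have ext_out g x : (x <= 0)%R -> ext g x = 0.
  move=> x0; rewrite /ext patchE memNset//= in_itv/= andbT.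
  by apply/negP; rewrite -leNgt.
have mext g : measurable_fun (`]0%R, +oo[ : set R) g -> measurable_fun setT (ext g).
  move=> mg; apply/(measurable_restrictT _ _).1 => //.
  by apply/measurable_EFinP; apply: measurable_funM => //; exact: measurable_funTS.
have ext0 g : (forall x, 0 < x -> 0 <= g x)%R -> forall x, 0 <= ext g x.
  move=> g0 x; rewrite /ext patchE; case: ifPn => //.
  by rewrite inE/= in_itv/= andbT => x0; rewrite lee_fin mulr_ge0 ?g0 ?expR_ge0.
rewrite [X in _ = X * _]integral_mkcond [X in _ = _ * X]integral_mkcond.
rewrite -[RHS](tonelli_convolution (mext _ mk) (mext _ mf) (ext0 _ k0) (ext0 _ f0)).
rewrite integral_mkcond; apply: eq_integral => t _.
rewrite patchE; case: ifPn => [|]; rewrite ?inE/= ?notin_setE/= in_itv/= andbT => t0.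
  rewrite -ge0_integralZl//.
  - rewrite integral_mkcond; apply: eq_integral => s _.
    rewrite patchE.
    case: ifPn => [|]; rewrite ?inE/= ?notin_setE/= in_itv/=.
      move=> /andP[s0 st]; rewrite !ext_in ?subr_gt0//.
      rewrite -!EFinM; congr EFin.
      rewrite (_ : (- t = - (t - s) - s)%R); last by ring.
      by rewrite expRD; ring.
    move=> /negP; rewrite negb_and -!leNgt => /orP[s0|ts].
      by rewrite (ext_out f)// mule0.
    by rewrite (ext_out k) ?mul0e// subr_le0.
  - apply/measurable_EFinP; apply: measurable_funM.
      exact: measurable_reflect.
    exact: measurable_sub_itv.
  - move=> s /=; rewrite in_itv/= => /andP[s0 st].
    by rewrite lee_fin mulr_ge0 ?k0 ?f0// subr_gt0.
move/negP: t0; rewrite -leNgt => t0; apply/esym/integral0_eq => s _.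
have [s0|s0] := ltP 0%R s; last by rewrite (ext_out f)// mule0.
by rewrite (ext_out k) ?mul0e// subr_le0 (le_trans t0)// ltW.
Qed.

End lebesgue_affine.

Section gamma_beta.
Variable R : realType.
Local Notation mu := (@lebesgue_measure R).
Implicit Types a b t : R.

Lemma measurable_powR_sub1 a (D : set R) : measurable_fun D (fun x : R => x `^ (a - 1)).
Proof. exact: measurable_funTS. Qed.

Lemma measurable_expRN (D : set R) : measurable_fun D (fun x : R => expR (- x)).
Proof. by apply: measurable_funTS; apply: measurableT_comp. Qed.

Lemma measurable_gamma_integrand a (D : set R) :
  measurable_fun D (fun x : R => (x `^ (a - 1) * expR (- x))%:E).
Proof.
apply/measurable_EFinP; apply: measurable_funM.
  exact: measurable_powR_sub1.
exact: measurable_expRN.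
Qed.

Lemma gamma_integrand_ge0 a (x : R) : (0 <= (x `^ (a - 1) * expR (- x))%:E)%E.
Proof. by rewrite lee_fin mulr_ge0 ?powR_ge0 ?expR_ge0. Qed.

Lemma integral_itvcc_deriv (f F : R -> R) a b : a < b ->
  {in `[a, b], forall x : R, is_derive x 1 F (f x)} ->
  {within `[a, b], continuous f} ->
  (\int[mu]_(x in `[a, b]) (f x)%:E = (F b)%:E - (F a)%:E)%E.
Proof.
move=> ab dF cf.
have cF x : x \in `[a, b] -> {for x, continuous F}.
  move=> /dF [dFx _]; exact/differentiable_continuous/derivable1_diffP.
apply: continuous_FTC2 => //.
- split.
  + by move=> x xab; have /dF[] : x \in `[a, b] by exact: subset_itv_oo_cc.
  + by apply/cvg_at_right_filter/cF; rewrite in_itv/= lexx ltW.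
  + by apply/cvg_at_left_filter/cF; rewrite in_itv/= lexx ltW.
- move=> x xab; have /dF[_ <-] : x \in `[a, b] by exact: subset_itv_oo_cc.
  by rewrite derive1E.
Qed.

Lemma continuous_powR a (x : R) : 0 < x -> {for x, continuous (fun x => x `^ a)}.
Proof.
move=> x0; apply/differentiable_continuous/derivable1_diffP.
by apply: derivable_powR; rewrite in_itv/= x0.
Qed.

(** The intervals []1 / (n + 1), 1]] exhaust []0, 1]], and on each of them the primitive [x^a / a]
    is regular up to the ends; monotone convergence then handles the singularity at 0. *)
Lemma integral_powR_itv01 a : 0 < a ->
  (\int[mu]_(x in `]0%R, 1%R]) (x `^ (a - 1))%:E <= (a^-1)%:E)%E.
Proof.
move=> a0.
pose F n : set R := `]n.+1%:R^-1, 1]%classic.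
have bigF : \bigcup_n F n = `]0, 1]%classic.
  apply/seteqP; split => x /=.
    move=> [n _]; rewrite /F /= !in_itv/= => /andP[nx x1].
    by rewrite x1 andbT (lt_trans _ nx)// invr_gt0.
  rewrite in_itv/= => /andP[x0 x1].
  exists (Num.bound x^-1) => //; rewrite /F /= in_itv/= x1 andbT.
  rewrite invf_plt ?posrE//.
  by rewrite (lt_le_trans (archi_boundP _)) ?invr_ge0 ?(ltW x0)// ler_nat.
rewrite -bigF.
have cvgF : (\int[mu]_(x in F i) (x `^ (a - 1))%:E @[i --> \oo] -->
    \int[mu]_(x in \bigcup_i F i) (x `^ (a - 1))%:E)%E.
  apply: ge0_nondecreasing_set_cvg_integral => //.
  - move=> m n mn; rewrite subsetEset => x; rewrite /F /= !in_itv/= => /andP[mx x1].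
    rewrite x1 andbT (le_lt_trans _ mx)// lef_pV2 ?posrE// ler_nat ltnS//.
  - by move=> i; exact: measurable_itv.
  - by move=> i; apply/measurable_EFinP; exact: measurable_powR_sub1.
  - by move=> i x _; rewrite lee_fin powR_ge0.
rewrite -(cvg_lim (@ereal_hausdorff R) cvgF); apply: lime_le.
  by apply/cvg_ex; eexists; exact: cvgF.
apply: nearW => -[|n].
  rewrite /F invr1 set_itvoc0 integral_set0 lee_fin invr_ge0 ltW//.
have e0 : 0 < n.+2%:R^-1 :> R by rewrite invr_gt0.
have e1 : n.+2%:R^-1 < 1 :> R by rewrite invf_lt1// ltr1n.
rewrite /F integral_itv_obnd_cbnd//.
  rewrite (@integral_itvcc_deriv _ (fun x => a^-1 * x `^ a) _ _ e1).
  - rewrite powR1 mulr1 -EFinB lee_fin gerBl mulr_ge0 ?powR_ge0// invr_ge0 ltW//.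
  - move=> x; rewrite in_itv/= => /andP[ex x1].
    have x0 : 0 < x by exact: lt_le_trans ex.
    have := is_derive1_powR a x0 => dx.
    rewrite -[X in is_derive _ _ _ X](mulKf (lt0r_neq0 a0)).
    exact: is_deriveZ.
  - apply: continuous_in_subspaceT => x; rewrite inE/= in_itv/= => /andP[ex x1].
    by apply: continuous_powR; exact: lt_le_trans ex.
by apply/measurable_EFinP; exact: measurable_powR_sub1.
Qed.

Lemma integral_gamma_lty a : 0 < a ->
  (\int[mu]_(x in `]0%R, +oo[) (x `^ (a - 1) * expR (- x))%:E < +oo)%E.
Proof.
move=> a0.
have -> : `]0, +oo[%classic = `]0, 1] `|` `]1, +oo[ :> set R.
  apply/seteqP; split => x /=; rewrite !in_itv/= !andbT.
    by move=> ->; case: (leP x 1); [left|right].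
  by move=> [/andP[]//|]; apply: lt_trans.
rewrite ge0_integral_setU//=; last 3 first.
- exact: measurable_gamma_integrand.
- by move=> x _; exact: gamma_integrand_ge0.
- apply/disj_setPS => x /= []; rewrite !in_itv/= andbT => /andP[_ x1].
  by rewrite ltNge x1.
apply: lte_add_pinfty.
  apply: (le_lt_trans _ (ltry a^-1)); apply: le_trans (integral_powR_itv01 a0).
  apply: ge0_le_integral => //.
  - by move=> x _; exact: gamma_integrand_ge0.
  - exact: measurable_gamma_integrand.
  - by apply/measurable_EFinP; exact: measurable_powR_sub1.
  - move=> x /=; rewrite in_itv/= => /andP[x0 _].
    by rewrite lee_fin ler_piMr ?powR_ge0// -expR0 ler_expR oppr_le0 ltW.
(* From [ln y <= y] at [y = x / (2 a)] one gets [x^a <= (2 a)^a e^(x / 2)]; the extra factor 2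
   undoes the normalisation of the exponential density of rate [1 / 2]. *)
pose C := (2 * a) `^ a * 2.
apply: (@le_lt_trans _ _ (\int[mu]_(x in `]1%R, +oo[) (C%:E * (exponential_pdf (1/2) x)%:E))%E).
  apply: ge0_le_integral => //.
  - by move=> x _; exact: gamma_integrand_ge0.
  - exact: measurable_gamma_integrand.
  - apply/measurable_EFinP; apply: measurable_funM => //.
    by apply: measurable_funTS; exact: measurable_exponential_pdf.
  - move=> x /=; rewrite in_itv/= andbT => x1.
    rewrite lee_fin exponential_pdfE; last lra.
    have x0 : 0 < x by lra.
    rewrite /C.
    have h1 : x `^ (a - 1) <= x `^ a by apply: ler_powR; lra.
    have h2 : x `^ a <= expR (x / 2) * (2 * a) `^ a.
      have a2 : 0 < 2 * a by lra.
      rewrite /powR !gt_eqF// -expRD ler_expR.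
      have xa : 0 < x / (2 * a) by rewrite divr_gt0.
      have := ltW (ln_sublinear xa).
      rewrite ln_div ?posrE// => lxa.
      have : a * (ln x - ln (2 * a)) <= a * (x / (2 * a)) by rewrite ler_pM2l.
      have -> : a * (x / (2 * a)) = x / 2 by field; rewrite gt_eqF.
      by rewrite mulrBr; lra.
    have -> : (2 * a) `^ a * 2 * (1 / 2 * expR (- (1 / 2) * x)) =
        (expR (x / 2) * (2 * a) `^ a) * expR (- x).
      rewrite [in RHS]mulrAC -expRD (_ : x / 2 - x = - (1 / 2) * x); last by field.
      by field.
    by rewrite ler_pM2r ?expR_gt0// (le_trans h1).
have mE : measurable_fun (`]1%R, +oo[ : set R) (fun x : R => (exponential_pdf (1 / 2) x)%:E).
  by apply/measurable_EFinP; apply: measurable_funTS; exact: measurable_exponential_pdf.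
have E0 (x : R) : `]1%R, +oo[%classic x -> (0 <= (exponential_pdf (1 / 2) x)%:E)%E.
  by move=> _; rewrite lee_fin exponential_pdf_ge0//; lra.
have C0 : (0 <= C%:E)%E by rewrite lee_fin mulr_ge0// powR_ge0.
rewrite ge0_integralZl//.
apply: lte_mul_pinfty => //.
have half0 : 0 < 1 / 2 :> R by lra.
apply: (@le_lt_trans _ _ (\int[mu]_x (exponential_pdf (1/2) x)%:E)%E).
  apply: ge0_subset_integral => //.
    by apply/measurable_EFinP; exact: measurable_exponential_pdf.
  by move=> x _; rewrite lee_fin exponential_pdf_ge0// ltW.
by rewrite integral_exponential_pdf// ltry.
Qed.

Lemma Gamma_EFin a : 0 < a ->
  (\int[mu]_(x in `]0%R, +oo[) (x `^ (a - 1) * expR (- x))%:E = (Gamma a)%:E)%E.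
Proof.
move=> a0; rewrite /Gamma /Rintegral fineK// ge0_fin_numE ?integral_gamma_lty//.
by apply: integral_ge0 => x _; exact: gamma_integrand_ge0.
Qed.

(** Keep only the part of the integral over [[X, X + 1]]. Since [X] is free, this shows that [Gamma]
    outgrows every geometric sequence; [X = 1] gives positivity. *)
Lemma Gamma_ge a X : 0 < a -> 0 < X ->
  X `^ a * (expR (- (X + 1)) / (X + 1)) <= Gamma a.
Proof.
move=> a0 X0; rewrite -lee_fin -Gamma_EFin//.
pose D : set R := `[X, X + 1]%classic.
have mD : measurable D by exact: measurable_itv.
apply: (@le_trans _ _ (\int[mu]_(x in D) (x `^ (a - 1) * expR (- x))%:E)%E); last first.
  apply: ge0_subset_integral => //.
  - exact: measurable_gamma_integrand.
  - by move=> x _; exact: gamma_integrand_ge0.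
  - by move=> x; rewrite /D /= !in_itv/= andbT => /andP[Xx _]; exact: lt_le_trans Xx.
set c := X `^ a * _.
have -> : (c%:E = \int[mu]_(x in D) c%:E)%E.
  rewrite integral_cst//= lebesgue_measure_itv/= lte_fin ltrDl ltr01.
  by rewrite -EFinB addrAC subrr add0r mule1.
have c0 : 0 <= c.
  by rewrite mulr_ge0 ?powR_ge0// divr_ge0 ?expR_ge0//; lra.
apply: ge0_le_integral => //.
- exact: measurable_gamma_integrand.
- move=> x; rewrite /D /= in_itv/= => /andP[Xx xX]; rewrite lee_fin.
  have x0 : 0 < x by exact: lt_le_trans Xx.
  rewrite powRB; last by rewrite (gt_eqF x0) implybT.
  have -> : c = X `^ a / (X + 1) * expR (- (X + 1)) by rewrite /c mulrA mulrAC.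
  rewrite (powRr1 (ltW x0)); apply: ler_pM.
  - by rewrite divr_ge0 ?powR_ge0//; lra.
  - exact: expR_ge0.
  - apply: ler_pM; [exact: powR_ge0|by rewrite invr_ge0; lra| |].
      by apply: ge0_ler_powR; rewrite ?nnegrE//; exact: ltW.
    by rewrite lef_pV2 ?posrE//; lra.
  - by rewrite ler_expR lerN2.
Qed.

Lemma Gamma_gt0 a : 0 < a -> 0 < Gamma a.
Proof.
move=> a0; apply: lt_le_trans (Gamma_ge a0 ltr01).
by rewrite mulr_gt0 ?powR_gt0// divr_gt0 ?expR_gt0//; lra.
Qed.

Lemma Gamma1 : Gamma 1 = 1 :> R.
Proof.
rewrite -[LHS]/(fine (Gamma 1)%:E) -Gamma_EFin//.
rewrite -[RHS]/(fine 1%E) -(@integral_exponential_pdf R 1)//; congr fine.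
rewrite integral_itv_obnd_cbnd; last exact: measurable_gamma_integrand.
rewrite integral_mkcond; apply: eq_integral => x _.
rewrite /exponential_pdf !patchE; case: ifPn => // _.
by rewrite subrr powRr0 mulN1r.
Qed.

Lemma measurable_beta_integrand a b (c : R) :
  measurable_fun (`]0%R, c[ : set R)
    (fun s => ((c - s) `^ (a - 1) * s `^ (b - 1))%:E).
Proof.
apply/measurable_EFinP; apply: measurable_funM.
  apply: (@measurable_reflect _ (fun x => x `^ (a - 1))).
  exact: measurable_powR_sub1.
exact: measurable_powR_sub1.
Qed.

Lemma beta_integrand_ge0 a b (c s : R) :
  (0 <= ((c - s) `^ (a - 1) * s `^ (b - 1))%:E)%E.
Proof. by rewrite lee_fin mulr_ge0 ?powR_ge0. Qed.

Lemma beta_integral_scale a b c : 0 < c ->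
  (\int[mu]_(s in `]0%R, c[) ((c - s) `^ (a - 1) * s `^ (b - 1))%:E =
   (c `^ (a + b - 1))%:E *
   \int[mu]_(s in `]0%R, 1%R[) ((1 - s) `^ (a - 1) * s `^ (b - 1))%:E)%E.
Proof.
move=> c0.
pose G d := (fun s : R => ((d - s) `^ (a - 1) * s `^ (b - 1))%:E) \_ (`]0%R, d[ : set R).
have mG d : measurable_fun setT (G d).
  by apply/(measurable_restrictT _ _).1 => //; exact: measurable_beta_integrand.
have G0 d s : (0 <= G d s)%E.
  by rewrite /G patchE; case: ifPn => // _; exact: beta_integrand_ge0.
have mGc : measurable_fun setT (fun x => G c (c * x + 0)).
  apply: (measurableT_comp (mG c)); apply: measurable_funD; last exact: measurable_cst.
  by apply: measurable_funM; [exact: measurable_cst|exact: measurable_id].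
have cp0 : 0 <= c `^ (a + b - 1) by exact: powR_ge0.
rewrite [LHS]integral_mkcond [in RHS]integral_mkcond -/(G c) -/(G 1).
apply: (etrans (esym (integral_affine 0 c0 (mG c) (G0 c)))).
apply: (etrans (esym (ge0_integralZl_EFin mu measurableT
  (fun x _ => G0 c (c * x + 0)) mGc (ltW c0)))).
apply: (etrans _ (ge0_integralZl_EFin mu measurableT (fun x _ => G0 1 x) (mG 1) cp0)).
apply: eq_integral => x _; rewrite addr0 /G !patchE.
have -> : (c * x \in (`]0%R, c[%classic : set R)) = (x \in (`]0%R, 1%R[%classic : set R)).
  apply/idP/idP; rewrite !inE/= !in_itv/= pmulr_rgt0// => /andP[-> /=].
    by rewrite -[X in _ < X -> _]mulr1 ltr_pM2l.
  by rewrite -[X in _ -> _ < X]mulr1 ltr_pM2l.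
case: ifPn => [|_]; last by rewrite !mule0.
rewrite inE/= in_itv/= => /andP[x0 x1]; rewrite -!EFinM; congr EFin.
rewrite (_ : c - c * x = c * (1 - x)); last by ring.
rewrite !powRM ?ltW// ?subr_gt0//.
have -> : c `^ (a + b - 1) = c * c `^ (a - 1) * c `^ (b - 1).
  rewrite -[X in X * _ * _](powRr1 (ltW c0)) -!powRD ?(gt_eqF c0) ?implybT//.
  by congr powR; ring.
by ring.
Qed.

(** By scaling, the convolution of two powers is [B] times a power, so its Laplace transform gives
    [Gamma (a + b) B = Gamma a Gamma b]. *)
Lemma beta_integral01 a b : 0 < a -> 0 < b ->
  (\int[mu]_(s in `]0%R, 1%R[) ((1 - s) `^ (a - 1) * s `^ (b - 1))%:E =
   (Gamma a * Gamma b / Gamma (a + b))%:E)%E.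
Proof.
move=> a0 b0; have ab0 : 0 < a + b by rewrite addr_gt0.
set B := (X in X = _).
have B0 : (0 <= B)%E by apply: integral_ge0 => x _; exact: beta_integrand_ge0.
have : ((Gamma (a + b))%:E * B = (Gamma a)%:E * (Gamma b)%:E)%E.
  have := @laplace_convolution _ (fun x => x `^ (a - 1)) (fun x => x `^ (b - 1))
    (@measurable_powR_sub1 _ _) (@measurable_powR_sub1 _ _)
    (fun x _ => powR_ge0 x _) (fun x _ => powR_ge0 x _).
  rewrite (Gamma_EFin a0) (Gamma_EFin b0) => <-.
  rewrite -(Gamma_EFin ab0).
  apply: (etrans (esym (ge0_integralZr mu (measurable_itv _)
    (@measurable_gamma_integrand (a + b) _) (fun x _ => gamma_integrand_ge0 _ x) B0))).
  apply: eq_integral => t; rewrite inE/= in_itv/= andbT => t0.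
  by rewrite beta_integral_scale// muleA -EFinM [in RHS]mulrC.
have G0 := Gamma_gt0 ab0.
(* [B] is so far only a nonnegative extended real; an infinite value would contradict the finite
   right-hand side. *)
move: B B0 => [r| |] //.
  rewrite -!EFinM => _ [rE]; congr EFin; rewrite -rE; field.
  by rewrite gt_eqF.
by rewrite gt0_muley ?lte_fin// -EFinM.
Qed.

Lemma beta_integral a b t : 0 < a -> 0 < b -> 0 < t ->
  (\int[mu]_(s in `]0%R, t[) ((t - s) `^ (a - 1) * s `^ (b - 1))%:E =
   (t `^ (a + b - 1) * (Gamma a * Gamma b / Gamma (a + b)))%:E)%E.
Proof. by move=> a0 b0 t0; rewrite beta_integral_scale// beta_integral01// -EFinM. Qed.

Lemma integrable_beta a b t : 0 < a -> 0 < b -> 0 < t ->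
  mu.-integrable (`]0%R, t[ : set R)
    (EFin \o (fun s => (t - s) `^ (a - 1) * s `^ (b - 1))).
Proof.
move=> a0 b0 t0; apply/integrableP; split; first exact: measurable_beta_integrand.
rewrite (_ : (fun x => `|_|) = (fun s => ((t - s) `^ (a - 1) * s `^ (b - 1))%:E))%E; last first.
  by apply/funext => s /=; rewrite ger0_norm// mulr_ge0 ?powR_ge0.
by rewrite beta_integral// ltry.
Qed.

End gamma_beta.

(** * Mittag-Leffler kernels and their convolution *)

Section mittag_leffler_series.
Variables (R : realType) (al : R).
Hypothesis al0 : 0 < al.
Implicit Types (b t x : R) (c d : nat -> R).

Definition geometrically_bounded c :=
  exists C Q : R, 0 < Q /\ forall k, `|c k| <= C * Q ^+ k.

(** With [c k = (- lam)^k] these are the terms of [E_{al,b}(-lam x)]. Free coefficients keep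
    derivatives and convolutions of Mittag-Leffler functions inside one family. *)
Definition ml_term b c x (k : nat) : R := c k * x ^+ k / Gamma (k%:R * al + b).
Definition ml_sum b c x := limn (series (ml_term b c x)).

Lemma ml_index_gt0 b k : 0 < b -> 0 < k%:R * al + b.
Proof. by move=> b0; rewrite ltr_wpDl// mulr_ge0// ltW. Qed.

(** Taking [X] with [X^al = 2 Q] in [Gamma_ge] makes the denominator grow at least like
    [(2 Q)^k]. *)
Lemma invGamma_decay b Q : 0 < b -> 0 < Q ->
  exists D, forall k, Q ^+ k / Gamma (k%:R * al + b) <= D * (1 / 2) ^+ k.
Proof.
move=> b0 Q0; pose X := (2 * Q) `^ al^-1.
have Q20 : 0 < 2 * Q by rewrite mulr_gt0.
have X0 : 0 < X by rewrite powR_gt0.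
pose m := expR (- (X + 1)) / (X + 1).
have m0 : 0 < m by rewrite divr_gt0 ?expR_gt0//; lra.
exists (X `^ b * m)^-1 => k.
have Xb : 0 < X `^ b by rewrite powR_gt0.
have := Gamma_ge (ml_index_gt0 k b0) X0; rewrite -/m.
have Gk0 := Gamma_gt0 (ml_index_gt0 k b0).
have -> : X `^ (k%:R * al + b) = (2 * Q) ^+ k * X `^ b.
  rewrite powRD ?(gt_eqF X0) ?implybT//; congr (_ * _).
  by rewrite -powRrM mulrCA mulVf ?gt_eqF// mulr1 powR_mulrn// ltW.
have Xm : 0 < X `^ b * m by rewrite mulr_gt0.
move=> h; rewrite ler_pdivrMr// -mulrA [leRHS]mulrC (ler_pdivlMr _ _ Xm).
rewrite (_ : Q ^+ k * (X `^ b * m) = (1 / 2) ^+ k * ((2 * Q) ^+ k * X `^ b * m)).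
  by rewrite ler_wpM2l// exprn_ge0.
by rewrite !mulrA -exprMn (_ : 1 / 2 * (2 * Q) = Q)//; field.
Qed.

Lemma ml_term_summable b c x : 0 < b -> geometrically_bounded c ->
  abs_summable (ml_term b c x).
Proof.
move=> b0 [C [Q [Q0 cQ]]].
have [D hD] := invGamma_decay b0 (mulr_gt0 Q0 (ltr_pwDl ltr01 (normr_ge0 x))).
have C0 : 0 <= C by have := le_trans (normr_ge0 _) (cQ 0%N); rewrite expr0 mulr1.
apply: (@abs_summable_le _ _ (fun k => C * D * (1 / 2) ^+ k)); last first.
  by apply: is_cvg_geometric_series; rewrite ger0_norm; lra.
move=> k; rewrite /ml_term.
have G0 := Gamma_gt0 (ml_index_gt0 k b0).
rewrite !normrM normfV (gtr0_norm G0) -mulrA -mulrA.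
apply: (@le_trans _ _ (C * (Q ^+ k * ((1 + `|x|) ^+ k / Gamma (k%:R * al + b))))); last first.
  by rewrite ler_wpM2l// mulrA -exprMn.
rewrite [leRHS]mulrA; apply: ler_pM => //.
  by rewrite mulr_ge0// invr_ge0 ltW.
rewrite ler_pM2r ?invr_gt0// normrX.
by apply: lerXn2r; rewrite ?nnegrE ?addr_ge0// lerDr.
Qed.

Lemma ml_sum_continuous b c : 0 < b -> geometrically_bounded c ->
  continuous (ml_sum b c).
Proof.
move=> b0 [C [Q [Q0 cQ]]] x.
apply: (@tannery _ _ (nbhs x) _ _ _ (fun k => `|ml_term b (fun k => `|c k|) (`|x| + 1) k|)).
- apply: (@ml_term_summable b (fun k => `|c k|) (`|x| + 1) b0).
  by exists C, Q; split => // k; rewrite normr_id.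
- near=> y => k.
  have yx : `|y| <= `|x| + 1.
    have : `|x - y| <= 1 by near: y; apply: (@cvgr_dist_le _ R^o _ (nbhs x) _ id x) => //.
    move=> h; rewrite -[y](subKr x); apply: (le_trans (ler_normB _ _)); lra.
  rewrite /ml_term !normrM normr_id ler_wpM2r// ler_wpM2l//.
  by rewrite !normrX lerXn2r ?nnegrE// [X in _ <= X]ger0_norm ?addr_ge0.
- move=> k; apply: cvgMl; apply: cvgMr; exact: exprn_continuous.
Unshelve. all: by end_near. Qed.

Definition cauchy_prod c d m := \sum_(i < m.+1) c i * d (m - i)%N.

Lemma cauchy_square (c d F : nat -> R) N :
  \sum_(i < N) \sum_(j < N) c i * d j * F (i + j)%N =
  \sum_(m < N + N) (\sum_(i < N) \sum_(j < N) c i * d j * ((i + j)%N == m)%:R) * F m.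
Proof.
under [RHS]eq_bigr do rewrite mulr_suml.
rewrite [RHS]exchange_big/=; apply: eq_bigr => i _.
under [RHS]eq_bigr do rewrite mulr_suml.
rewrite [RHS]exchange_big/=; apply: eq_bigr => j _.
have ij : (i + j < N + N)%N by rewrite -addnS leq_add// ltnW.
rewrite (bigD1 (Ordinal ij))//= eqxx mulr1 big1 ?addr0// => m mij.
rewrite (_ : (i + j)%N == m = false) ?mulr0 ?mul0r//.
by apply/negbTE; apply: contra mij => /eqP h; apply/eqP/val_inj.
Qed.

(** The square truncation alters the Cauchy coefficient only for [m >= N]: for smaller [m] the inner
    test always succeeds. *)
Lemma cauchy_coef (c d : nat -> R) N m :
  \sum_(i < N) \sum_(j < N) c i * d j * ((i + j)%N == m)%:R =
  \sum_(i < N | (i < m.+1)%N) c i * (if (m - i < N)%N then d (m - i)%N else 0).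
Proof.
rewrite [RHS]big_mkcond; apply: eq_bigr => i _.
case: ifPn => [im|].
  rewrite ltnS in im; case: ifPn => [miN|]; last first.
    rewrite -leqNgt => Nmi; rewrite mulr0 big1// => j _.
    rewrite (_ : (i + j)%N == m = false) ?mulr0//; apply/negbTE.
    apply: contraTN (ltn_ord j) => /eqP ijm; rewrite -leqNgt.
    by rewrite (leq_trans Nmi)// -ijm addKn.
  rewrite (bigD1 (Ordinal miN))//= subnKC// eqxx mulr1 big1 ?addr0// => j jm.
  rewrite (_ : (i + j)%N == m = false) ?mulr0//; apply/negbTE.
  by apply: contra jm => /eqP ijm; apply/eqP/val_inj; rewrite /= -ijm addKn.
rewrite -leqNgt => mi; rewrite big1// => j _.
rewrite (_ : (i + j)%N == m = false) ?mulr0//; apply/negbTE.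
by rewrite neq_ltn (leq_trans mi) ?orbT// leq_addr.
Qed.

(** Each product [Q^i Q'^(m - i)] is at most [(Q + Q')^m], and the factor 2 absorbs the number of
    terms since [m + 1 <= 2^m]. Uniformity in [N] makes this a majorant when [N] tends to
    infinity. *)
Lemma geometrically_bounded_cauchy c d :
  geometrically_bounded c -> geometrically_bounded d ->
  exists C Q, 0 < Q /\ forall N m,
    `|\sum_(i < N) \sum_(j < N) c i * d j * ((i + j)%N == m)%:R| <= C * Q ^+ m.
Proof.
move=> [C [Q [Q0 cQ]]] [C' [Q' [Q'0 dQ]]].
exists (C * C'), (2 * (Q + Q')); split; first by rewrite mulr_gt0// addr_gt0.
have C0 : 0 <= C by have := le_trans (normr_ge0 _) (cQ 0%N); rewrite expr0 mulr1.
have C'0 : 0 <= C' by have := le_trans (normr_ge0 _) (dQ 0%N); rewrite expr0 mulr1.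
move=> N m; rewrite cauchy_coef; apply: (le_trans (ler_norm_sum _ _ _)).
pose B := C * C' * (Q + Q') ^+ m.
have B0 : 0 <= B by rewrite !mulr_ge0// exprn_ge0// addr_ge0 ?ltW.
apply: (@le_trans _ _ (\sum_(i < N | (i < m.+1)%N) B)).
  apply: ler_sum => i im; rewrite normrM.
  apply: (@le_trans _ _ (C * Q ^+ i * (C' * Q' ^+ (m - i)))).
    apply: ler_pM => //; case: ifP => // _; rewrite normr0 mulr_ge0//.
    by rewrite exprn_ge0// ltW.
  rewrite mulrACA /B ler_wpM2l ?mulr_ge0//.
  rewrite -[in X in _ <= _ ^+ X](@subnKC i m) // exprD.
  have [Q0' Q'0'] := (ltW Q0, ltW Q'0).
  by apply: ler_pM; rewrite ?exprn_ge0//; apply: lerXn2r; rewrite ?nnegrE ?addr_ge0// ?lerDl ?lerDr.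
apply: (@le_trans _ _ (m.+1%:R * B)).
  have [Nm|mN] := leqP N m.+1.
    apply: (@le_trans _ _ (\sum_(i < N) B)).
      by rewrite [leLHS]big_mkcond; apply: ler_sum => i _; case: ifP.
    rewrite sumr_const card_ord -[leLHS]mulr_natl; apply: ler_wpM2r => //.
    by rewrite ler_nat.
  by rewrite -(big_ord_widen _ (fun=> B)) ?sumr_const ?card_ord ?mulr_natl// ltnW.
have QQ0 : 0 <= Q + Q' by rewrite addr_ge0// ltW.
rewrite exprMn /B mulrCA ler_wpM2l ?mulr_ge0// ler_wpM2r ?exprn_ge0//.
by rewrite -natrX ler_nat ltn_expl.
Qed.

End mittag_leffler_series.

(** * Integrals of finite sums and convolution of the kernels *)

Section Rintegral_sum.
Variable R : realType.

Lemma sum_finite (u : nat -> R) N : (forall n, (N <= n)%N -> u n = 0) ->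
  limn (series u) = \sum_(n < N) u n.
Proof.
move=> u0; apply/cvg_lim => //; apply: cvg_near_cst; near=> n.
have Nn : (N <= n)%N by near: n; exact: nbhs_infty_ge.
rewrite seriesEnat /= (@big_cat_nat _ _ _ N)//= [X in _ + X]big_nat_cond [X in _ + X]big1 ?addr0 ?big_mkord//.
by move=> i; rewrite andbT => /andP[Ni _]; exact: u0.
Unshelve. all: by end_near. Qed.

Local Notation mu := (@lebesgue_measure R).

Lemma integrable_scale (D : set (measurableTypeR R)) k (f : R -> R) : measurable D ->
  mu.-integrable D (EFin \o f) -> mu.-integrable D (EFin \o (fun x => k * f x)).
Proof.
by move=> mD intf; exact: (integrableZl mD k intf).
Qed.

Lemma integrable_bigsum (D : set (measurableTypeR R)) N (f : nat -> R -> R) : measurable D ->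
  (forall i, mu.-integrable D (EFin \o f i)) ->
  mu.-integrable D (EFin \o (fun x => \sum_(i < N) f i x)).
Proof.
move=> mD intf; elim: N => [|N IH].
  rewrite (_ : _ \o _ = cst 0%E); first exact: integrable0.
  by apply/funext => x /=; rewrite big_ord0.
rewrite (_ : _ \o _ = (EFin \o (fun x => \sum_(i < N) f i x)%R) \+ (EFin \o f N))%E.
  exact: integrableD.
by apply/funext => x /=; rewrite big_ord_recr.
Qed.

Lemma Rintegral_bigsum (D : set (measurableTypeR R)) N (f : nat -> R -> R) : measurable D ->
  (forall i, mu.-integrable D (EFin \o f i)) ->
  \int[mu]_(x in D) (\sum_(i < N) f i x) = \sum_(i < N) \int[mu]_(x in D) f i x.
Proof.
move=> mD intf; elim: N => [|N IH].
  rewrite big_ord0; under eq_Rintegral do rewrite big_ord0.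
  by rewrite /Rintegral integral0.
rewrite big_ord_recr /= -IH -RintegralD//; last exact: integrable_bigsum.
by apply: eq_Rintegral => x _; rewrite big_ord_recr.
Qed.

End Rintegral_sum.

Section mlker_convolution.
Variables (R : realType) (al : R).
Hypothesis al0 : 0 < al.
Local Notation mu := (@lebesgue_measure R).
Implicit Types (a b t : R) (c d : nat -> R).

(* [mlker b c t] is the sum of the c_k t^(al k + b - 1) / Gamma (al k + b): by the
   beta integral, convolution of kernels adds the [b]'s and Cauchy-multiplies the
   [c]'s. *)
Definition mlker b c t : R := t `^ (b - 1) * ml_sum al b c (t `^ al).

Lemma measurable_mlker b c (D : set R) : 0 < b -> geometrically_bounded c ->
  measurable_fun D (mlker b c).
Proof.
move=> b0 gc; apply: measurable_funTS; apply: measurable_funM.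
  exact: measurable_powR.
apply: (@measurableT_comp _ _ _ _ _ _ (ml_sum al b c)); last exact: measurable_powR.
by apply: continuous_measurable_fun; exact: ml_sum_continuous.
Qed.

Lemma Rintegral_beta a b t : 0 < a -> 0 < b -> 0 < t ->
  \int[mu]_(s in `]0, t[) ((t - s) `^ (a - 1) * s `^ (b - 1)) =
  t `^ (a + b - 1) * (Gamma a * Gamma b / Gamma (a + b)).
Proof. by move=> a0 b0 t0; rewrite /Rintegral beta_integral. Qed.

Let part b c N t := t `^ (b - 1) * \sum_(i < N) ml_term al b c (t `^ al) i.

Lemma powR_ml_exponent b t i : 0 < t ->
  t `^ (b - 1) * (t `^ al) ^+ i = t `^ (i%:R * al + b - 1).
Proof.
move=> t0; rewrite -powR_mulrn ?powR_ge0// -powRrM -powRD ?(gt_eqF t0) ?implybT//.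
by congr powR; ring.
Qed.

(** Finitely many products of powers occur, and each is a beta integral whose [Gamma] factors cancel
    the denominators, leaving the one at [(i + j) al + a + b]. *)
Lemma Rintegral_partial a b c d t N : 0 < a -> 0 < b -> 0 < t ->
  mu.-integrable (`]0, t[ : set R)
    (EFin \o (fun s => part a c N (t - s) * part b d N s)) /\
  \int[mu]_(s in `]0, t[) (part a c N (t - s) * part b d N s) =
  t `^ (a + b - 1) *
    \sum_(m < N + N) (\sum_(i < N) \sum_(j < N) c i * d j * ((i + j)%N == m)%:R)
      * ((t `^ al) ^+ m / Gamma (m%:R * al + (a + b))).
Proof.
move=> a0 b0 t0.
pose e i j s := c i * d j / (Gamma (i%:R * al + a) * Gamma (j%:R * al + b)) *
   ((t - s) `^ (i%:R * al + a - 1) * s `^ (j%:R * al + b - 1)).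
have ie i j : mu.-integrable (`]0, t[ : set R) (EFin \o e i j).
  by apply: integrable_scale => //; apply: integrable_beta => //; exact: ml_index_gt0.
have eE s : s \in (`]0, t[%classic : set R) -> part a c N (t - s) * part b d N s =
    \sum_(i < N) \sum_(j < N) e i j s.
  rewrite inE/= in_itv/= => /andP[s0 st].
  have ts0 : 0 < t - s by rewrite subr_gt0.
  rewrite /part mulrACA big_distrlr/= mulr_sumr; apply: eq_bigr => i _.
  rewrite mulr_sumr; apply: eq_bigr => j _.
  rewrite /e -(powR_ml_exponent a i ts0) -(powR_ml_exponent b j s0) /ml_term invfM.
  move: ((t - s) `^ (a - 1)) (s `^ (b - 1)) (((t - s) `^ al) ^+ i) ((s `^ al) ^+ j).
  move: (Gamma (i%:R * al + a))^-1 (Gamma (j%:R * al + b))^-1.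
  by move=> *; ring.
have int2 : mu.-integrable (`]0, t[ : set R)
    (EFin \o (fun s => \sum_(i < N) \sum_(j < N) e i j s)).
  apply: (@integrable_bigsum _ _ _ (fun i s => \sum_(j < N) e i j s)) => // i.
  exact: integrable_bigsum.
split.
  apply: eq_integrable int2 => //.
  by move=> s sin /=; rewrite eE.
rewrite (@eq_Rintegral _ _ _ mu _ _ _ eE).
rewrite (@Rintegral_bigsum _ _ _ (fun i s => \sum_(j < N) e i j s))//; last first.
  by move=> i; exact: integrable_bigsum.
rewrite -(cauchy_square c d (fun m => (t `^ al) ^+ m / Gamma (m%:R * al + (a + b)))) mulr_sumr.
apply: eq_bigr => i _.
rewrite Rintegral_bigsum// mulr_sumr; apply: eq_bigr => j _.
have ia := ml_index_gt0 al0 i a0; have jb := ml_index_gt0 al0 j b0.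
rewrite /e RintegralZl//; last by apply: integrable_beta.
rewrite (Rintegral_beta ia jb t0).
have -> : i%:R * al + a + (j%:R * al + b) = (i + j)%:R * al + (a + b) by rewrite natrD; ring.
rewrite -powR_ml_exponent//.
have g1 := gt_eqF (Gamma_gt0 ia); have g2 := gt_eqF (Gamma_gt0 jb).
have := gt_eqF (Gamma_gt0 (ml_index_gt0 al0 (i + j) (addr_gt0 a0 b0))).
move: g1 g2; move: (Gamma _) (Gamma _) (Gamma _) (c i) (d j) (_ `^ _) (_ ^+ _).
by move=> x y z u v p r g1 g2 g3; field; rewrite g1 g2 g3.
Qed.

(** Dominated convergence for the integrals and [tannery] for the series compute two limits of the
    same sequence, the one of [Rintegral_partial]. *)
Lemma mlker_convolution a b c d t : 0 < a -> 0 < b -> 0 < t ->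
  geometrically_bounded c -> geometrically_bounded d ->
  mu.-integrable (`]0, t[ : set R)
    (EFin \o (fun s => mlker a c (t - s) * mlker b d s)) /\
  \int[mu]_(s in `]0, t[) (mlker a c (t - s) * mlker b d s) =
  mlker (a + b) (cauchy_prod c d) t.
Proof.
move=> a0 b0 t0 gc gd.
(* On []0, t[] one has [s^al <= t^al], so the absolute series at the right end bounds all partial
   sums at once. *)
pose M b c := limn (series (fun k => `|ml_term al b c (t `^ al) k|)).
have partM b' c' N s : 0 < b' -> geometrically_bounded c' -> 0 < s -> s < t ->
    `|part b' c' N s| <= s `^ (b' - 1) * M b' c'.
  move=> b'0 gc' s0 st; rewrite /part normrM ger0_norm ?powR_ge0// ler_wpM2l ?powR_ge0//.
  apply: (le_trans (ler_norm_sum _ _ _)).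
  apply: (@le_trans _ _ (\sum_(i < N) `|ml_term al b' c' (t `^ al) i|)); last first.
    by apply: partial_sum_le => //; exact: ml_term_summable.
  apply: ler_sum => i _; rewrite /ml_term !normrM ler_wpM2r// ler_wpM2l//.
  rewrite !normrX; apply: lerXn2r; rewrite ?nnegrE// !ger0_norm ?powR_ge0//.
  have s0' := ltW s0; have t0' := ltW t0.
  by apply: (ge0_ler_powR (ltW al0)); rewrite ?nnegrE// ltW.
have partlim b' c' s : 0 < b' -> geometrically_bounded c' ->
    part b' c' N s @[N --> \oo] --> mlker b' c' s.
  move=> b'0 gc'; apply: cvgMr.
  rewrite (_ : (fun N => _) = series (ml_term al b' c' (s `^ al))); last by rewrite seriesEord.
  exact: abs_summable_cvg (@ml_term_summable _ _ al0 b' c' (s `^ al) b'0 gc').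
have [] := @dominated_convergence _ _ R mu (`]0, t[ : set R) (measurable_itv _)
  (fun N => EFin \o (fun s => part a c N (t - s) * part b d N s))
  (EFin \o (fun s => mlker a c (t - s) * mlker b d s))
  (EFin \o (fun s => (M a c * M b d) * ((t - s) `^ (a - 1) * s `^ (b - 1)))).
- by move=> N; have [/integrableP[]] := Rintegral_partial c d N a0 b0 t0.
- apply/measurable_EFinP; apply: measurable_funM; last exact: measurable_mlker.
  apply: measurable_reflect; exact: measurable_mlker.
- apply: aeW => s _; apply: cvg_EFin; first exact: nearW.
  by apply: cvgM; exact: partlim.
- by apply: integrable_scale => //; exact: integrable_beta.
- apply: aeW => s N /=; rewrite in_itv/= => /andP[s0 st].
  rewrite lee_fin normrM.
  have := ler_pM (normr_ge0 _) (normr_ge0 _) (partM a c N (t - s) a0 gc _ _) (partM b d N s b0 gd s0 st).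
  rewrite subr_gt0 gtrBl => /(_ st s0) /le_trans; apply.
  move: (M a c) (M b d) (_ `^ (a - 1)) (_ `^ (b - 1)) => m m' v v'.
  by rewrite mulrACA [leRHS]mulrC.
move=> inte _ lime; split => //.
have [C [Q [Q0 CQ]]] := geometrically_bounded_cauchy gc gd.
pose F m := (t `^ al) ^+ m / Gamma (m%:R * al + (a + b)).
pose coef N m := \sum_(i < N) \sum_(j < N) c i * d j * ((i + j)%N == m)%:R.
have ab0 : 0 < a + b by rewrite addr_gt0.
have F0 m : 0 <= F m.
  by rewrite mulr_ge0 ?exprn_ge0 ?powR_ge0// invr_ge0 ltW// Gamma_gt0// ml_index_gt0.
have limN : limn (series (fun m => coef N m * F m)) @[N --> \oo] -->
    limn (series (fun m => cauchy_prod c d m * F m)).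
  apply: (@tannery _ _ _ _ _ _ (fun m => `|ml_term al (a + b) (fun k => C * Q ^+ k) (t `^ al) m|)).
  - apply: (@ml_term_summable _ _ al0) => //; exists `|C|, Q; split => // k.
    by rewrite normrM (ger0_norm (exprn_ge0 _ (ltW Q0))).
  - apply: nearW => N m; rewrite normrM (ger0_norm (F0 m)).
    apply: le_trans (ler_norm _); rewrite /ml_term -mulrA.
    by apply: ler_wpM2r; [exact: F0|exact: CQ].
  - move=> m; apply: cvgMl; apply: cvg_near_cst; near=> N.
    have mN : (m < N)%N by near: N; exact: nbhs_infty_gt.
    rewrite /coef cauchy_coef -(big_ord_widen _ (fun i => c i * (if (m - i < N)%N then d (m - i)%N else 0)))//.
    apply: eq_bigr => i _; rewrite ifT//.
    by rewrite (leq_ltn_trans _ mN)// leq_subr.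
have limE : (\int[mu]_(s in `]0%R, t[) (part a c N (t - s) * part b d N s)%:E @[N --> \oo] -->
    (mlker (a + b) (cauchy_prod c d) t)%:E)%E.
  rewrite (_ : (fun N => _) = EFin \o (fun N => t `^ (a + b - 1) * limn (series (fun m => coef N m * F m)))).
    apply: cvg_EFin; first exact: nearW.
    apply: cvgMr; rewrite /ml_sum.
    rewrite (_ : ml_term al (a + b) (cauchy_prod c d) (t `^ al) = (fun m => cauchy_prod c d m * F m))//.
    by apply/funext => m; rewrite /ml_term mulrA.
  apply/funext => N /=.
  have [iN vN] := Rintegral_partial c d N a0 b0 t0.
  rewrite -[LHS]fineK; last exact: (integrable_fin_num _ iN).
  congr EFin; rewrite -/(Rintegral _ _ _) vN (@sum_finite _ _ (N + N))// => m NNm.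
  rewrite /coef big1 ?mul0r// => i _; rewrite big1// => j _.
  rewrite (_ : (i + j)%N == m = false) ?mulr0//; apply/negbTE.
  by rewrite neq_ltn (leq_trans _ NNm)// -addnS leq_add// ltnW.
exact: (congr1 fine (cvg_unique (@ereal_hausdorff R) lime limE)).
Unshelve. all: by end_near. Qed.

End mlker_convolution.

Lemma measurable_itvR (R : realType) (i : interval R) :
  measurable ([set` i] : set (measurableTypeR R)).
Proof. exact: measurable_itv. Qed.

(** * Volterra equation of the Mittag-Leffler kernels *)

Section mittag_leffler_positivity.
Variables (R : realType) (al : R).
Hypothesis al0 : 0 < al.
Local Notation mu := (@lebesgue_measure R).
Implicit Types (b t x lam : R) (c d : nat -> R).

(** The unit of the Cauchy product. Its kernel is [t^(b - 1) / Gamma b], so convolution with it is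
    the fractional integral of order [b]. *)
Definition delta0 (k : nat) : R := (k == 0%N)%:R.
Definition alt lam (k : nat) : R := (- lam) ^+ k.

Lemma geometrically_bounded_delta0 : geometrically_bounded delta0.
Proof.
exists 1, 1; split => // k; rewrite expr1n mulr1 /delta0.
by case: eqP; rewrite ?normr1 ?normr0.
Qed.

Lemma geometrically_bounded_alt lam : geometrically_bounded (alt lam).
Proof.
exists 1, (`|lam| + 1); split; first by rewrite ltr_wpDl.
move=> k; rewrite mul1r /alt normrX normrN.
by apply: lerXn2r; rewrite ?nnegrE ?addr_ge0// lerDl.
Qed.

Lemma cauchy_prod_delta0 c : cauchy_prod delta0 c = c.
Proof.
apply/funext => m; rewrite /cauchy_prod big_ord_recl /= subn0 /delta0 eqxx mul1r.
by rewrite big1 ?addr0// => i _; rewrite mul0r.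
Qed.

Lemma cauchy_prod_delta0r c : cauchy_prod c delta0 = c.
Proof.
apply/funext => m; rewrite /cauchy_prod big_ord_recr/= subnn /delta0 eqxx mulr1.
by rewrite big1 ?add0r// => i _; rewrite subn_eq0 leqNgt ltn_ord mulr0.
Qed.

Lemma ml_sum_delta0 b x : ml_sum al b delta0 x = (Gamma b)^-1.
Proof.
rewrite /ml_sum (@sum_finite _ _ 1).
  by rewrite big_ord_recl big_ord0 /ml_term /delta0 /= !mul0r expr0 add0r addr0 !mul1r.
by case=> // n _; rewrite /ml_term /delta0 !mul0r.
Qed.

Lemma mlker_delta0 b t : mlker al b delta0 t = t `^ (b - 1) / Gamma b.
Proof. by rewrite /mlker ml_sum_delta0. Qed.

Lemma ml_sum_alt_recl b lam x : 0 < b ->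
  ml_sum al b (alt lam) x = (Gamma b)^-1 - lam * x * ml_sum al (b + al) (alt lam) x.
Proof.
move=> b0; have bal : 0 < b + al by rewrite addr_gt0.
have gl := geometrically_bounded_alt lam.
rewrite {1}/ml_sum (sum_recl (@ml_term_summable _ _ al0 b _ x b0 gl)).
have -> : ml_term al b (alt lam) x 0 = (Gamma b)^-1.
  by rewrite /ml_term /alt !expr0 !mul1r mul0r add0r.
congr (_ + _); rewrite -mulNr -(sumZ _ (@ml_term_summable _ _ al0 _ _ x bal gl)).
apply: eq_sum => k; rewrite /ml_term /alt !exprS -addn1 natrD mulrDl mul1r addrA.
rewrite [k%:R * al + b + al]addrAC.
by move: (Gamma _)^-1 ((- lam) ^+ k) (x ^+ k) => g u v; ring.
Qed.

Lemma mlker_alt_recl b lam t : 0 < b -> 0 < t ->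
  mlker al b (alt lam) t =
  mlker al b delta0 t - lam * mlker al (al + b) (alt lam) t.
Proof.
move=> b0 t0; rewrite /mlker (ml_sum_alt_recl _ _ b0) ml_sum_delta0.
have -> : t `^ (al + b - 1) = t `^ (b - 1) * t `^ al.
  by rewrite -powRD ?(gt_eqF t0) ?implybT//; congr powR; ring.
rewrite (addrC al b).
move: (ml_sum al (b + al) (alt lam) (t `^ al)) => m.
by move: (Gamma b)^-1 (t `^ (b - 1)) (t `^ al) => g u v; ring.
Qed.

Lemma mlker_continuous b c t : 0 < b -> geometrically_bounded c -> 0 < t ->
  {for t, continuous (mlker al b c)}.
Proof.
move=> b0 gc t0; apply: cvgM; first exact: continuous_powR.
apply: continuous_comp; first exact: continuous_powR.
exact: ml_sum_continuous.
Qed.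

(** This is the equation [s = k - k * s], with [*] the convolution, of the resolvent of the Abel
    kernel [k = t^(al - 1) / Gamma al]: convolving with [k] raises the second parameter by [al], and
    [mlker_alt_recl] relates the two parameters. *)
Lemma mlker_alt_volterra t : 0 < t ->
  mu.-integrable (`]0, t[ : set R)
    (EFin \o (fun u => (t - u) `^ (al - 1) * mlker al al (alt 1) u)) /\
  mlker al al (alt 1) t = (Gamma al)^-1 * (t `^ (al - 1) -
    \int[mu]_(u in `]0, t[) ((t - u) `^ (al - 1) * mlker al al (alt 1) u)).
Proof.
move=> t0; have Gal := lt0r_neq0 (Gamma_gt0 al0).
have [int1 int2] := mlker_convolution al0 al0 al0 t0
  geometrically_bounded_delta0 (geometrically_bounded_alt 1).
have eqf : (fun u => (t - u) `^ (al - 1) * mlker al al (alt 1) u) =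
    (fun u => Gamma al * (mlker al al delta0 (t - u) * mlker al al (alt 1) u)).
  by apply/funext => u; rewrite mlker_delta0 [RHS]mulrA [Gamma al * _]mulrC divfK.
rewrite eqf; split; first exact: integrable_scale.
rewrite (RintegralZl _ (measurable_itvR _) int1) int2 cauchy_prod_delta0.
rewrite mulrBr (mulKf Gal) mulrC -mlker_delta0.
by rewrite [LHS](mlker_alt_recl _ al0 t0) mul1r.
Qed.

(** A translation brings it to the beta integral with second exponent 1. *)
Lemma Rintegral_powR_right (t0 t : R) : 0 <= t < t0 ->
  mu.-integrable (`]t, t0[ : set R) (EFin \o (fun u => (t0 - u) `^ (al - 1))) /\
  \int[mu]_(u in `]t, t0[) (t0 - u) `^ (al - 1) =
  (t0 - t) `^ al * (Gamma al / Gamma (al + 1)).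
Proof.
move=> /andP[t00 tt0]; have d0 : 0 < t0 - t by rewrite subr_gt0.
have mf (c : R) : measurable_fun [set: R] (fun u : R => ((c - u) `^ (al - 1))%:E).
  apply/measurable_EFinP; apply: (measurableT_comp (measurable_powR _)).
  by apply: measurable_funB; [exact: measurable_cst|exact: measurable_id].
have e : (\int[mu]_(u in `]t, t0[) ((t0 - u)%R `^ (al - 1))%:E =
    ((t0 - t) `^ al * (Gamma al / Gamma (al + 1)))%:E)%E.
  have -> : (t0 - t) `^ al * (Gamma al / Gamma (al + 1)) =
      (t0 - t) `^ (al + 1 - 1) * (Gamma al * Gamma 1 / Gamma (al + 1)).
    by rewrite Gamma1 mulr1 addrK.
  rewrite -(beta_integral al0 ltr01 d0).
  rewrite integral_mkcond.
  rewrite -(@integral_affine R 1 t)//; last 2 first.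
  - by apply/(measurable_restrictT _ _).1 => //; exact: measurable_funTS.
  - by move=> x; rewrite patchE; case: ifP => // _; rewrite lee_fin powR_ge0.
  rewrite mul1e [RHS]integral_mkcond; apply: eq_integral => u _.
  rewrite mul1r !patchE.
  have -> : (u + t \in (`]t, t0[%classic : set R)) = (u \in (`]0, (t0 - t)[%classic : set R)).
    by apply/idP/idP; rewrite !inE/= !in_itv/= ltrDr ltrBrDr.
  case: ifP => // _; rewrite subrr powRr0 mulr1; congr (EFin (_ `^ _)); ring.
split; last by rewrite /Rintegral e.
have mft : measurable_fun (`]t, t0[ : set R) (EFin \o (fun u => (t0 - u) `^ (al - 1))).
  by apply: measurable_funTS; exact: (mf t0).
apply/integrableP; split; first exact: mft.
rewrite (_ : (fun x => `|_|) = (fun u => ((t0 - u) `^ (al - 1))%:E))%E; last first.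
  by apply/funext => s /=; rewrite ger0_norm// powR_ge0.
by rewrite e ltry.
Qed.

End mittag_leffler_positivity.

Lemma Rintegral_split (R : realType) (f : R -> R) (r t t0 : R) : r <= t <= t0 ->
  (@lebesgue_measure R).-integrable (`]r, t0[ : set R) (EFin \o f) ->
  [/\ (@lebesgue_measure R).-integrable (`]r, t[ : set R) (EFin \o f),
      (@lebesgue_measure R).-integrable (`]t, t0[ : set R) (EFin \o f) &
  \int[@lebesgue_measure R]_(u in `]r, t0[) f u =
  \int[@lebesgue_measure R]_(u in `]r, t[) f u +
  \int[@lebesgue_measure R]_(u in `]t, t0[) f u].
Proof.
move=> /andP[rt tt0] intf.
have int1 : (@lebesgue_measure R).-integrable (`]r, t[ : set R) (EFin \o f).
  apply: integrableS intf; [exact: measurable_itvR|exact: measurable_itvR|].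
  by apply: subset_itvl; rewrite bnd_simp.
have int2 : (@lebesgue_measure R).-integrable (`]t, t0[ : set R) (EFin \o f).
  apply: integrableS intf; [exact: measurable_itvR|exact: measurable_itvR|].
  by apply: subset_itvr; rewrite bnd_simp.
split => //.
move: tt0; rewrite le_eqVlt => /predU1P[tt0|tt0].
  by rewrite tt0 set_itvoo0 Rintegral_set0 addr0.
have := @Rintegral_itvB R f (BRight r) (BLeft t0) t intf.
rewrite !bnd_simp => /(_ rt tt0) <-.
by rewrite (Rintegral_itv_bndo_bndc int1) addrC subrK.
Qed.

(** * Complete monotonicity of the Mittag-Leffler function *)

Section resolvent_positivity.
Variables (R : realType) (al : R).
Hypothesis al01 : 0 < al < 1.
Local Notation mu := (@lebesgue_measure R).
Let al0 : 0 < al. Proof. by case/andP: al01. Qed.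
Let al1 : al < 1. Proof. by case/andP: al01. Qed.
Let s := mlker al al (alt 1).

Lemma le0_ler_powR (p x y : R) : p <= 0 -> 0 < x -> x <= y -> y `^ p <= x `^ p.
Proof.
move=> p0 x0 xy; have y0 := lt_le_trans x0 xy.
rewrite -[p]opprK [y `^ _]powRN [x `^ _]powRN lef_pV2 ?posrE ?powR_gt0//.
by apply: ge0_ler_powR; rewrite ?oppr_ge0// nnegrE ltW.
Qed.

Let s_continuous (t : R) : 0 < t -> {for t, continuous s}.
Proof. by move=> t0; apply: mlker_continuous => //; exact: geometrically_bounded_alt. Qed.

(** Near 0 the kernel behaves like [t^(al - 1) / Gamma al]. This keeps the infimum of the points
    where [s <= 0] away from 0. *)
Let s_gt0_near0 : \forall t \near 0^'+, 0 < s t.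
Proof.
have ml0 : ml_sum al al (alt 1) 0 = (Gamma al)^-1.
  by rewrite (ml_sum_alt_recl al0 _ _ al0) mulr0 mul0r subr0.
have : ml_sum al al (alt 1) (t `^ al) @[t --> 0^'+] --> (Gamma al)^-1.
  rewrite -ml0; apply: continuous_cvg; last exact: powR_cvg0.
  exact: (ml_sum_continuous al0 al0 (geometrically_bounded_alt 1)).
have G0 : 0 < (Gamma al)^-1 by rewrite invr_gt0 Gamma_gt0.
move=> /cvgr_gt/(_ _ G0) h; near=> t.
have t0 : 0 < t by near: t; exact: nbhs_right_gt.
by rewrite /s /mlker mulr_gt0 ?powR_gt0//; near: t.
Unshelve. all: by end_near. Qed.

(* The kernel [t ^ (al - 1)] is logarithmically convex: this bounds the integral
   at [t0] by the one at the earlier time [t], up to the part over [t, t0[. *)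
Let s_lower (t t0 : R) : 0 < t -> t < t0 ->
  (forall u, 0 < u -> u < t0 -> 0 < s u) ->
  (forall u, t <= u -> u < t0 -> s u <= s t) ->
  Gamma al * s t * (t0 `^ (al - 1) / t `^ (al - 1) - (t0 - t) `^ al / Gamma (al + 1))
  <= Gamma al * s t0.
Proof.
move=> t_gt0 tt0 spos smax; have t0_gt0 := lt_trans t_gt0 tt0.
pose f (w u : R) := (w - u) `^ (al - 1) * s u.
have [i0 _] := mlker_alt_volterra al0 t0_gt0.
have [i1 _] := mlker_alt_volterra al0 t_gt0.
have G0 := Gamma_gt0 al0.
have Gs w : 0 < w -> Gamma al * s w = w `^ (al - 1) - \int[mu]_(u in `]0, w[) f w u.
  move=> w0; have [_ v] := mlker_alt_volterra al0 w0.
  exact: (canLR (mulVKf (lt0r_neq0 G0)) v).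
have Gs0 := Gs _ t0_gt0; have Gs1 := Gs _ t_gt0.
have h0t : 0 <= t <= t0 by rewrite !ltW.
have [j1 j2 split0] := Rintegral_split h0t i0.
have htt0 : 0 <= t < t0 by rewrite ltW.
have [k2 e2] := Rintegral_powR_right al0 htt0.
have tp : 0 < t `^ (al - 1) by rewrite powR_gt0.
have B : \int[mu]_(u in `]t, t0[) f t0 u <= s t * ((t0 - t) `^ al * (Gamma al / Gamma (al + 1))).
  rewrite -e2 -(RintegralZl _ (measurable_itvR _) k2).
  apply: le_Rintegral => //; first exact: integrable_scale.
  move=> u /=; rewrite in_itv/= => /andP[tu ut0].
  rewrite /f mulrC; apply: ler_wpM2r; first exact: powR_ge0.
  by apply: smax => //; exact: ltW.
(* Log-convexity enters as [t0 (t - u) <= (t0 - u) t]; the exponent [al - 1] is negative and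
   reverses it. Positivity of [s] before [t0] allows multiplication by [s u]. *)
have A : \int[mu]_(u in `]0, t[) f t0 u <=
    t0 `^ (al - 1) / t `^ (al - 1) * \int[mu]_(u in `]0, t[) f t u.
  rewrite -(RintegralZl _ (measurable_itvR _) i1).
  apply: le_Rintegral => //; first exact: integrable_scale.
  move=> u /=; rewrite in_itv/= => /andP[u0 ut].
  rewrite /f mulrA ler_wpM2r ?(ltW (spos u u0 (lt_trans ut tt0)))//.
  have tu : 0 < t - u by rewrite subr_gt0.
  have t0u : 0 < t0 - u by rewrite subr_gt0 (lt_trans ut).
  rewrite mulrAC ler_pdivlMr// -(powRM _ (ltW t0u) (ltW t_gt0)) -(powRM _ (ltW t0_gt0) (ltW tu)).
  apply: le0_ler_powR; first by rewrite subr_le0 ltW.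
    by rewrite mulr_gt0.
  rewrite mulrBr mulrBl lerD2l lerN2 [leRHS]mulrC; apply: ler_wpM2l; exact: ltW.
move: A B Gs0 Gs1; rewrite split0.
set Ia := (\int[mu]_(u in `]0, t[) f t0 u).
set Ib := (\int[mu]_(u in `]t, t0[) f t0 u).
set Ic := (\int[mu]_(u in `]0, t[) f t u).
move: Ia Ib Ic => Ia Ib Ic A B Gs0 Gs1; rewrite {}Gs0.
rewrite mulrBr.
have -> : Gamma al * s t * ((t0 - t) `^ al / Gamma (al + 1)) =
    s t * ((t0 - t) `^ al * (Gamma al / Gamma (al + 1))).
  by move: (s t) (_ `^ al) (Gamma al) (Gamma (al + 1))^-1 => x y z w; ring.
have -> : Gamma al * s t * (t0 `^ (al - 1) / t `^ (al - 1)) =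
    t0 `^ (al - 1) - t0 `^ (al - 1) / t `^ (al - 1) * Ic.
  rewrite Gs1 mulrBl mulrCA mulfV ?gt_eqF// mulr1 [Ic * _]mulrC//.
by rewrite -addrA lerD2l -opprD lerN2 lerD.
Qed.

(** At the first point [t0] where [s] fails to be positive, continuity gives [s t0 <= 0]. Yet
    [s_lower], started at a maximum point of [s] on a short interval ending at [t0], gives
    [s t0 > 0]. *)
Lemma mlker_resolvent_ge0 t : 0 < t -> 0 <= s t.
Proof.
move=> tp; rewrite leNgt; apply/negP => st.
pose P := [set u | 0 < u /\ s u <= 0].
have Pt : P t by split => //; exact: ltW.
have [e /= e0 he] := s_gt0_near0.
have e_lb : lbound P e.
  move=> u [u0 su]; rewrite leNgt; apply/negP => ue.
  have := he u; rewrite /ball_ /= sub0r normrN gtr0_norm// => /(_ ue u0).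
  by rewrite ltNge su.
have P0 : has_inf P by split; [exists t|exists e].
pose t0 := inf P.
have t0_gt0 : 0 < t0 by apply: (lt_le_trans e0); apply: lb_le_inf => //; exists t.
have spos u : 0 < u -> u < t0 -> 0 < s u.
  move=> u0 ut0; rewrite ltNge; apply/negP => su.
  have : t0 <= u by apply: ge_inf; [case: P0|split].
  by rewrite leNgt ut0.
have st0 : s t0 <= 0.
  rewrite leNgt; apply/negP => st0.
  have /cvgr_gt/(_ _ st0)[d /= d0 hd] := s_continuous t0_gt0.
  have [p [p0 sp] pd] := inf_adherent d0 P0.
  have pt0 : t0 <= p by apply: ge_inf; [case: P0|split].
  have := hd p; rewrite /ball_ /= distrC ger0_norm ?subr_ge0// ltrBlDl => /(_ pd).
  by rewrite ltNge sp.
have G1 : 0 < Gamma (al + 1) by rewrite Gamma_gt0// addr_gt0.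
(* Within distance [d0] of [t0] the subtracted term of [s_lower] is at most [1 / 4]; beyond [t0 / 2]
   the ratio of powers is at least [1 / 2]. Hence the bracket is positive. *)
pose d0 := (Gamma (al + 1) / 4) `^ al^-1.
have d0_gt0 : 0 < d0 by rewrite powR_gt0// divr_gt0.
pose t1 := t0 - Num.min (t0 / 2) d0.
have m0 : 0 < Num.min (t0 / 2) d0 by rewrite lt_min divr_gt0.
have m1 : Num.min (t0 / 2) d0 <= t0 / 2 by rewrite ge_min lexx.
have m2 : Num.min (t0 / 2) d0 <= d0 by rewrite ge_min lexx orbT.
have t1_gt0 : 0 < t1.
  by rewrite /t1 subr_gt0 (le_lt_trans m1)// ltr_pdivrMr// ltr_pMr// ltr1n.
have t10 : t1 < t0 by rewrite /t1 gtrBl.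
have [tm tm_in tmax] : exists2 c, c \in `[t1, t0] & forall u, u \in `[t1, t0] -> s u <= s c.
  apply: EVT_max; first exact: ltW.
  apply: continuous_in_subspaceT => u; rewrite inE/= in_itv/= => /andP[ut _].
  by apply: s_continuous; exact: lt_le_trans ut.
have /andP[t1m tm0] : t1 <= tm <= t0 by move: tm_in; rewrite in_itv.
have tm_gt0 := lt_le_trans t1_gt0 t1m.
have stm : 0 < s tm.
  apply: (lt_le_trans (spos t1 t1_gt0 t10)); apply: tmax.
  by rewrite in_itv/= lexx ltW.
have tmt0 : tm < t0.
  by rewrite lt_neqAle tm0 andbT; apply/eqP => tmE; move: stm; rewrite tmE ltNge st0.
have := s_lower tm_gt0 tmt0 spos.
have h1 u : tm <= u -> u < t0 -> s u <= s tm.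
  move=> tu ut; apply: tmax; rewrite in_itv/= (le_trans t1m tu) ltW//.
move=> /(_ h1); apply/negP; rewrite -ltNge.
have Gal : 0 < Gamma al by rewrite Gamma_gt0.
apply: (@le_lt_trans _ _ 0); first by rewrite pmulr_rle0.
apply: mulr_gt0; first exact: mulr_gt0.
rewrite subr_gt0.
apply: (@lt_le_trans _ _ (1 / 2)).
  rewrite (ltr_pdivrMr _ _ G1).
  apply: (@le_lt_trans _ _ (d0 `^ al)).
    apply: ge0_ler_powR; rewrite ?nnegrE ?subr_ge0 ?(ltW al0) ?(ltW d0_gt0)//.
    by rewrite lerBlDr -lerBlDl (le_trans _ t1m)// /t1 lerB.
  rewrite /d0 -powRrM mulVf ?gt_eqF// powRr1; last by rewrite ltW// divr_gt0.
  by rewrite [ltRHS]mulrC ltr_pM2l// div1r ltf_pV2 ?posrE// ltr_nat.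
have tmh : 1 / 2 <= tm / t0.
  rewrite ler_pdivlMr// (le_trans _ t1m)// /t1 lerBrDr mulrC div1r.
  by rewrite [leRHS]splitr lerD2l.
apply: (le_trans tmh).
have -> : t0 `^ (al - 1) / tm `^ (al - 1) = (tm / t0) `^ (1 - al).
  rewrite powRM ?invr_ge0 ?ltW// -powRN opprB mulrC; congr (_ * _).
  by rewrite -[t0^-1]powR_inv1 ?ltW// -powRrM mulN1r opprB.
apply: ger1_powR; last by rewrite gerBl ltW.
by rewrite divr_gt0//= ler_pdivrMr// mul1r.
Qed.

End resolvent_positivity.

Section ml_sum_linear.
Variables (R : realType) (al : R).
Hypothesis al0 : 0 < al.
Implicit Types (b x : R) (c : nat -> R).

Lemma ml_sum_big b x N (w : nat -> R) (c : nat -> nat -> R) : 0 < b ->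
  (forall i, geometrically_bounded (c i)) ->
  \sum_(i < N) w i * ml_sum al b (c i) x =
  ml_sum al b (fun k => \sum_(i < N) w i * c i k) x.
Proof.
move=> b0 gc.
have sm i : abs_summable (ml_term al b (c i) x) by exact: ml_term_summable.
transitivity (\sum_(i < N) limn (series (fun k => w i * ml_term al b (c i) x k))).
  by apply: eq_bigr => i _; rewrite sumZ.
rewrite -(@sum_big _ _ (fun i k => w i * ml_term al b (c i) x k)); last first.
  by move=> i; exact: abs_summableZ.
apply: eq_sum => k; rewrite /ml_term !mulr_suml; apply: eq_bigr => i _.
by rewrite !mulrA.
Qed.

Lemma ml_sum_cvg b x (c : nat -> nat -> R) c' C Q : 0 < b -> 0 < Q ->
  (forall N k, `|c N k| <= C * Q ^+ k) ->
  (forall k, c N k @[N --> \oo] --> c' k) ->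
  ml_sum al b (c N) x @[N --> \oo] --> ml_sum al b c' x.
Proof.
move=> b0 Q0 cC cc'.
apply: (@tannery _ _ _ _ _ _ (fun k => `|ml_term al b (fun k => C * Q ^+ k) x k|)).
- apply: (@ml_term_summable _ _ al0 b _ x b0); exists `|C|, Q; split => // k.
  by rewrite normrM (ger0_norm (exprn_ge0 _ (ltW Q0))).
- apply: nearW => N k; rewrite /ml_term 2!normrM [leRHS]normrM [X in _ <= X * _]normrM.
  rewrite ler_wpM2r// ler_wpM2r//.
  exact: le_trans (cC N k) (ler_norm _).
- by move=> k; apply: cvgMl; apply: cvgMl; exact: cc'.
Qed.

Lemma eq_ml_sum b x c c' : c =1 c' -> ml_sum al b c x = ml_sum al b c' x.
Proof. by move=> /funext ->. Qed.

End ml_sum_linear.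

Section mittag_leffler_bounds.
Variables (R : realType) (al : R).
Hypothesis al01 : 0 < al < 1.
Let al0 : 0 < al. Proof. by case/andP: al01. Qed.
Let al1 : al < 1. Proof. by case/andP: al01. Qed.

(* [mlE x] is E_{al,1}(-x), and [mle j x] is (-x)^j / j! times its j-th derivative. *)
Definition mlE x : R := ml_sum al 1 (alt 1) x.
Definition bin_alt j (k : nat) : R := 'C(k, j)%:R * (-1) ^+ k.
(** The coefficients of [(1 + z)^(- j - 1)]; multiplying by [1 / (1 + z)], whose coefficients are
    [alt 1], therefore raises [j] by one. *)
Definition bin_alt_shift j (m : nat) : R := 'C(m + j, j)%:R * (-1) ^+ m.
Definition mle j x : R := (-1) ^+ j * ml_sum al 1 (bin_alt j) x.

Lemma bin_le_expn m k : ('C(m, k) <= 2 ^ m)%N.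
Proof.
have [km|mk] := leqP k m; last by rewrite bin_small.
have -> : (2 = 1 + 1)%N by []; rewrite expnDn.
rewrite (bigD1 (Ordinal (km : (k < m.+1)%N)))//= !exp1n !muln1.
exact: leq_addr.
Qed.

Lemma geometrically_bounded_bin_alt j : geometrically_bounded (bin_alt j).
Proof.
exists 1, 2; split => // k; rewrite mul1r normrM normrX normrN1 expr1n mulr1.
by rewrite ger0_norm// -natrX ler_nat bin_le_expn.
Qed.

Lemma geometrically_bounded_bin_alt_shift j : geometrically_bounded (bin_alt_shift j).
Proof.
exists (2 ^+ j), 2; split => // k; rewrite normrM normrX normrN1 expr1n mulr1.
by rewrite ger0_norm// -exprD addnC -natrX ler_nat bin_le_expn.
Qed.

Lemma bin_hockey_stick m j : (\sum_(i < m.+1) 'C(m - i + j, j) = 'C(m + j.+1, j.+1))%N.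
Proof.
transitivity (\sum_(i < m.+1) 'C(i + j, j))%N.
  rewrite (reindex_inj rev_ord_inj); apply: eq_bigr => i _ /=.
  by rewrite subSS subKn// -ltnS.
elim: m => [|m IH]; first by rewrite big_ord_recl big_ord0 add0n binn add0n binn.
by rewrite big_ord_recr /= IH (addSn m j.+1) binS addSnnS.
Qed.

Lemma cauchy_prod_bin_alt j :
  cauchy_prod (alt 1) (bin_alt_shift j) = bin_alt_shift j.+1.
Proof.
apply/funext => m; rewrite /cauchy_prod /bin_alt_shift /alt.
rewrite -bin_hockey_stick natr_sum mulr_suml; apply: eq_bigr => i _.
by rewrite mulrCA -exprD subnKC// -ltnS.
Qed.

(** For [j = 0] the function is the fractional integral of order [1 - al] of the nonnegative
    resolvent; each further [j] is one more convolution with the resolvent. *)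
Lemma mlker_bin_ge0 j t : 0 < t -> 0 <= mlker al (j%:R * al + 1) (bin_alt_shift j) t.
Proof.
elim: j t => [|j IH] t t0.
  rewrite mul0r add0r (_ : bin_alt_shift 0 = alt 1); last first.
    by apply/funext => m; rewrite /bin_alt_shift addn0 bin0 mul1r.
  have a1 : 0 < 1 - al by rewrite subr_gt0.
  have [_] := mlker_convolution al0 a1 al0 t0
    (@geometrically_bounded_delta0 R) (geometrically_bounded_alt 1).
  rewrite subrK cauchy_prod_delta0 => <-.
  apply: Rintegral_ge0 => u /=; rewrite in_itv/= => /andP[u0 _].
  apply: mulr_ge0; last exact: mlker_resolvent_ge0.
  by rewrite mlker_delta0 divr_ge0 ?powR_ge0// ltW// Gamma_gt0.
have jal : 0 < j%:R * al + 1 by rewrite ml_index_gt0.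
have [_] := mlker_convolution al0 al0 jal t0
  (geometrically_bounded_alt 1) (geometrically_bounded_bin_alt_shift j).
rewrite cauchy_prod_bin_alt (_ : al + (j%:R * al + 1) = j.+1%:R * al + 1); last first.
  by rewrite -natr1; ring.
move=> <-; apply: Rintegral_ge0 => u /=; rewrite in_itv/= => /andP[u0 ut].
apply: mulr_ge0; last exact: IH.
by apply: mlker_resolvent_ge0; rewrite // subr_gt0.
Qed.

Lemma sum_shift (u : nat -> R) j : abs_summable u -> (forall n, (n < j)%N -> u n = 0) ->
  limn (series u) = limn (series (fun n => u (n + j)%N)).
Proof.
elim: j u => [|j IH] u su u0; first by apply: eq_sum => n; rewrite addn0.
rewrite sum_recl// u0// add0r IH.
- by apply: eq_sum => n; rewrite addnS.
- exact: abs_summable_shift.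
- by move=> n nj; rewrite u0.
Qed.

(** The binomials vanish for the first [j] indices; shifting by [j] makes the signs cancel and
    raises the second parameter by [j al]. *)
Lemma mleE j x : mle j x = x ^+ j * ml_sum al (j%:R * al + 1) (bin_alt_shift j) x.
Proof.
have gb := geometrically_bounded_bin_alt j.
have s0 := @ml_term_summable _ _ al0 _ _ x ltr01 gb.
have E : ml_sum al 1 (bin_alt j) x = limn (series (fun n => ml_term al 1 (bin_alt j) x (n + j)%N)).
  by apply: sum_shift => // n nj; rewrite /ml_term /bin_alt bin_small// !mul0r.
have sh i : abs_summable (fun n => ml_term al 1 (bin_alt j) x (n + i)%N).
  elim: i => [|i IH]; first by under eq_fun do rewrite addn0.
  by under eq_fun do rewrite addnS -addSn; exact: (abs_summable_shift IH).
have sb := @ml_term_summable _ _ al0 _ _ x (ml_index_gt0 al0 j ltr01)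
  (geometrically_bounded_bin_alt_shift j).
rewrite /mle E -(sumZ _ (sh j)) -(sumZ _ sb).
apply: eq_sum => k; rewrite /ml_term /bin_alt /bin_alt_shift.
have -> : (k + j)%:R * al + 1 = k%:R * al + (j%:R * al + 1) by rewrite natrD; ring.
have s1 : (-1) ^+ j * (-1) ^+ j = 1 :> R by rewrite -exprD addnn -signr_odd odd_double.
rewrite !exprD; move: s1 (Gamma _)^-1.
move: ((-1) ^+ j) ((-1) ^+ k) (x ^+ k) (x ^+ j) ('C(k + j, j)%:R) => s t u v w s1 g.
transitivity (s * s * (v * (w * t * u * g))); first by clear; ring.
by rewrite s1 mul1r.
Qed.

Lemma mle_ge0 j x : 0 < x -> 0 <= mle j x.
Proof.
move=> x0; have t0 : 0 < x `^ al^-1 by rewrite powR_gt0.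
have xt : (x `^ al^-1) `^ al = x.
  by rewrite -powRrM mulVf ?gt_eqF// powRr1// ltW.
rewrite mleE; have := mlker_bin_ge0 j t0; rewrite /mlker xt addrK.
by rewrite powRrM powRAC xt powR_mulrn// ltW.
Qed.

End mittag_leffler_bounds.

(** * Bounds for the iterates of [x d/dx] *)

Section mittag_leffler_estimates.
Variables (R : realType) (al : R).
Hypothesis al01 : 0 < al < 1.
Let al0 : 0 < al. Proof. by case/andP: al01. Qed.

Lemma sum_bin_geometric (k N : nat) (z : R) : (k < N)%N ->
  \sum_(j < N) 'C(k, j)%:R * z ^+ j = (1 + z) ^+ k.
Proof.
move=> kN; rewrite exprDn (big_ord_widen _ (fun j => 1 ^+ (k - j) * z ^+ j *+ 'C(k, j)) kN).
rewrite [RHS]big_mkcond; apply: eq_bigr => j _.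
case: ifPn => [_|]; first by rewrite expr1n mul1r mulr_natl.
by rewrite -leqNgt => kj; rewrite bin_small// mul0r.
Qed.

(** The left side is a partial sum of the Taylor series of [E(-x)] at [x] taken at [x / 2], that is,
    with increment [- x / 2]. Its terms are nonnegative, so it increases to its limit. *)
Lemma sum_mle_le x N : 0 < x -> \sum_(j < N) (1 / 2) ^+ j * mle al j x <= mlE al (x / 2).
Proof.
move=> x0.
pose c n k : R := \sum_(j < n) (- (1 / 2)) ^+ j * bin_alt R j k.
have cE n : \sum_(j < n) (1 / 2) ^+ j * mle al j x = ml_sum al 1 (c n) x.
  rewrite -(ml_sum_big al0 _ _ _ ltr01); last by move=> i; exact: geometrically_bounded_bin_alt.
  apply: eq_bigr => j _; rewrite /mle mulrA -exprMn mulrN1.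
  by [].
have cvgc : ml_sum al 1 (c n) x @[n --> \oo] --> mlE al (x / 2).
  have -> : mlE al (x / 2) = ml_sum al 1 (fun k => (1 / 2) ^+ k * (-1) ^+ k) x.
    apply: eq_sum => k; rewrite /ml_term /alt.
    congr (_ / _); rewrite exprMn div1r; ring.
  apply: (@ml_sum_cvg R al al0 1 x c _ 1 2) => //.
    move=> n k; rewrite mul1r; apply: (le_trans (ler_norm_sum _ _ _)).
    apply: (@le_trans _ _ (\sum_(j < n + k.+1) 'C(k, j)%:R * 1 ^+ j)); last first.
      by rewrite sum_bin_geometric// ltn_addl.
    rewrite (big_ord_widen _ (fun j => `|(- (1 / 2)) ^+ j * bin_alt R j k|) (leq_addr k.+1 n)).
    rewrite [leLHS]big_mkcond; apply: ler_sum => j _.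
    rewrite expr1n mulr1; case: ifP => // _.
    rewrite normrM; have -> : `|bin_alt R j k| = 'C(k, j)%:R.
      by rewrite /bin_alt normrM normrX normrN1 expr1n mulr1 ger0_norm.
    rewrite normrX normrN ler_piMl//; apply: exprn_ile1 => //.
    by rewrite ger0_norm; lra.
  move=> k; apply: cvg_near_cst; near=> n.
  have kn : (k < n)%N by near: n; exact: nbhs_infty_gt.
  rewrite /c; under eq_bigr do rewrite /bin_alt mulrA [_ * 'C(_, _)%:R]mulrC.
  rewrite -mulr_suml sum_bin_geometric//; congr (_ ^+ _ * _); lra.
rewrite cE -(cvg_lim (@Rhausdorff R) cvgc).
apply: nondecreasing_cvgn_le; last by apply/cvg_ex; eexists; exact: cvgc.
apply/nondecreasing_seqP => n; rewrite -!cE big_ord_recr/= lerDl.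
by rewrite mulr_ge0 ?exprn_ge0 ?mle_ge0.
Unshelve. all: by end_near. Qed.

(* [surj j i] is the number of surjections from a j-set to an i-set. *)
Fixpoint surj (j i : nat) : nat :=
  if j is j'.+1 then (i * (surj j' i + surj j' i.-1))%N else (i == 0)%N.

Lemma surj_gt j i : (j < i)%N -> surj j i = 0%N.
Proof.
elim: j i => [|j IH] i /=; first by case: i.
case: i => // i ji; rewrite !IH ?muln0//=; exact: ltnW.
Qed.

(** The weight [2^i] compensates the factor [2^(- i)] of [sum_mle_le]. In the recurrence the two
    terms contribute 1 and 2, whence the base 3; the factor [i <= j + 1] builds the factorial. *)
Lemma surj_le j i : (surj j i * 2 ^ i <= 3 ^ j * j`!)%N.
Proof.
elim: j i => [|j IH] i /=; first by case: i.
have [ij|ji] := leqP i j.+1; last first.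
  by rewrite !surj_gt ?muln0// ?(ltn_trans _ ji)//; case: i ji.
apply: (@leq_trans (j.+1 * (3 * (3 ^ j * j`!)))); last first.
  by rewrite factS expnS mulnCA [in X in (_ <= X)%N]mulnACA mulnA [(3 * _ * _)%N]mulnAC mulnC.
case: i ij => [|i] ij; first by rewrite mul0n.
rewrite -mulnA; apply: leq_mul => //=.
rewrite mulnDl expnS [X in (_ + X)%N]mulnCA -expnS -[3%N]/(1 + 2)%N mulnDl mul1n.
by apply: leq_add; [exact: IH|rewrite leq_mul2l /=; exact: IH].
Qed.

(** Functions from a [j]-set to a [k]-set sorted by their image. The induction uses [k C(k, i) = i
    C(k, i) + (i + 1) C(k, i + 1)]. *)
Lemma expn_surj k j : (k ^ j = \sum_(i < j.+1) surj j i * 'C(k, i))%N.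
Proof.
elim: j => [|j IH]; first by rewrite big_ord_recl big_ord0 bin0.
rewrite expnS IH big_distrr/=.
have step i : (k * (surj j i * 'C(k, i)) =
    i * surj j i * 'C(k, i) + i.+1 * surj j i * 'C(k, i.+1))%N.
  have [ki|ik] := leqP i k; last by rewrite !bin_small ?muln0// ltnW.
  have -> : (i.+1 * surj j i * 'C(k, i.+1) = surj j i * ((k - i) * 'C(k, i)))%N.
    by rewrite mulnAC mul_bin_left mulnC.
  by rewrite [(i * surj j i)%N]mulnC -mulnA -mulnDr -mulnDl subnKC// mulnCA.
under eq_bigr do rewrite step.
rewrite big_split/= [RHS]big_ord_recl/= mul0n mul0n add0n.
under [RHS]eq_bigr do rewrite mulnDr mulnDl.
rewrite big_split/=; congr (_ + _)%N.
rewrite big_ord_recl /= mul0n mul0n add0n [RHS]big_ord_recr /=.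
by rewrite (@surj_gt j j.+1)// muln0 mul0n addn0.
Qed.

(* [mly j] is the j-th iterate of x d/dx on E_{al,1}(-x). *)
Definition mly j x : R := ml_sum al 1 (fun k => k%:R ^+ j * (-1) ^+ k) x.

Lemma mly_mle j x : mly j x = \sum_(i < j.+1) (-1) ^+ i * (surj j i)%:R * mle al i x.
Proof.
have -> : mly j x = ml_sum al 1 (fun k => \sum_(i < j.+1) (surj j i)%:R * bin_alt R i k) x.
  apply: eq_ml_sum => k; rewrite -natrX expn_surj natr_sum mulr_suml.
  by apply: eq_bigr => i _; rewrite /bin_alt natrM mulrA.
rewrite -(@ml_sum_big R al al0 1 x j.+1 (fun i => (surj j i)%:R) (bin_alt R) ltr01); last first.
  by move=> i; exact: geometrically_bounded_bin_alt.
apply: eq_bigr => i _; by rewrite /mle mulrACA -exprD addnn -signr_odd odd_double expr0 mul1r.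
Qed.

(** The iterate is a signed combination of the nonnegative [mle i]; [surj_le] bounds the weights and
    [sum_mle_le] the remaining sum. Halving the argument costs no decay. *)
Lemma mly_le j x : 0 < x -> `|mly j x| <= (3 ^ j * j`!)%:R * mlE al (x / 2).
Proof.
move=> x0; rewrite mly_mle; apply: (le_trans (ler_norm_sum _ _ _)).
apply: (@le_trans _ _ ((3 ^ j * j`!)%:R * \sum_(i < j.+1) (1 / 2) ^+ i * mle al i x)); last first.
  by apply: ler_wpM2l => //; exact: sum_mle_le.
rewrite mulr_sumr; apply: ler_sum => i _.
rewrite normrM normrM normrX normrN1 expr1n mul1r [`|_%:R|]ger0_norm//.
rewrite (ger0_norm (mle_ge0 al01 i x0)) mulrA; apply: ler_wpM2r; first exact: mle_ge0.
rewrite mul1r exprVn ler_pdivlMr ?exprn_gt0// -natrX -natrM ler_nat.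
exact: surj_le.
Qed.

Lemma mlE_ge0 x : 0 < x -> 0 <= mlE al x.
Proof.
move=> x0; have := mle_ge0 al01 0 x0.
rewrite /mle expr0 mul1r (_ : bin_alt R 0 = alt 1)//.
by apply/funext => k; rewrite /bin_alt bin0 mul1r.
Qed.

End mittag_leffler_estimates.

(** * Monotonicity, decay and Laplace transform of the Mittag-Leffler function *)

Section mittag_leffler_monotonicity.
Variables (R : realType) (al : R).
Hypothesis al01 : 0 < al < 1.
Local Notation mu := (@lebesgue_measure R).
Let al0 : 0 < al. Proof. by case/andP: al01. Qed.

Lemma mlE_scale lam x : mlE al (lam * x) = ml_sum al 1 (alt lam) x.
Proof.
apply: eq_sum => k; rewrite /ml_term /alt; congr (_ / _).
by rewrite -!exprMn mulNr mul1r mulNr.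
Qed.

Lemma mlker1_mlE lam t : mlker al 1 (alt lam) t = mlE al (lam * t `^ al).
Proof. by rewrite /mlker subrr powRr0 mul1r mlE_scale. Qed.

Lemma mlker1_recl lam t : 0 < t ->
  mlE al (lam * t `^ al) = 1 - lam * mlker al (al + 1) (alt lam) t.
Proof.
move=> t0; rewrite -mlker1_mlE mlker_alt_recl// mlker_delta0 subrr powRr0.
by rewrite Gamma1 divr1.
Qed.

(** The integrated form of the relaxation equation of order [al] with rate [lam] and initial value
    1. *)
Lemma mlE_volterra lam t : 0 < t ->
  mu.-integrable (`]0, t[ : set R)
    (EFin \o (fun u => (t - u) `^ (al - 1) * mlE al (lam * u `^ al))) /\
  lam * \int[mu]_(u in `]0, t[) ((t - u) `^ (al - 1) * mlE al (lam * u `^ al)) =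
  Gamma al * (1 - mlE al (lam * t `^ al)).
Proof.
move=> t0; have G0 := lt0r_neq0 (Gamma_gt0 al0).
have [int1 int2] := mlker_convolution al0 al0 ltr01 t0
  (@geometrically_bounded_delta0 R) (geometrically_bounded_alt lam).
have eqf : (fun u => (t - u) `^ (al - 1) * mlE al (lam * u `^ al)) =
    (fun u => Gamma al * (mlker al al (delta0 R) (t - u) * mlker al 1 (alt lam) u)).
  apply/funext => u; rewrite (mlker1_mlE lam u) mlker_delta0.
  move: (mlE _ _) (_ `^ (al - 1)) (Gamma al) G0 => m p G G0.
  by rewrite [RHS]mulrA [G * _]mulrC divfK.
rewrite eqf; split; first exact: integrable_scale.
rewrite (RintegralZl _ (measurable_itvR _) int1) int2 cauchy_prod_delta0 (mlker1_recl lam t0).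
by rewrite opprB addrCA subrr addr0 mulrCA.
Qed.

Lemma mlE_scale_ge0 lam t : 0 < lam -> 0 < t -> 0 <= mlE al (lam * t `^ al).
Proof. by move=> l0 t0; apply: mlE_ge0 => //; rewrite mulr_gt0// powR_gt0. Qed.

(** As a function of time it is 1 minus the integral of the nonnegative resolvent. *)
Lemma mlE_nonincreasing t u : 0 < t -> t <= u -> mlE al (u `^ al) <= mlE al (t `^ al).
Proof.
move=> t0 tu; have u0 := lt_le_trans t0 tu.
have rep w : 0 < w ->
    mu.-integrable (`]0, w[ : set R) (EFin \o (fun v => mlker al al (alt 1) v)) /\
    mlE al (w `^ al) = 1 - \int[mu]_(v in `]0, w[) mlker al al (alt 1) v.
  move=> w0.
  have [int1 int2] := mlker_convolution al0 ltr01 al0 w0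
    (@geometrically_bounded_delta0 R) (geometrically_bounded_alt 1).
  have eqf : (fun v => mlker al 1 (delta0 R) (w - v) * mlker al al (alt 1) v) =
      (fun v => mlker al al (alt 1) v).
    apply/funext => v.
    rewrite (@mlker_delta0 R al 1) (subrr 1) powRr0 Gamma1 divr1.
    exact: mul1r.
  move: int1 int2; rewrite eqf => int1 int2; split; first exact: int1.
  rewrite int2 cauchy_prod_delta0 -[w `^ al]mul1r (mlker1_recl 1 w0) (addrC 1 al).
  by congr (_ - _); exact: mul1r.
have [iu ->] := rep _ u0; have [_ ->] := rep _ t0.
have h : 0 <= t <= u by rewrite ltW.
have [_ _ ->] := Rintegral_split h iu.
rewrite opprD addrA gerBl; apply: Rintegral_ge0 => v /=.
by rewrite in_itv/= => /andP[tv _]; apply: mlker_resolvent_ge0 => //; exact: lt_trans tv.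
Qed.

(** On []0, t[] the function is at least its value at [t]. Inserted in the Volterra equation with
    [lam = 1], this gives [E t^al / Gamma (al + 1) <= 1 - E], which contains both bounds because
    [E >= 0]. *)
Lemma mlE_powR_bounds t : 0 < t ->
  mlE al (t `^ al) <= 1 /\ mlE al (t `^ al) * (t `^ al / Gamma (al + 1)) <= 1.
Proof.
move=> t0; have G0 := Gamma_gt0 al0.
have [int1] := mlE_volterra 1 t0.
rewrite !mul1r => eqI.
have E0 w : 0 < w -> 0 <= mlE al (w `^ al).
  by move=> w0; have := mlE_scale_ge0 ltr01 w0; rewrite mul1r.
have lower : mlE al (t `^ al) * (t `^ al * (Gamma al / Gamma (al + 1))) <=
    Gamma al * (1 - mlE al (t `^ al)).
  have h : 0 <= (0 : R) < t by apply/andP; split.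
  have [k2 e2] := Rintegral_powR_right al0 h.
  rewrite -eqI -[X in X `^ al * (_ / _)]subr0 -e2 -(RintegralZl _ (measurable_itvR _) k2).
  apply: le_Rintegral => //; first exact: integrable_scale.
  move=> u /=; rewrite in_itv/= => /andP[u0 ut].
  rewrite mul1r mulrC; apply: ler_wpM2l; first exact: powR_ge0.
  by apply: mlE_nonincreasing => //; exact: ltW.
have p0 : 0 <= t `^ al / Gamma (al + 1).
  by apply: divr_ge0; [exact: powR_ge0|apply/ltW/Gamma_gt0; exact: addr_gt0].
have lower' : mlE al (t `^ al) * (t `^ al / Gamma (al + 1)) <= 1 - mlE al (t `^ al).
  rewrite -(ler_pM2l G0); apply: le_trans lower.
  rewrite le_eqVlt; apply/orP; left; apply/eqP.
  move: (mlE al (t `^ al)) => x; move: (t `^ al) (Gamma al) (Gamma (al + 1))^-1 => y z w.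
  ring.
split.
  by rewrite -subr_ge0; apply: le_trans lower'; rewrite mulr_ge0// E0.
by apply: (le_trans lower'); rewrite gerBl E0.
Qed.

Let powRK x : 0 < x -> (x `^ al^-1) `^ al = x.
Proof. by move=> x0; rewrite -powRrM mulVf ?gt_eqF// powRr1// ltW. Qed.

Lemma mlE_le1 x : 0 < x -> mlE al x <= 1.
Proof.
move=> x0; have t0 : 0 < x `^ al^-1 by rewrite powR_gt0.
by have [+ _] := mlE_powR_bounds t0; rewrite powRK.
Qed.

Lemma mlE_le x : 0 < x -> mlE al x <= Gamma (al + 1) / x.
Proof.
move=> x0; have t0 : 0 < x `^ al^-1 by rewrite powR_gt0.
have [_] := mlE_powR_bounds t0; rewrite powRK// => h.
have G1 : 0 < Gamma (al + 1) by rewrite Gamma_gt0// addr_gt0.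
by rewrite ler_pdivlMr// -[leRHS]mul1r -ler_pdivrMr// -mulrA.
Qed.

Lemma cvg_exp_sum (z : R) : \sum_(j < N) z ^+ j / j`!%:R @[N --> \oo] --> expR z.
Proof.
rewrite (_ : (fun N => _) = series (exp_coeff z)); last by rewrite seriesEord.
exact: is_cvg_series_exp_coeff.
Qed.

Lemma exp_sum_le (z : R) N : 0 <= z -> \sum_(j < N) z ^+ j / j`!%:R <= expR z.
Proof.
move=> z0; apply: (@partial_sum_le R (exp_coeff z)).
  by move=> n; rewrite /exp_coeff /= mulr_ge0 ?exprn_ge0// invr_ge0.
exact: is_cvg_series_exp_coeff.
Qed.

(** Since [(x e^v)^k = x^k e^(v k)], expanding the exponential in powers of [v] brings out the
    factors [k^j] of [mly j]. The coefficients are dominated by [e^(|v| k)], uniformly in [N]. *)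
Lemma mlE_taylor x v :
  \sum_(j < N) v ^+ j / j`!%:R * mly al j x @[N --> \oo] --> mlE al (x * expR v).
Proof.
pose c N k : R := \sum_(j < N) v ^+ j / j`!%:R * (k%:R ^+ j * (-1) ^+ k).
have gc j : geometrically_bounded (fun k => k%:R ^+ j * (-1) ^+ k : R).
  (* [k^j / j!] is a single term of the series of [e^k]. *)
  exists j`!%:R, (expR 1); split; first exact: expR_gt0.
  move=> k; rewrite normrM normrX normrX normrN1 expr1n mulr1 ger0_norm//.
  rewrite -expRM_natl mulr1.
  rewrite -ler_pdivrMl ?ltr0n ?fact_gt0// mulrC.
  apply: le_trans (exp_sum_le j.+1 (ler0n _ k)).
  rewrite big_ord_recr/= lerDr; apply: sumr_ge0 => i _.
  by rewrite mulr_ge0 ?exprn_ge0// invr_ge0.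
have -> : (fun N => \sum_(j < N) v ^+ j / j`!%:R * mly al j x) = (fun N => ml_sum al 1 (c N) x).
  apply/funext => N; rewrite (@ml_sum_big R al al0 1 x N (fun j => v ^+ j / j`!%:R)
    (fun j k => k%:R ^+ j * (-1) ^+ k) ltr01 gc)//.
have -> : mlE al (x * expR v) = ml_sum al 1 (fun k => expR (v * k%:R) * (-1) ^+ k) x.
  apply: eq_sum => k; rewrite /ml_term /alt; congr (_ / _).
  by rewrite exprMn expRM_natr; move: ((-1) ^+ k) (x ^+ k) (expR v ^+ k) => s y w; ring.
apply: (@ml_sum_cvg R al al0 1 x c _ 1 (expR `|v|)) => //.
  move=> N k; rewrite mul1r; apply: (le_trans (ler_norm_sum _ _ _)).
  rewrite -expRM_natr; apply: le_trans (exp_sum_le N (mulr_ge0 (normr_ge0 v) (ler0n _ k))).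
  apply: ler_sum => j _.
  rewrite !normrM !normrX normrN1 expr1n mulr1 normfV exprMn.
  by rewrite [`|j`!%:R|]ger0_norm// [`|k%:R|]ger0_norm// mulrAC.
move=> k; rewrite (_ : (fun N => c N k) = (fun N => (\sum_(j < N) (v * k%:R) ^+ j / j`!%:R) * (-1) ^+ k)).
  by apply: cvgMl; exact: cvg_exp_sum.
apply/funext => N; rewrite /c mulr_suml; apply: eq_bigr => j _.
by rewrite exprMn; move: (v ^+ j) (k%:R ^+ j) (_^-1) ((-1) ^+ k) => *; ring.
Qed.

Lemma mlE_laplace lam : 0 < lam ->
  (\int[mu]_(t in `]0%R, +oo[) (mlE al (lam * t `^ al) * expR (- t))%:E =
   ((1 + lam)^-1)%:E)%E.
Proof.
move=> l0; have G0 := Gamma_gt0 al0.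
pose f t := mlE al (lam * t `^ al).
have mf : measurable_fun (`]0%R, +oo[ : set R) f.
  rewrite (_ : f = mlker al 1 (alt lam)); last by apply/funext => t; rewrite mlker1_mlE.
  by apply: measurable_mlker => //; exact: geometrically_bounded_alt.
have f0 t : 0 < t -> 0 <= f t by exact: mlE_scale_ge0.
have f1 t : 0 < t -> 0 <= 1 - f t.
  by move=> t0; rewrite subr_ge0 mlE_le1// mulr_gt0// powR_gt0.
have me : measurable_fun (`]0%R, +oo[ : set R) (fun t => expR (- t)) by exact: measurable_expRN.
pose L := (\int[mu]_(t in `]0%R, +oo[) (f t * expR (- t))%:E)%E.
(* Transforming [1 - E] separately avoids differences of extended reals: [J + L = 1] makes both
   finite, and the transformed Volterra equation reads [J = lam L]. *)
pose J := (\int[mu]_(t in `]0%R, +oo[) ((1 - f t) * expR (- t))%:E)%E.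
have mJ : measurable_fun (`]0%R, +oo[ : set R) (fun t => ((1 - f t) * expR (- t))%:E).
  apply/measurable_EFinP; apply: measurable_funM => //.
  by apply: measurable_funB => //; exact: measurable_cst.
have mL : measurable_fun (`]0%R, +oo[ : set R) (fun t => (f t * expR (- t))%:E).
  by apply/measurable_EFinP; exact: measurable_funM.
have L0 : (0 <= L)%E.
  apply: integral_ge0 => t /=; rewrite in_itv/= andbT => t0.
  by rewrite lee_fin mulr_ge0 ?f0 ?expR_ge0.
have pJ t : (`]0%R, +oo[%classic : set R) t -> (0 <= ((1 - f t) * expR (- t))%:E)%E.
  by rewrite /= in_itv/= andbT => t0; rewrite lee_fin mulr_ge0 ?f1 ?expR_ge0.
have J0 : (0 <= J)%E by exact: integral_ge0.
have JL : (J + L = 1%:E)%E.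
  rewrite /J /L -ge0_integralD//; last first.
    by move=> t /=; rewrite in_itv/= andbT => t0; rewrite lee_fin mulr_ge0 ?f0 ?expR_ge0.
  rewrite -[in RHS]Gamma1 -(Gamma_EFin ltr01); apply: eq_integral => t _.
  by rewrite subrr powRr0 -EFinD -mulrDl subrK.
have eqJ : ((Gamma al / lam)%:E * J = (Gamma al)%:E * L)%E.
  have := @laplace_convolution _ (fun x => x `^ (al - 1)) f
    (@measurable_powR_sub1 _ _ _) mf (fun x _ => powR_ge0 x _) f0.
  rewrite (Gamma_EFin al0) => <-.
  have gl : 0 <= Gamma al / lam by rewrite divr_ge0// ltW.
  rewrite /J -(ge0_integralZl_EFin mu (measurable_itvR _) pJ mJ gl).
  apply: eq_integral => t; rewrite inE/= in_itv/= andbT => t0.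
  have [it et] := mlE_volterra lam t0.
  have -> : (\int[mu]_(s in `]0%R, t[) ((t - s) `^ (al - 1) * f s)%:E)%E =
      (Gamma al / lam * (1 - f t))%:E.
    rewrite -[LHS]fineK; last exact: (integrable_fin_num (measurable_itvR _) it).
    congr EFin; apply: (mulfI (lt0r_neq0 l0)); rewrite [LHS]et mulrA; congr (_ * _).
    by rewrite mulrCA mulfV ?mulr1// lt0r_neq0.
  by rewrite -!EFinM mulrA mulrC.
rewrite -[LHS]/L; move: L L0 J J0 JL eqJ => [l| |] // l0' [j| |] // j0' [jl] [e].
have nz : 1 + lam != 0 by rewrite gt_eqF// addr_gt0.
have jE : j = lam * l.
  apply: (mulfI (lt0r_neq0 G0)); rewrite [RHS]mulrCA -e.
  by move: (lt0r_neq0 l0) (Gamma al) => lnz G; field.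
by congr EFin; apply: (mulfI nz); rewrite (mulfV nz) mulrDl mul1r -jE addrC.
Qed.

End mittag_leffler_monotonicity.

Lemma triple_sixth (R : realType) (x : R) : x <= 1 / 6 -> x * 3 <= 1 / 2.
Proof. lra. Qed.

Lemma sum_half_le2 (R : realType) N : \sum_(j < N) (1 / 2) ^+ j <= 2 :> R.
Proof.
suff -> : \sum_(j < N) (1 / 2) ^+ j = 2 - 2 * (1 / 2) ^+ N :> R.
  by rewrite gerBl mulr_ge0// exprn_ge0.
elim: N => [|N IH]; first by rewrite big_ord0 expr0 mulr1 subrr.
by rewrite big_ord_recr /= IH exprS; move: ((1 / 2) ^+ N) => x; field.
Qed.

(** * Relaxation series *)

Section relaxation_series.
Variables (R : realType) (al : R) (lam r : nat -> R) (rho0 m : R).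
Hypothesis al01 : 0 < al < 1.
Hypothesis m0 : 0 < m.
Hypothesis lam_ge : forall n, m <= lam n.
Hypothesis r_summable : abs_summable (fun n => r n / lam n).
Let al0 : 0 < al. Proof. by case/andP: al01. Qed.
Let al1 : al < 1. Proof. by case/andP: al01. Qed.
Let lam0 n : 0 < lam n. Proof. exact: lt_le_trans (lam_ge n). Qed.
Let G1 : 0 < Gamma (al + 1). Proof. by rewrite Gamma_gt0// addr_gt0. Qed.

Definition relax (t : R) : R :=
  rho0 + limn (series (fun n => r n * mlE al (lam n * t `^ al))).

Lemma relax_term_le t n : 0 < t ->
  `|r n * mlE al (lam n * t `^ al)| <= Gamma (al + 1) / t `^ al * `|r n / lam n|.
Proof.
move=> t0; have ta : 0 < t `^ al by rewrite powR_gt0.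
have x0 : 0 < lam n * t `^ al by rewrite mulr_gt0.
rewrite normrM (ger0_norm (mlE_ge0 al01 x0)).
apply: (le_trans (ler_wpM2l (normr_ge0 _) (mlE_le al01 x0))).
rewrite normrM normfV (gtr0_norm (lam0 n)) invfM.
move: `|r n| (Gamma _) (lam n)^-1 (t `^ al)^-1 => a b c d.
by rewrite le_eqVlt; apply/orP; left; apply/eqP; ring.
Qed.

Lemma relax_summable t : 0 < t ->
  abs_summable (fun n => r n * mlE al (lam n * t `^ al)).
Proof.
move=> t0; apply: (@abs_summable_le _ _ _ (fun n => relax_term_le n t0)).
by apply: is_cvg_seriesZ.
Qed.

Let mly_term_le t j n : 0 < t ->
  `|r n * mly al j (lam n * t `^ al)| <=
  (3 ^ j * j`!)%:R * (2 * Gamma (al + 1) / t `^ al * `|r n / lam n|).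
Proof.
move=> t0; have ta : 0 < t `^ al by rewrite powR_gt0.
have x0 : 0 < lam n * t `^ al by rewrite mulr_gt0.
have x2 : 0 < lam n * t `^ al / 2 by rewrite divr_gt0.
rewrite normrM.
apply: (le_trans (ler_wpM2l (normr_ge0 _) (mly_le al01 j x0))).
rewrite mulrCA; apply: ler_wpM2l => //.
apply: (le_trans (ler_wpM2l (normr_ge0 _) (mlE_le al01 x2))).
rewrite normrM normfV (gtr0_norm (lam0 n)) !invfM invrK.
move: `|r n| (Gamma _) (lam n)^-1 (t `^ al)^-1 => a b c d.
by rewrite le_eqVlt; apply/orP; left; apply/eqP; ring.
Qed.

(** Replacing [t] by [t e^u] multiplies the argument by [e^(al u)], so [mlE_taylor] applies with
    [v = al u]. The [j!] of [mly_le] cancels that of the Taylor coefficient. The constant [C]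
    depends on [t], the radius does not. *)
Lemma relax_taylor t : 0 < t -> exists d C,
  (forall j, `|d j| <= C * 3 ^+ j) /\
  (forall u, `|u| <= 1 / 6 -> relax (t * expR u) = rho0 + limn (series (fun j => d j * u ^+ j))).
Proof.
move=> t0; pose B n := 2 * Gamma (al + 1) / t `^ al * `|r n / lam n|.
have sB : cvgn (series B) by exact: is_cvg_seriesZ.
have B0 n : 0 <= B n.
  by rewrite mulr_ge0// divr_ge0 ?powR_ge0// mulr_ge0// ltW.
pose y j n := mly al j (lam n * t `^ al).
have sy j : abs_summable (fun n => r n * y j n).
  apply: (@abs_summable_le _ _ (fun n => (3 ^ j * j`!)%:R * B n)).
    by move=> n; exact: mly_term_le.
  exact: is_cvg_seriesZ.
pose d j := al ^+ j / j`!%:R * limn (series (fun n => r n * y j n)).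
exists d, (limn (series B)).
have fne0 j : j`!%:R != 0 :> R by rewrite pnatr_eq0 -lt0n fact_gt0.
have dle j : `|d j| <= limn (series B) * 3 ^+ j.
  rewrite normrM [X in X * _ <= _]ger0_norm; last first.
    by rewrite divr_ge0// exprn_ge0// ltW.
  have h : `|limn (series (fun n => r n * y j n))| <= (3 ^ j * j`!)%:R * limn (series B).
    have -> : (3 ^ j * j`!)%:R * limn (series B) = limn (series (fun n => (3 ^ j * j`!)%:R * B n)).
      rewrite sumZ//; apply: (@abs_summable_le _ _ B) => // n; rewrite ger0_norm//.
    apply: norm_sum_le; first by move=> n; exact: mly_term_le.
    exact: is_cvg_seriesZ.
  have a1 : al ^+ j <= 1 by rewrite exprn_ile1// ltW.
  have S0 : 0 <= limn (series B) by exact: sum_ge0.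
  apply: (@le_trans _ _ (1 / j`!%:R * ((3 ^ j * j`!)%:R * limn (series B)))).
    apply: ler_pM; [|exact: normr_ge0|by apply: ler_wpM2r|exact: h].
    by rewrite divr_ge0// exprn_ge0// ltW.
  rewrite natrM natrX le_eqVlt; apply/orP; left; apply/eqP.
  by move: (limn (series B)) (3 ^+ j) (fne0 j) => S p nz; field.
split=> // u u6.
have te0 : (t * expR u) `^ al = t `^ al * expR (al * u).
  by rewrite powRM ?(ltW t0) ?expR_ge0// mulrC -expRM [u * al]mulrC mulrC.
rewrite /relax te0; congr (_ + _).
pose v := al * u.
have v6 : `|v| <= 1 / 6.
  rewrite normrM (gtr0_norm al0); apply: le_trans u6.
  by rewrite ler_piMl// ltW.
have termE N : \sum_(j < N) d j * u ^+ j =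
    limn (series (fun n => \sum_(j < N) v ^+ j / j`!%:R * (r n * y j n))).
  rewrite (@sum_big _ N (fun j n => v ^+ j / j`!%:R * (r n * y j n))); last first.
    by move=> j; exact: abs_summableZ.
  apply: eq_bigr => j _; rewrite sumZ// /d /v exprMn.
  by move: (limn _) (al ^+ j) (u ^+ j) (j`!%:R^-1) => *; ring.
have lim1 : \sum_(j < N) d j * u ^+ j @[N --> \oo] -->
    limn (series (fun n => r n * mlE al (lam n * (t `^ al * expR v)))).
  rewrite (_ : (fun N => _) = (fun N => limn (series (fun n =>
    r n * \sum_(j < N) v ^+ j / j`!%:R * y j n)))); last first.
    apply/funext => N; rewrite termE; apply: eq_sum => n; rewrite mulr_sumr.
    by apply: eq_bigr => j _; rewrite mulrCA.
  (* For [|v| <= 1 / 6] the [j]-th term is at most [(3 |v|)^j B n <= 2^(- j) B n]; summing over [j]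
     gives the factor 2. *)
  apply: (@tannery _ _ _ _ _ _ (fun n => 2 * B n)).
  - exact: is_cvg_seriesZ.
  - apply: nearW => N n; rewrite mulr_sumr; apply: (le_trans (ler_norm_sum _ _ _)).
    apply: (@le_trans _ _ (\sum_(j < N) B n * (1 / 2) ^+ j)).
      apply: ler_sum => j _; rewrite mulrCA normrM.
      apply: (le_trans (ler_wpM2l (normr_ge0 _) (mly_term_le j n t0))); rewrite -/(B n).
      have -> : `|v ^+ j / j`!%:R| = `|v| ^+ j / j`!%:R.
        by rewrite normrM normrX normfV [`|_%:R|]ger0_norm.
      rewrite mulrA [leRHS]mulrC; apply: ler_wpM2r => //.
      rewrite natrM natrX (_ : _ / _ * _ = (`|v| * 3) ^+ j); last first.
        by rewrite exprMn; move: (`|v| ^+ j) (3 ^+ j) (fne0 j) => *; field.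
      by apply: lerXn2r; rewrite ?nnegrE ?mulr_ge0//; exact: triple_sixth.
    rewrite -mulr_sumr mulrC; apply: ler_wpM2r => //.
    exact: sum_half_le2.
  - move=> n; apply: cvgMr; rewrite mulrA; exact: mlE_taylor.
rewrite -(cvg_lim (@Rhausdorff R) lim1) -/v; congr (limn _).
by rewrite seriesEord.
Qed.

End relaxation_series.

(** * Continuation in time *)

Section continuation.
Variable R : realType.

(** The difference of the two sides is one power series, the constants being absorbed in its
    coefficient of index 0 through [delta0]. It vanishes to the right of 0, so all its coefficients
    vanish. *)
Lemma taylor_identity (d d' : nat -> R) (C C' e rho0 rho0' : R) : 0 < e ->
  (forall j, `|d j| <= C * 3 ^+ j) -> (forall j, `|d' j| <= C' * 3 ^+ j) ->
  (forall u, 0 < u -> u < e -> u <= 1 / 6 ->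
     rho0 + limn (series (fun j => d j * u ^+ j)) =
     rho0' + limn (series (fun j => d' j * u ^+ j))) ->
  forall u, `|u| <= 1 / 6 ->
     rho0 + limn (series (fun j => d j * u ^+ j)) =
     rho0' + limn (series (fun j => d' j * u ^+ j)).
Proof.
move=> e0 dC d'C eqd.
pose w j := d j - d' j + (rho0 - rho0') * delta0 R j.
have smb (x : nat -> R) X u : `|u| <= 1 / 6 -> (forall j, `|x j| <= X * 3 ^+ j) ->
    abs_summable (fun j => x j * u ^+ j).
  move=> u6 xX; have h : 0 <= `|u| * 3 <= 1 / 2 by rewrite mulr_ge0//= triple_sixth.
  have [] := @geometric_tail R (fun j => x j * u ^+ j) X (`|u| * 3) 0 h; last by [].
  move=> k; rewrite normrM normrX exprMn [`|u| ^+ k * _]mulrC mulrA.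
  by apply: ler_wpM2r; [rewrite exprn_ge0|exact: xX].
have d0 j : `|delta0 R j| <= 1 * 3 ^+ j.
  rewrite mul1r /delta0; case: eqP => _; rewrite ?normr0 ?exprn_ge0// normr1.
  by apply: exprn_ege1; lra.
have d0s u : limn (series (fun j => delta0 R j * u ^+ j)) = 1.
  rewrite (@sum_finite _ _ 1) ?big_ord_recl ?big_ord0 /delta0 ?expr0 ?mulr1 ?addr0//.
  by case=> // n _; rewrite mul0r.
have wE u : `|u| <= 1 / 6 -> limn (series (fun j => w j * u ^+ j)) =
    (rho0 + limn (series (fun j => d j * u ^+ j))) -
    (rho0' + limn (series (fun j => d' j * u ^+ j))).
  move=> u6; have s1 := smb _ _ _ u6 dC; have s2 := smb _ _ _ u6 d'C.
  have s3 := smb _ _ _ u6 d0.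
  rewrite (_ : (fun j => w j * u ^+ j) = (fun j => (d j * u ^+ j + (-1) * (d' j * u ^+ j)) +
      (rho0 - rho0') * (delta0 R j * u ^+ j))); last first.
    by apply/funext => j; rewrite /w; ring.
  rewrite sumD; [|by apply: abs_summableD => //; exact: abs_summableZ|exact: abs_summableZ].
  rewrite sumD//; last exact: abs_summableZ.
  rewrite !sumZ// d0s; ring.
have wC j : `|w j| <= (C + C' + `|rho0 - rho0'|) * 3 ^+ j.
  rewrite !mulrDl; apply: (le_trans (ler_normD _ _)); apply: lerD.
    by apply: (le_trans (ler_normB _ _)); exact: lerD.
  by rewrite normrM; apply: ler_wpM2l => //; rewrite -[leRHS]mul1r.
have w0 : forall j, w j = 0.
  apply: (@pseries_eq0 R w _ 3 _ wC) => //.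
  near=> u; have u0 : 0 < u by near: u; exact: nbhs_right_gt.
  have ue : u < e by near: u; exact: nbhs_right_lt.
  have u6 : u <= 1 / 6 by near: u; apply: nbhs_right_le; lra.
  by rewrite wE ?(gtr0_norm u0)// eqd// subrr.
move=> u u6; apply/eqP; rewrite -subr_eq0 -wE// (@sum_finite _ _ 0) ?big_ord0//.
by move=> n _; rewrite w0 mul0r.
Unshelve. all: by end_near. Qed.

Lemma exp_step_propagation (H H' : R -> R) (T1 T2 : R) :
  (forall t e, 0 < t -> 0 < e ->
     (forall u, 0 < u -> u < e -> H (t * expR u) = H' (t * expR u)) ->
     forall u, `|u| <= 1 / 6 -> H (t * expR u) = H' (t * expR u)) ->
  0 < T1 -> T1 < T2 ->
  (forall t, T1 <= t <= T2 -> H t = H' t) -> forall t, 0 < t -> H t = H' t.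
Proof.
move=> step T10 T12 HH.
have base u : `|u| <= 1 / 6 -> H (T1 * expR u) = H' (T1 * expR u).
  apply: (step _ (ln (T2 / T1))) => //.
    by rewrite ln_gt0// ltr_pdivlMr// mul1r.
  move=> v v0 ve; apply: HH; rewrite ler_peMr ?(ltW T10)//=; last first.
    by rewrite -expR0 ler_expR ltW.
  rewrite mulrC -ler_pdivlMr// -[leRHS]lnK ?posrE ?divr_gt0// ?(lt_trans T10)//.
  by rewrite ler_expR ltW.
(* Blocks of length [1 / 12]: given agreement for [|u| <= (n + 2) / 12], the centres [(n + 1) / 12]
   and its opposite have a known interval of length [1 / 12] to their right, and the radius [1 / 6]
   around them reaches [(n + 3) / 12] in absolute value. *)
have ind n : forall u, `|u| <= (n%:R + 2) / 12 -> H (T1 * expR u) = H' (T1 * expR u).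
  elim: n => [|n IH] u un.
    by apply: base; move: un; rewrite add0r; lra.
  have n0 : 0 <= n%:R :> R by [].
  rewrite -natr1 in un.
  pose s := (n%:R + 1) / 12 : R.
  have s0 : 0 <= s by rewrite /s; lra.
  have [|un'] := leP `|u| ((n%:R + 2) / 12); first exact: IH.
  move: un; rewrite ler_norml => /andP[un1 un2].
  have [u0|u0] := leP 0 u; [rewrite (ger0_norm u0) in un'|rewrite (ltr0_norm u0) in un'].
  - have -> : T1 * expR u = T1 * expR s * expR (u - s) by rewrite -mulrA -expRD addrC subrK.
    apply: (step _ (1 / 12)).
    + by rewrite mulr_gt0 ?expR_gt0.
    + by rewrite divr_gt0.
    + move=> v v0 v1; rewrite -mulrA -expRD; apply: IH.
      by rewrite ger0_norm ?addr_ge0 ?(ltW v0)// /s; lra.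
    + by rewrite ler_norml /s; apply/andP; split; lra.
  - have -> : T1 * expR u = T1 * expR (- s) * expR (u + s).
      by rewrite -mulrA -expRD addrCA addNr addr0.
    apply: (step _ (1 / 12)).
    + by rewrite mulr_gt0 ?expR_gt0.
    + by rewrite divr_gt0.
    + move=> v v0 v1; rewrite -mulrA -expRD; apply: IH.
      by rewrite ler_norml; move: s0; rewrite /s => s0; apply/andP; split; lra.
    + by rewrite ler_norml /s; apply/andP; split; lra.
move=> t t0; have tT : 0 < t / T1 by rewrite divr_gt0.
have -> : t = T1 * expR (ln (t / T1)) by rewrite lnK ?posrE// mulrC divfK ?gt_eqF.
apply: (ind (Num.bound (12 * `|ln (t / T1)|))).
rewrite ler_pdivlMr// mulrC.
have /archi_boundP h : 0 <= 12 * `|ln (t / T1)| by rewrite mulr_ge0.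
by rewrite (le_trans (ltW h))// lerDl.
Qed.

Variables (al al' : R) (lam lam' r r' : nat -> R) (rho0 rho0' m : R).
Hypothesis al01 : 0 < al < 1.
Hypothesis al'01 : 0 < al' < 1.
Hypothesis m0 : 0 < m.
Hypothesis lam_ge : forall n, m <= lam n.
Hypothesis lam'_ge : forall n, m <= lam' n.
Hypothesis r_summable : abs_summable (fun n => r n / lam n).
Hypothesis r'_summable : abs_summable (fun n => r' n / lam' n).
Let H := relax al lam r rho0.
Let H' := relax al' lam' r' rho0'.

Lemma relax_continuation_step t e : 0 < t -> 0 < e ->
  (forall u, 0 < u -> u < e -> H (t * expR u) = H' (t * expR u)) ->
  forall u, `|u| <= 1 / 6 -> H (t * expR u) = H' (t * expR u).
Proof.
move=> t0 e0 HH.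
have [d [C [dC dE]]] := relax_taylor rho0 al01 m0 lam_ge r_summable t0.
have [d' [C' [d'C d'E]]] := relax_taylor rho0' al'01 m0 lam'_ge r'_summable t0.
have key := taylor_identity e0 dC d'C (rho0 := rho0) (rho0' := rho0').
move=> u u6; rewrite /H /H' (dE u u6) (d'E u u6); apply: key => // v v0 ve v6.
have v6' : `|v| <= 1 / 6 by rewrite gtr0_norm.
by have := HH v v0 ve; rewrite /H /H' (dE v v6') (d'E v v6').
Qed.

Lemma relax_continuation (T1 T2 : R) : 0 < T1 -> T1 < T2 ->
  (forall t, T1 <= t <= T2 -> H t = H' t) -> forall t, 0 < t -> H t = H' t.
Proof. exact: (exp_step_propagation relax_continuation_step). Qed.

End continuation.

(** * Laplace transform of the relaxation series *)

Section relaxation_laplace.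
Variables (R : realType) (al : R) (lam r : nat -> R) (rho0 m : R).
Hypothesis al01 : 0 < al < 1.
Hypothesis m0 : 0 < m.
Hypothesis lam_ge : forall n, m <= lam n.
Hypothesis r_summable : abs_summable (fun n => r n / lam n).
Local Notation mu := (@lebesgue_measure R).
Let al0 : 0 < al. Proof. by case/andP: al01. Qed.
Let al1 : al < 1. Proof. by case/andP: al01. Qed.
Let lam0 n : 0 < lam n. Proof. exact: lt_le_trans (lam_ge n). Qed.

Lemma integrable_gamma (b : R) : 0 < b ->
  mu.-integrable (`]0, +oo[ : set R) (EFin \o (fun t => t `^ (b - 1) * expR (- t))).
Proof.
move=> b0; apply/integrableP; split; first exact: measurable_gamma_integrand.
rewrite (_ : (fun x => `|_|) = (fun t => (t `^ (b - 1) * expR (- t))%:E))%E.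
  exact: integral_gamma_lty.
by apply/funext => t /=; rewrite ger0_norm// mulr_ge0 ?powR_ge0 ?expR_ge0.
Qed.

Lemma Rintegral_mlE_laplace l : 0 < l ->
  mu.-integrable (`]0, +oo[ : set R)
    (EFin \o (fun t => mlE al (l * t `^ al) * expR (- t))) /\
  \int[mu]_(t in `]0, +oo[) (mlE al (l * t `^ al) * expR (- t)) = (1 + l)^-1.
Proof.
move=> l0; have e := mlE_laplace al01 l0.
split; last by rewrite /Rintegral e.
apply/integrableP; split.
  apply/measurable_EFinP; apply: measurable_funM; last exact: measurable_expRN.
  rewrite (_ : (fun t => _) = mlker al 1 (alt l)); last by apply/funext => t; rewrite mlker1_mlE.
  by apply: measurable_mlker => //; exact: geometrically_bounded_alt.
have -> : (\int[mu]_(x in `]0%R, +oo[) `|(mlE al (l * x `^ al) * expR (- x))%:E| =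
    \int[mu]_(t in `]0%R, +oo[) (mlE al (l * t `^ al) * expR (- t))%:E)%E.
  apply: eq_integral => t; rewrite inE/= in_itv/= andbT => t0.
  by rewrite ger0_norm// mulr_ge0 ?expR_ge0// mlE_ge0// mulr_gt0// powR_gt0.
by rewrite e ltry.
Qed.

(** Rescaling time by [z] keeps the weight [e^(-t)] fixed, so the transform at frequency 1 applies
    to each mode with rate [lam n * z^al]. *)
Lemma relax_laplace z : 0 < z ->
  \int[mu]_(t in `]0, +oo[) (relax al lam r rho0 (t * z) * expR (- t)) =
  rho0 + limn (series (fun n => r n / (1 + lam n * z `^ al))).
Proof.
move=> z0; have za : 0 < z `^ al by rewrite powR_gt0.
pose D : set (measurableTypeR R) := `]0, +oo[%classic.
have mD : measurable D by exact: measurable_itvR.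
pose l n := lam n * z `^ al.
have l0 n : 0 < l n by rewrite mulr_gt0.
pose phi n t := mlE al (l n * t `^ al) * expR (- t).
have intphi n : mu.-integrable D (EFin \o phi n) by have [] := Rintegral_mlE_laplace (l0 n).
have inte : mu.-integrable D (EFin \o (fun t => expR (- t))).
  apply: eq_integrable (integrable_gamma ltr01) => //.
  by move=> t _ /=; rewrite subrr powRr0 mul1r.
have Rinte : \int[mu]_(t in D) expR (- t) = 1.
  rewrite -[RHS]Gamma1 /Gamma; apply: eq_Rintegral => t _.
  by rewrite subrr powRr0 mul1r.
pose S N t := rho0 * expR (- t) + \sum_(n < N) r n * phi n t.
have intS N : mu.-integrable D (EFin \o S N) /\
    \int[mu]_(t in D) S N t = rho0 + \sum_(n < N) r n / (1 + l n).
  have i1 : mu.-integrable D (EFin \o (fun t => rho0 * expR (- t))) by exact: integrable_scale.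
  have i2 n : mu.-integrable D (EFin \o (fun t => r n * phi n t)) by exact: integrable_scale.
  have i3 := @integrable_bigsum R D N (fun n t => r n * phi n t) mD i2.
  split; first exact: (integrableD mD i1 i3).
  rewrite (RintegralD mD i1 i3) (RintegralZl _ mD inte) Rinte mulr1; congr (_ + _).
  rewrite (@Rintegral_bigsum R D N (fun n t => r n * phi n t) mD i2).
  apply: eq_bigr => n _; rewrite (RintegralZl _ mD (intphi n)); congr (_ * _).
  by have [] := Rintegral_mlE_laplace (l0 n).
(* Majorant of all partial sums, from [relax_term_le]. The power is [t^(- al)], written as
   [t^((1 - al) - 1)] to be a [Gamma] integrand with positive parameter [1 - al]. *)
pose K := Gamma (al + 1) / z `^ al * limn (series (fun n => `|r n / lam n|)).
pose g t := `|rho0| * expR (- t) + K * (t `^ (1 - al - 1) * expR (- t)).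
have intg : mu.-integrable D (EFin \o g).
  apply: (integrableD mD (f := EFin \o (fun t => `|rho0| * expR (- t)))
    (g := EFin \o (fun t => K * (t `^ (1 - al - 1) * expR (- t))))).
    exact: integrable_scale.
  by apply: integrable_scale => //; apply: integrable_gamma; rewrite subr_gt0.
pose F t := relax al lam r rho0 (t * z) * expR (- t).
have lamE n t : 0 < t -> lam n * (t * z) `^ al = l n * t `^ al.
  by move=> t0; rewrite powRM ?ltW// /l [t `^ al * _]mulrC mulrA.
have SF t : D t -> S N t @[N --> \oo] --> F t.
  rewrite /D /= in_itv/= andbT => t0.
  rewrite /S /F /relax mulrDl; apply: cvgD; first exact: cvg_cst.
  have tz : 0 < t * z by rewrite mulr_gt0.
  have := abs_summable_cvg (relax_summable al01 m0 lam_ge r_summable tz).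
  rewrite seriesEord => h.
  rewrite (_ : (fun N => _) = (fun N => (\sum_(n < N) r n * mlE al (lam n * (t * z) `^ al)) * expR (- t))).
    apply: cvgMl; exact: h.
  apply/funext => N; rewrite mulr_suml; apply: eq_bigr => n _.
  by rewrite /phi mulrA lamE.
have Sg N t : D t -> `|S N t| <= g t.
  rewrite /D /= in_itv/= andbT => t0.
  have tz : 0 < t * z by rewrite mulr_gt0.
  apply: (le_trans (ler_normD _ _)); apply: lerD.
    by rewrite normrM [`|expR _|]ger0_norm// expR_ge0.
  apply: (le_trans (ler_norm_sum _ _ _)).
  rewrite mulrA.
  apply: (@le_trans _ _ ((\sum_(n < N) Gamma (al + 1) / (t * z) `^ al * `|r n / lam n|) * expR (- t))).
    rewrite mulr_suml; apply: ler_sum => n _.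
    rewrite /phi mulrA normrM [`|expR _|]ger0_norm ?expR_ge0//; apply: ler_wpM2r.
      exact: expR_ge0.
    rewrite -lamE//; exact: relax_term_le al01 m0 lam_ge _ _ tz.
  apply: ler_wpM2r; first exact: expR_ge0.
  have ta : t `^ (1 - al - 1) = (t `^ al)^-1 by rewrite addrAC subrr add0r powRN.
  rewrite -mulr_sumr /K ta [leRHS]mulrAC; apply: ler_pM.
  - by apply: divr_ge0; [apply/ltW/Gamma_gt0; exact: addr_gt0|exact: powR_ge0].
  - by apply: sumr_ge0.
  - by rewrite (powRM _ (ltW t0) (ltW z0)) invfM mulrA mulrAC.
  - exact: partial_sum_le.
have mF : measurable_fun D (EFin \o F).
  apply: (@emeasurable_fun_cvg _ _ _ D (fun N => EFin \o S N)).
    by move=> N; have [/integrableP[]] := intS N.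
  by move=> t Dt; apply: cvg_EFin; [exact: nearW|exact: SF].
have [] := @dominated_convergence _ _ R mu D mD (fun N => EFin \o S N) (EFin \o F) (EFin \o g) _ mF _ intg.
- by move=> N; have [/integrableP[]] := intS N.
- by apply: aeW => t Dt; apply: cvg_EFin; [exact: nearW|exact: SF].
- by apply: aeW => t N Dt; rewrite /= lee_fin; exact: Sg.
move=> _ _ lime.
have limE : (\int[mu]_(t in D) (S N t)%:E @[N --> \oo] -->
    (rho0 + limn (series (fun n => r n / (1 + l n))))%:E)%E.
  rewrite (_ : (fun N => _) = EFin \o (fun N => rho0 + \sum_(n < N) r n / (1 + l n))).
    apply: cvg_EFin; first exact: nearW.
    apply: cvgD; first exact: cvg_cst.
    rewrite (_ : (fun N => _) = series (fun n => r n / (1 + l n))); last by rewrite seriesEord.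
    apply: abs_summable_cvg; apply: (@abs_summable_le _ _ (fun n => (z `^ al)^-1 * `|r n / lam n|)).
      move=> n; rewrite !normrM !normfV (gtr0_norm (lam0 n)) mulrCA; apply: ler_wpM2l => //.
      have p1 : 0 < 1 + l n by rewrite addr_gt0.
      rewrite (gtr0_norm p1) -invfM lef_pV2 ?posrE ?mulr_gt0//.
      by rewrite mulrC lerDr.
    exact: is_cvg_seriesZ.
  apply/funext => N /=; have [iN vN] := intS N.
  by rewrite -[LHS]fineK; [congr EFin; exact: vN|exact: (integrable_fin_num mD iN)].
exact: (congr1 fine (cvg_unique (@ereal_hausdorff R) lime limE)).
Qed.

End relaxation_laplace.

(** * Identification from the Laplace transform *)

Section stieltjes_expansion.
Variable R : realType.

(** Moments of the masses [r n / lam n] placed at [1 / lam n]. The index is shifted: the value at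
    [k] sums [r n] times the power [- k - 1] of [lam n]. *)
Definition inv_moment (lam r : nat -> R) k : R :=
  limn (series (fun n => r n / lam n * (lam n)^-1 ^+ k)).

Definition laplace_coef (lam r : nat -> R) (rho0 : R) (k : nat) : R :=
  if k is k'.+1 then (-1) ^+ k' * inv_moment lam r k' else rho0.

Variables (lam r : nat -> R) (rho0 m : R).
Hypothesis m0 : 0 < m.
Hypothesis lam_ge : forall n, m <= lam n.
Hypothesis r_summable : abs_summable (fun n => r n / lam n).
Let lam0 n : 0 < lam n. Proof. exact: lt_le_trans (lam_ge n). Qed.
Let S := limn (series (fun n => `|r n / lam n|)).
Let S0 : 0 <= S. Proof. exact: sum_ge0. Qed.

Let xi_ge0 n : 0 <= (lam n)^-1. Proof. by rewrite invr_ge0 ltW. Qed.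
Let xi_le n : (lam n)^-1 <= m^-1. Proof. by rewrite lef_pV2 ?posrE. Qed.

Lemma inv_moment_term_le k n :
  `|r n / lam n * (lam n)^-1 ^+ k| <= m^-1 ^+ k * `|r n / lam n|.
Proof.
rewrite normrM mulrC; apply: ler_wpM2r => //.
rewrite normrX ger0_norm//; apply: lerXn2r; rewrite ?nnegrE//.
by rewrite invr_ge0 ltW.
Qed.

Lemma inv_moment_summable k : abs_summable (fun n => r n / lam n * (lam n)^-1 ^+ k).
Proof.
apply: (@abs_summable_le _ _ _ (inv_moment_term_le k)).
exact: is_cvg_seriesZ.
Qed.

Lemma inv_moment_le k : `|inv_moment lam r k| <= S * m^-1 ^+ k.
Proof.
have -> : S * m^-1 ^+ k = limn (series (fun n => m^-1 ^+ k * `|r n / lam n|)).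
  by rewrite sumZ 1?mulrC//; apply: (@abs_summable_le _ _ (fun n => `|r n / lam n|)) => // n; rewrite normr_id.
apply: norm_sum_le; first exact: inv_moment_term_le.
exact: is_cvg_seriesZ.
Qed.

Lemma laplace_coef_le k : `|laplace_coef lam r rho0 k| <= (`|rho0| + S * m) * m^-1 ^+ k.
Proof.
case: k => [|k] /=; first by rewrite expr0 mulr1 lerDl mulr_ge0// ltW.
rewrite normrM normrX normrN1 expr1n mul1r; apply: (le_trans (inv_moment_le k)).
rewrite exprS mulrA; apply: ler_wpM2r; first by rewrite exprn_ge0// invr_ge0 ltW.
by rewrite mulrDl mulfK ?gt_eqF// lerDr mulr_ge0// invr_ge0 ltW.
Qed.

(** Here [y] stands for [z^(- al)]. Each summand is [y r / lam] times the geometric series of ratio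
    [- y / lam], of modulus at most [1 / 2]; the bound 2 on its partial sums allows the exchange of
    the two sums. *)
Lemma laplace_expansion y : 0 < y -> y * m^-1 <= 1 / 2 ->
  limn (series (fun k => laplace_coef lam r rho0 k * y ^+ k)) =
  rho0 + limn (series (fun n => r n / (1 + lam n / y))).
Proof.
move=> y0 ym.
have ym0 : 0 <= m^-1 * y <= 1 / 2 by rewrite mulrC ym mulr_ge0 ?invr_ge0 ?ltW.
have sa : abs_summable (fun k => laplace_coef lam r rho0 k * y ^+ k).
  apply: (geometric_tail 0 ym0 (C := `|rho0| + S * m) _).1 => k.
  rewrite normrM exprMn mulrA normrX (gtr0_norm y0).
  by apply: ler_wpM2r; [rewrite exprn_ge0// ltW|exact: laplace_coef_le].
rewrite sum_recl//= expr0 mulr1; congr (_ + _).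
have lim1 : \sum_(k < N) laplace_coef lam r rho0 k.+1 * y ^+ k.+1 @[N --> \oo] -->
    limn (series (fun n => r n / (1 + lam n / y))).
  rewrite (_ : (fun N => _) = (fun N => limn (series (fun n =>
     r n / lam n * (y * \sum_(k < N) (- (y / lam n)) ^+ k))))); last first.
    apply/funext => N.
    transitivity (limn (series (fun n => \sum_(k < N) ((-1) ^+ k * y ^+ k.+1) *
        (r n / lam n * (lam n)^-1 ^+ k)))).
      rewrite (@sum_big _ N (fun k n => (-1) ^+ k * y ^+ k.+1 * (r n / lam n * (lam n)^-1 ^+ k))).
        apply: eq_bigr => k _; rewrite sumZ; last exact: inv_moment_summable.
        by rewrite /= -/(inv_moment lam r k) mulrAC.
      by move=> k; apply: abs_summableZ; exact: inv_moment_summable.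
    apply: eq_sum => n; rewrite !mulr_sumr; apply: eq_bigr => k _.
    have -> : (- (y / lam n)) ^+ k = (-1) ^+ k * (y ^+ k * (lam n)^-1 ^+ k).
      by rewrite -!exprMn mulN1r.
    rewrite exprS; move: ((-1) ^+ k) (y ^+ k) ((lam n)^-1 ^+ k) => a b c; ring.
  apply: (@tannery _ _ _ _ _ _ (fun n => 2 * y * `|r n / lam n|)).
  - exact: is_cvg_seriesZ.
  - apply: nearW => N n; rewrite normrM mulrC; apply: ler_wpM2r => //.
    rewrite normrM (gtr0_norm y0) mulrC; apply: ler_wpM2r; first exact: ltW.
    apply: (le_trans (ler_norm_sum _ _ _)); apply: le_trans (sum_half_le2 R N).
    apply: ler_sum => k _; rewrite normrX normrN.
    apply: lerXn2r; rewrite ?nnegrE//.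
    rewrite ger0_norm; last by rewrite divr_ge0// ltW.
    by apply: le_trans ym; apply: ler_wpM2l; [exact: ltW|exact: xi_le].
  - move=> n.
    have q1 : `|- (y / lam n)| < 1.
      rewrite normrN ger0_norm; last by rewrite divr_ge0// ltW.
      apply: (@le_lt_trans _ _ (1 / 2)); last lra.
      by apply: le_trans ym; apply: ler_wpM2l; [exact: ltW|exact: xi_le].
    have := @cvg_geometric_series R 1 (- (y / lam n)) q1.
    rewrite seriesEord => h.
    have p1 : lam n + y != 0 by rewrite gt_eqF// addr_gt0.
    have -> : r n / (1 + lam n / y) = r n / lam n * (y * (1 / (1 - - (y / lam n)))).
      have [nz1 nz2] := (lt0r_neq0 (lam0 n), lt0r_neq0 y0).
      by field; rewrite nz1 nz2 opprK p1.
    apply: cvgMr; apply: cvgMr.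
    move: h; rewrite /geometric /=.
    by under eq_fun do under eq_bigr do rewrite mul1r.
rewrite -(cvg_lim (@Rhausdorff R) lim1); congr (limn _); by rewrite seriesEord.
Qed.

End stieltjes_expansion.

Section laplace_matching.
Variable R : realType.
Implicit Types (lam r : nat -> R).

Lemma sum_single (u : nat -> R) n : (forall i, i != n -> u i = 0) ->
  limn (series u) = u n.
Proof.
move=> u0; rewrite (@sum_finite _ _ n.+1) => [|i ni].
  by rewrite big_ord_recr /= big1 ?add0r// => i _; rewrite u0// ltn_eqF.
by rewrite u0// gtn_eqF.
Qed.

Lemma sum_all0 (u : nat -> R) : (forall i, u i = 0) -> limn (series u) = 0.
Proof. by move=> u0; rewrite (@sum_finite _ _ 0) ?big_ord0. Qed.

(* The moments are asymptotic to the one of the smallest [lam n] with [r n != 0]. *)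
Lemma inv_moment_neq0 lam r m : 0 < m -> (forall n, m <= lam n) ->
  (forall n, lam n < lam n.+1) -> abs_summable (fun n => r n / lam n) ->
  (exists n, r n != 0) -> exists k0, forall k, (k0 <= k)%N -> inv_moment lam r k != 0.
Proof.
move=> m0 lam_ge lamS sr exr.
have lam0 n : 0 < lam n by exact: lt_le_trans (lam_ge n).
have lam_lt : {homo lam : i j / (i < j)%N >-> i < j} by apply: homo_ltn lamS; exact: lt_trans.
case: (ex_minnP exr) => n0 rn0 min0.
pose f k n := r n / lam n * (lam n0 / lam n) ^+ k.
have fE k : limn (series (f k)) = lam n0 ^+ k * inv_moment lam r k.
  rewrite /inv_moment -sumZ; last exact: inv_moment_summable m0 lam_ge sr k.
  by apply: eq_sum => n; rewrite /f exprMn mulrCA.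
have c0 : r n0 / lam n0 != 0 by rewrite mulf_neq0// invr_neq0// gt_eqF.
have lim : limn (series (f k)) @[k --> \oo] --> r n0 / lam n0.
  pose u n := if n == n0 then r n0 / lam n0 else 0.
  have <- : limn (series u) = r n0 / lam n0.
    by rewrite (@sum_single u n0) /u ?eqxx// => i /negPf ->.
  apply: (@tannery _ _ _ _ _ _ (fun n => `|r n / lam n|)) => //.
    apply: nearW => k n; rewrite /f normrM.
    have [nn0|n0n] := ltnP n n0.
      have -> : r n = 0 by apply/eqP/negPn/negP => /min0; rewrite leqNgt nn0.
      by rewrite mul0r normr0 mul0r.
    rewrite ler_piMr// normrX exprn_ile1// ger0_norm ?divr_ge0 ?(ltW (lam0 _))//.
    rewrite ler_pdivrMr// mul1r; move: n0n; rewrite leq_eqVlt => /predU1P[->//|n0n].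
    by apply/ltW/lam_lt.
  move=> n; rewrite /u; have [->|nn0] := eqVneq n n0.
    rewrite /f divff ?gt_eqF//; under eq_fun do rewrite expr1n mulr1.
    exact: cvg_cst.
  have [{}nn0|n0n] := ltnP n n0.
    rewrite /f; have -> : r n = 0 by apply/eqP/negPn/negP => /min0; rewrite leqNgt nn0.
    by under eq_fun do rewrite mul0r mul0r; exact: cvg_cst.
  have {}n0n : (n0 < n)%N by rewrite ltn_neqAle eq_sym nn0.
  rewrite -[X in _ --> X](mulr0 (r n / lam n)); apply: cvgMr; apply: cvg_expr.
  rewrite ger0_norm ?divr_ge0 ?(ltW (lam0 _))// ltr_pdivrMr// mul1r.
  exact: lam_lt.
have /cvgrPdist_lt/(_ `|r n0 / lam n0|) := lim.
rewrite normr_gt0 => /(_ c0)[k0 _ hk]; exists k0 => k kk.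
apply/eqP => M0; have := hk k kk; by rewrite /= fE M0 mulr0 subr0 ltxx.
Qed.

Variables (al al' : R) (lam lam' r r' : nat -> R) (rho0 rho0' m : R).

Lemma laplace_coef_match : 0 < al -> 0 < al' -> 0 < m ->
  (forall n, m <= lam n) -> (forall n, m <= lam' n) ->
  abs_summable (fun n => r n / lam n) -> abs_summable (fun n => r' n / lam' n) ->
  (forall z, 0 < z -> rho0 + limn (series (fun n => r n / (1 + lam n * z `^ al))) =
                      rho0' + limn (series (fun n => r' n / (1 + lam' n * z `^ al')))) ->
  forall k, laplace_coef lam r rho0 k != 0 ->
  exists2 j, al' * j%:R = al * k%:R &
    laplace_coef lam r rho0 k = laplace_coef lam' r' rho0' j.
Proof.
move=> al0 al'0 m0 lam_ge lam'_ge sr sr' eqz.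
pose K := `|rho0| + limn (series (fun n => `|r n / lam n|)) * m.
pose K' := `|rho0'| + limn (series (fun n => `|r' n / lam' n|)) * m.
have mV0 : 0 < m^-1 by rewrite invr_gt0.
have K0 : 0 <= K by rewrite addr_ge0// mulr_ge0 ?(ltW m0)// sum_ge0.
have K'0 : 0 <= K' by rewrite addr_ge0// mulr_ge0 ?(ltW m0)// sum_ge0.
apply: (powR_series_unique (C := K + K') (Q := m^-1)) => //.
- move=> k; apply: (le_trans (laplace_coef_le rho0 m0 lam_ge sr k)).
  by apply: ler_wpM2r; [rewrite exprn_ge0// ltW|rewrite lerDl].
- move=> k; apply: (le_trans (laplace_coef_le rho0' m0 lam'_ge sr' k)).
  by apply: ler_wpM2r; [rewrite exprn_ge0// ltW|rewrite lerDr].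
have small b : 0 < b -> \forall x \near 0^'+, x `^ b * m^-1 <= 1 / 2.
  move=> b0; have /cvgrPdist_le/(_ (m / 2)) := @powR_cvg0 R _ b0.
  rewrite divr_gt0// => /(_ isT) h; near=> x.
  have : `|0 - x `^ b| <= m / 2 by near: x.
  rewrite sub0r normrN ger0_norm ?powR_ge0// => h2.
  by rewrite ler_pdivrMr// mulrC div1r.
have h := small _ al0; have h' := small _ al'0.
near=> x; have x0 : 0 < x by near: x; exact: nbhs_right_gt.
have y0 : 0 < x `^ al by rewrite powR_gt0.
have y'0 : 0 < x `^ al' by rewrite powR_gt0.
have ym : x `^ al * m^-1 <= 1 / 2 by near: x.
have y'm : x `^ al' * m^-1 <= 1 / 2 by near: x.
rewrite (laplace_expansion rho0 m0 lam_ge sr y0 ym).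
rewrite (laplace_expansion rho0' m0 lam'_ge sr' y'0 y'm).
(* The identity is read at [z = 1 / x], which turns the expansion at infinity into one at 0. *)
have xV0 : 0 < x^-1 by rewrite invr_gt0.
have powV b : x^-1 `^ b = (x `^ b)^-1.
  by rewrite -[x^-1]powR_inv1 ?(ltW x0)// -powRrM mulN1r powRN.
have := eqz _ xV0; rewrite !powV; exact.
Unshelve. all: by end_near. Qed.

End laplace_matching.

(** * Identification of the order, the constant and the atoms *)

Section identification.
Variable R : realType.

Lemma multiples_eq (a b : R) p q : 0 < a -> a = b * p%:R -> b = a * q%:R -> a = b.
Proof.
move=> a0 ab ba; have pq : (q * p)%N = 1%N.
  have : a * (q * p)%:R = a * 1 by rewrite mulr1 natrM mulrA -ba -ab.
  by move=> /(mulfI (lt0r_neq0 a0)) /eqP; rewrite -[1]/(1%:R) eqr_nat => /eqP.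
have /eqP := pq; rewrite muln_eq1 => /andP[_ /eqP p1].
by rewrite ab p1 mulr1.
Qed.

(** Nonzero coefficients at [k0] and [k0 + 1] are matched at some [j] and [i]; subtracting the two
    exponent identities leaves [a = b (i - j)], and positivity gives [j <= i]. A single match would
    only give a rational ratio. *)
Lemma consecutive_match (a b : R) (x y : nat -> R) k0 : 0 < a -> 0 < b ->
  (forall k, x k != 0 -> exists2 j, b * j%:R = a * k%:R & x k = y j) ->
  (forall k, (k0 <= k)%N -> x k != 0) -> exists p, a = b * p%:R.
Proof.
move=> a0 b0 match_ xk; have [j bj _] := match_ _ (xk k0 (leqnn _)).
have [i bi _] := match_ _ (xk k0.+1 (leqnSn _)).
have abij : a = b * (i%:R - j%:R) by rewrite mulrBr bi bj -natr1; ring.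
have ji : (j <= i)%N.
  rewrite leqNgt; apply/negP => ij; move: a0; rewrite abij pmulr_rgt0// subr_gt0 ltr_nat.
  by rewrite ltnNge ltnW.
by exists (i - j)%N; rewrite natrB.
Qed.

Variables (al al' : R) (lam lam' r r' : nat -> R) (rho0 rho0' m : R).
Hypotheses (al0 : 0 < al) (al'0 : 0 < al') (m0 : 0 < m).
Hypotheses (lam_ge : forall n, m <= lam n) (lam'_ge : forall n, m <= lam' n).
Hypotheses (lamS : forall n, lam n < lam n.+1) (lam'S : forall n, lam' n < lam' n.+1).
Hypothesis sr : abs_summable (fun n => r n / lam n).
Hypothesis sr' : abs_summable (fun n => r' n / lam' n).
Hypothesis exr : exists n, r n != 0.
Hypothesis eqz : forall z, 0 < z ->
  rho0 + limn (series (fun n => r n / (1 + lam n * z `^ al))) =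
  rho0' + limn (series (fun n => r' n / (1 + lam' n * z `^ al'))).

Let a := laplace_coef lam r rho0.
Let b := laplace_coef lam' r' rho0'.

Let match_ab k : a k != 0 -> exists2 j, al' * j%:R = al * k%:R & a k = b j.
Proof. exact: (laplace_coef_match al0 al'0 m0 lam_ge lam'_ge sr sr' eqz). Qed.

Let match_ba k : b k != 0 -> exists2 j, al * j%:R = al' * k%:R & b k = a j.
Proof.
apply: (laplace_coef_match al'0 al0 m0 lam'_ge lam_ge sr' sr) => z z0.
by rewrite (eqz z0).
Qed.

Let a_neq0 : exists k0, forall k, (k0 <= k)%N -> a k != 0.
Proof.
have [k0 hk] := inv_moment_neq0 m0 lam_ge lamS sr exr.
exists k0.+1 => -[//|k] kk /=.
by rewrite /a /= mulf_neq0 ?hk// expf_neq0// oppr_eq0 oner_eq0.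
Qed.

(** If all [r'] vanished, the second expansion would reduce to its constant term, which cannot match
    a nonzero coefficient of positive index. This restores the symmetry between the two sets of
    data. *)
Lemma other_coef_neq0 : exists n, r' n != 0.
Proof.
have [k0 hk] := a_neq0; have [j jk bj] := match_ab (hk k0.+1 (leqnSn _)).
apply: contrapT => /forallNP nr.
have r0 n : r' n = 0 by have /negP/negPn/eqP := nr n.
have : b j = 0.
  case: j jk bj => [|j] jk bj.
    move: jk; rewrite mulr0 => /esym/eqP; rewrite mulf_eq0 gt_eqF//= pnatr_eq0.
    by [].
  rewrite /b /= /inv_moment sum_all0 ?mulr0// => i; by rewrite r0 !mul0r.
by rewrite -bj => /eqP; apply/negP; exact: hk.
Qed.

Let b_neq0 : exists k0, forall k, (k0 <= k)%N -> b k != 0.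
Proof.
have [k0 hk] := inv_moment_neq0 m0 lam'_ge lam'S sr' other_coef_neq0.
exists k0.+1 => -[//|k] kk /=.
by rewrite /b /= mulf_neq0 ?hk// expf_neq0// oppr_eq0 oner_eq0.
Qed.

Lemma order_identified : al = al'.
Proof.
have [k0 hk] := a_neq0; have [k0' hk'] := b_neq0.
have [p ap] := consecutive_match al0 al'0 match_ab hk.
have [q aq] := consecutive_match al'0 al0 match_ba hk'.
exact: multiples_eq al0 ap aq.
Qed.

Let abE k : a k = b k.
Proof.
have [ak|ak] := eqVneq (a k) 0; last first.
  have [j] := match_ab ak; rewrite order_identified => /(mulfI (lt0r_neq0 al'0)).
  by move=> /eqP; rewrite eqr_nat => /eqP ->.
apply/eqP; rewrite ak eq_sym; apply/negPn/negP => bk.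
have [j] := match_ba bk; rewrite order_identified => /(mulfI (lt0r_neq0 al'0)).
by move=> /eqP; rewrite eqr_nat => /eqP -> ba; move: bk; rewrite ba ak eqxx.
Qed.

Lemma limit_identified : rho0 = rho0'.
Proof. exact: (abE 0). Qed.

(** Strict monotonicity of [lam] makes the mass at [1 / lam n] equal to [r n / lam n]. By
    [moments_unique] the other family has the same nonzero mass there, which yields an index [j],
    then the weight. *)
Lemma atoms_identified n : r n != 0 -> exists j, lam' j = lam n /\ r' j = r n.
Proof.
move=> rn.
have lam0 i : 0 < lam i by exact: lt_le_trans (lam_ge i).
have lam'0 i : 0 < lam' i by exact: lt_le_trans (lam'_ge i).
have inj (l : nat -> R) : (forall i, l i < l i.+1) -> injective l.
  move=> lS i j; have lt : {homo l : i j / (i < j)%N >-> i < j} by apply: homo_ltn lS; exact: lt_trans.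
  by case: (ltngtP i j) => // /lt h e; move: h; rewrite e ltxx.
have xi (l : nat -> R) : (forall i, m <= l i) -> forall i, 0 <= (l i)^-1 <= m^-1.
  move=> lm i; have l0 := lt_le_trans m0 (lm i).
  apply/andP; split; first by rewrite invr_ge0 ltW.
  by rewrite lef_pV2 ?posrE ?lm.
have mom k : inv_moment lam r k = inv_moment lam' r' k.
  have sgn : (-1) ^+ k != 0 :> R by rewrite expf_neq0// oppr_eq0 oner_eq0.
  exact: (mulfI sgn (abE k.+1)).
have mV0 : 0 < m^-1 by rewrite invr_gt0.
have := moments_unique mV0 (xi _ lam_ge n) sr sr' (xi _ lam_ge) (xi _ lam'_ge) mom.
rewrite (@sum_single _ _ n); last first.
  move=> i ni; rewrite (_ : (lam i)^-1 == (lam n)^-1 = false) ?mulr0//.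
  by apply/negbTE; apply: contra ni => /eqP/invr_inj/(inj _ lamS) ->.
rewrite eqxx mulr1 => e.
have cn : r n / lam n != 0 by rewrite mulf_neq0// invr_neq0// gt_eqF.
have [j lj] : exists j, lam' j = lam n.
  apply: contrapT => /forallNP nl; move: cn; rewrite e sum_all0 ?eqxx// => i.
  rewrite (_ : (lam' i)^-1 == (lam n)^-1 = false) ?mulr0//.
  by apply/negbTE/negP => /eqP/invr_inj; exact: nl.
exists j; split => //; move: e; rewrite (@sum_single _ _ j); last first.
  move=> i ij; rewrite -lj (_ : (lam' i)^-1 == (lam' j)^-1 = false) ?mulr0//.
  by apply/negbTE; apply: contra ij => /eqP/invr_inj/(inj _ lam'S) ->.
rewrite lj eqxx mulr1; have lnz : (lam n)^-1 != 0 by rewrite invr_neq0// gt_eqF.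
by move=> /(mulIf lnz).
Qed.

End identification.

(** * Boundary values of the eigenfunctions *)

Lemma normr_mul_le_sqr (R : realType) (u v : R) : `|u * v| <= u ^+ 2 + v ^+ 2.
Proof.
rewrite ler_norml; have h1 := sqr_ge0 (u - v); have h2 := sqr_ge0 (u + v).
have h3 := sqr_ge0 u; have h4 := sqr_ge0 v.
by apply/andP; split; nra.
Qed.

Section L2_bessel.
Variable R : realType.
Local Notation mu := (@lebesgue_measure R).
Implicit Types (f g : R -> R) (Phi : nat -> R -> R).
Let D : set (measurableTypeR R) := `]0, 1[%classic.
Let mD : measurable D. Proof. exact: measurable_itvR. Qed.

Lemma L2_mul f g : L2 f -> L2 g -> mu.-integrable D (EFin \o (fun x => f x * g x)).
Proof.
move=> [mf if2] [mg ig2].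
apply: (le_integrable mD _ _ (integrableD mD if2 ig2)).
  by apply/measurable_EFinP; exact: measurable_funM.
move=> x _; rewrite /= lee_fin.
rewrite [leRHS]ger0_norm ?addr_ge0 ?sqr_ge0//.
exact: normr_mul_le_sqr.
Qed.

Lemma L2_axpy f g c : L2 f -> L2 g -> L2 (fun x => f x - c * g x).
Proof.
move=> Lf Lg; have [mf if2] := Lf; have [mg ig2] := Lg; split.
  apply: measurable_funB => //; apply: measurable_funM => //; exact: measurable_cst.
have i1 := L2_mul Lf Lg.
have i2 := integrable_scale (- (2 * c)) mD i1.
have i3 := integrable_scale (c ^+ 2) mD ig2.
apply: (eq_integrable mD _ _ _ (integrableD mD if2 (integrableD mD i2 i3))) => x _ /=.
rewrite -!EFinD; congr EFin; ring.
Qed.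

Lemma inner_axpyl f g c h : L2 f -> L2 g -> L2 h ->
  inner (fun x => f x - c * g x) h = inner f h - c * inner g h.
Proof.
move=> Lf Lg Lh; have i1 := L2_mul Lf Lh; have i2 := L2_mul Lg Lh.
rewrite /inner -(RintegralZl c mD i2) -(RintegralB mD i1 (integrable_scale c mD i2)).
by apply: eq_Rintegral => x _; ring.
Qed.

Lemma innerC f g : inner f g = inner g f.
Proof. by apply: eq_Rintegral => x _; rewrite mulrC. Qed.

Lemma inner_ge0 f : 0 <= inner f f.
Proof. by apply: Rintegral_ge0 => x _; rewrite -expr2 sqr_ge0. Qed.

(** Removing the first [N] components one at a time leaves a remainder with the later coefficients
    unchanged; the claim is that its squared norm is nonnegative. The shift [n.+1] reflects the
    numbering of the basis from 1. *)
Lemma bessel Phi f N : orthonormal_basis Phi -> L2 f ->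
  \sum_(n < N) inner f (Phi n.+1) ^+ 2 <= inner f f.
Proof.
move=> [LPhi ortho _] Lf.
have [g [Lg gPhi gg]] : exists g, [/\ L2 g,
    forall n, (N <= n)%N -> inner g (Phi n.+1) = inner f (Phi n.+1) &
    inner g g = inner f f - \sum_(n < N) inner f (Phi n.+1) ^+ 2].
  elim: N => [|N [g [Lg gPhi gg]]].
    by exists f; split => //; rewrite big_ord0 subr0.
  pose c := inner f (Phi N.+1); have LN := LPhi N.+1 isT.
  exists (fun x => g x - c * Phi N.+1 x); split.
  - exact: L2_axpy.
  - move=> n Nn; rewrite inner_axpyl//; last exact: LPhi.
    by rewrite ortho// eqSS ltn_eqF// mulr0 subr0 gPhi// ltnW.
  - have LgN := L2_axpy c Lg LN.
    rewrite (inner_axpyl _ Lg LN LgN) (innerC g (fun x => g x - c * Phi N.+1 x)).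
    rewrite (innerC (Phi N.+1) (fun x => g x - c * Phi N.+1 x)).
    rewrite (inner_axpyl _ Lg LN Lg) (inner_axpyl _ Lg LN LN) [inner (Phi N.+1) g]innerC.
    by rewrite gPhi// ortho// eqxx gg big_ord_recr/= -/c; ring.
by rewrite -subr_ge0 -gg inner_ge0.
Qed.

Lemma summable_inner_mul Phi f g : orthonormal_basis Phi -> L2 f -> L2 g ->
  abs_summable (fun n => inner f (Phi n.+1) * inner g (Phi n.+1)).
Proof.
move=> ob Lf Lg; apply: (@abs_summable_bounded _ _ (inner f f + inner g g)) => N.
apply: le_trans (lerD (bessel N ob Lf) (bessel N ob Lg)).
rewrite -big_split/=; apply: ler_sum => n _.
exact: normr_mul_le_sqr.
Qed.

End L2_bessel.

Section C0_closure.
Variable R : realType.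
Local Notation mu := (@lebesgue_measure R).
Implicit Types (f g : R -> R).

Lemma C0D f g : C0_closure f -> C0_closure g -> C0_closure (fun x => f x + g x).
Proof. by move=> cf cg x; apply: cvgD; [exact: cf|exact: cg]. Qed.

Lemma C0M f g : C0_closure f -> C0_closure g -> C0_closure (fun x => f x * g x).
Proof. by move=> cf cg x; apply: cvgM; [exact: cf|exact: cg]. Qed.

Lemma C0_cst (c : R) : C0_closure (fun=> c).
Proof. by move=> x; exact: cvg_cst. Qed.

Lemma C0_id : C0_closure (fun x : R => x).
Proof. by apply: continuous_subspaceT => x; exact: cvg_id. Qed.

Lemma C0_L2 f : C0_closure f -> L2 f.
Proof.
move=> cf; split.
  have m01 : measurable (`[0, 1]%classic : set R) by exact: measurable_itv.
  have sub : (`]0, 1[%classic : set R) `<=` `[0, 1]%classic by exact: subset_itv_oo_cc.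
  apply: (measurable_funS m01 sub).
  exact: subspace_continuous_measurable_fun.
have cf2 : C0_closure (fun x => f x ^+ 2) by exact: C0M.
apply: (@integrableS _ _ _ _ (`[0, 1]%classic : set (measurableTypeR R))).
- exact: measurable_itvR.
- exact: measurable_itvR.
- exact: subset_itv_oo_cc.
- by apply: continuous_compact_integrable => //; exact: segment_compact.
Qed.

Lemma C0_integrable f : C0_closure f ->
  mu.-integrable (`]0, 1[%classic : set (measurableTypeR R)) (EFin \o f).
Proof.
move=> cf; have i1 := L2_mul (C0_L2 cf) (C0_L2 (@C0_cst 1)).
apply: (eq_integrable (@measurable_itvR R _) _ _ _ i1) => x _ /=.
by rewrite mulr1.
Qed.

Lemma Rintegral_itvoo_deriv f (F : R -> R) : C0_closure F -> C0_closure f ->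
  {in `]0, 1[, forall x : R, is_derive x 1 F (f x)} ->
  \int[mu]_(x in `]0, 1[) f x = F 1 - F 0.
Proof.
move=> cF cf dF.
have [cF' cF0 cF1] := (continuous_within_itvP F (@ltr01 R)).1 cF.
have := @continuous_FTC2 R f F 0 1 ltr01 cf.
have h : derivable_oo_LRcontinuous F 0 1 by split => // x /dF[].
have h' : {in `]0, 1[, F^`()%classic =1 f} by move=> x /dF[_ <-]; rewrite derive1E.
move=> /(_ h h') e; rewrite /Rintegral.
rewrite (_ : (\int[mu]_(x in `]0%R, 1%R[) (f x)%:E)%E = (\int[mu]_(x in `[0%R, 1%R]) (f x)%:E)%E).
  by rewrite e.
apply/esym/integral_itv_bndoo; apply/measurable_EFinP.
by have [] := C0_L2 cf.
Qed.

End C0_closure.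

(** Completing the square in [a0 (p1 + x p / 2)^2] leaves [a0 (1 - x^2) / 4] times [p^2], which is
    where the constant [a0 / 4] of the eigenvalue bound comes from. *)
Lemma energy_density_ge0 (R : realFieldType) (a a0 q l x p p1 : R) :
  0 <= a0 -> a0 <= a -> 0 <= q -> 0 <= x <= 1 ->
  0 <= (q - l) * p * p + a * p1 * p1
    + (a0 / 2 * (p * p) + a0 / 2 * x * (p * p1 + p1 * p)) + (l - a0 / 4) * (p * p).
Proof.
move=> a00 aa q0 /andP[x0 x1].
have -> : (q - l) * p * p + a * p1 * p1
    + (a0 / 2 * (p * p) + a0 / 2 * x * (p * p1 + p1 * p)) + (l - a0 / 4) * (p * p)
  = q * p ^+ 2 + (a - a0) * p1 ^+ 2 + a0 * (p1 + x * p / 2) ^+ 2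
    + a0 * ((1 - x) * (1 + x)) / 4 * p ^+ 2 by field.
rewrite !addr_ge0//; [exact: mulr_ge0 (sqr_ge0 _)|..].
- by apply: mulr_ge0 (sqr_ge0 _); rewrite subr_ge0.
- exact: mulr_ge0 (sqr_ge0 _).
- apply: mulr_ge0 (sqr_ge0 _); apply: mulr_ge0; last by lra.
  by apply: mulr_ge0 => //; apply: mulr_ge0; lra.
Qed.

Section eigenfunctions.
Variable R : realType.
Local Notation mu := (@lebesgue_measure R).
Variables (a q : R -> R) (a0 : R).
Hypothesis Ca : C2_closure a.
Hypothesis a0_gt0 : 0 < a0.
Hypothesis a_ge : {in `[0, 1], forall x : R, a0 <= a x}.
Hypothesis Qq : classQ q.

(* By the mean value theorem the one-sided derivative at 0 is the limit of phi'. *)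
Lemma eigenpair_flux (l : R) (phi : R -> R) : eigenpair a q l phi ->
  exists phi1, [/\ C0_closure phi, C0_closure phi1, phi 1 = 0 & phi1 0 = 0] /\
    {in `]0, 1[, forall x : R, is_derive x 1 phi (phi1 x)} /\
    {in `]0, 1[, forall x : R, is_derive x 1 (fun y => a y * phi1 y) ((q x - l) * phi x)}.
Proof.
move=> [[phi1 [phi2 [cphi cphi1 cphi2 dphi dphi1]]] eigen rd phi10].
have [a1 [a2 [ca ca1 ca2 da da1]]] := Ca.
exists phi1; split; [split => //|split => //].
- have [_ c0 _] := (continuous_within_itvP phi1 (@ltr01 R)).1 cphi1.
  have lim : h^-1 * (phi h - phi 0) @[h --> (0 : R)^'+] --> phi1 0.
    apply/cvgrPdist_le => e e0.
    have /cvgrPdist_le/(_ _ e0) [d /= d0 hd] := c0.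
    near=> h; have h0 : 0 < h by near: h; exact: nbhs_right_gt.
    have hd' : h < d by near: h; exact: nbhs_right_lt.
    have h1 : h < 1 by near: h; exact: nbhs_right_lt.
    have dphi' : forall x, x \in `]0, h[ -> is_derive x 1 phi (phi1 x).
      move=> x; rewrite in_itv/= => /andP[x0 xh].
      by apply: dphi; rewrite in_itv/= x0 (lt_trans xh h1).
    have cphi' : {within `[0, h], continuous phi}.
      apply: continuous_subspaceW cphi => x /=; rewrite !in_itv/= => /andP[x0 xh].
      by rewrite x0 (le_trans xh (ltW h1)).
    have [c] := MVT h0 dphi' cphi'; rewrite in_itv/= => /andP[c0' ch] ->.
    rewrite subr0 mulrCA mulVf ?gt_eqF// mulr1; apply: hd => //=.
    by rewrite sub0r normrN gtr0_norm// (lt_trans ch hd').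
  exact: (cvg_unique (@Rhausdorff R) lim rd).
- move=> x x01.
  have dflux : is_derive x 1 (fun y => a y * phi1 y) (a x *: phi2 x + phi1 x *: a1 x).
    by apply: is_deriveM; [exact: da|exact: dphi1].
  have <- : a x *: phi2 x + phi1 x *: a1 x = (q x - l) * phi x; last exact: dflux.
  have := eigen x x01; rewrite /opA.
  have -> : derive1 (fun y => a y * derive1 phi y) x = a x *: phi2 x + phi1 x *: a1 x.
    rewrite derive1E -(@derive_val _ _ _ _ _ _ _ dflux).
    apply: near_eq_derive.
    have := near_in_itvoo x01; apply: filterS => y y01.
    by rewrite derive1E (@derive_val _ _ _ _ _ _ _ (dphi y y01)).
  by move=> e; rewrite mulrBl -e /GRing.scale/=; ring.
Unshelve. all: by end_near. Qed.

Local Ltac C0 := repeat first [assumption | exact: C0_cst | exact: C0_id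
  | apply: C0M | apply: C0D].

(* Testing the equation with phi and using the flat Poincare inequality: the
   boundary terms of [a phi' phi + (a0 / 2) x phi^2] vanish. *)
Lemma eigenvalue_ge (l : R) (phi : R -> R) : eigenpair a q l phi ->
  inner phi phi = 1 -> a0 / 4 <= l.
Proof.
move=> /eigenpair_flux[phi1 [[cphi cphi1 phi_1 phi1_0] [dphi dflux]]] norm1.
have [a1 [a2 [ca _ _ _ _]]] := Ca; have [cq q_ge0] := Qq.
pose W x := a x * phi1 x * phi x + a0 / 2 * x * (phi x * phi x).
pose w x := (q x - l) * phi x * phi x + a x * phi1 x * phi1 x
  + (a0 / 2 * (phi x * phi x) + a0 / 2 * x * (phi x * phi1 x + phi1 x * phi x)).
have cW : C0_closure W by rewrite /W; C0.
have cw : C0_closure w by rewrite /w; C0.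
have dW : {in `]0, 1[, forall x : R, is_derive x 1 W (w x)}.
  move=> x x01; have dp := dphi x x01; have df := dflux x x01.
  apply: (is_derive_eq (is_deriveD (is_deriveM df dp)
    (is_deriveM (is_deriveM (is_derive_cst (a0 / 2) x 1) (is_derive_id x 1))
      (is_deriveM dp dp)))).
  by rewrite /w /GRing.scale/= ?fctE; ring.
have := Rintegral_itvoo_deriv cW cw dW.
rewrite /W phi_1 phi1_0 !(mulr0, mul0r) !addr0 subrr => w0.
have iw := C0_integrable cw.
have ip := integrable_scale (l - a0 / 4) (@measurable_itvR R _) (C0_integrable (C0M cphi cphi)).
have : 0 <= \int[mu]_(x in `]0, 1[) (w x + (l - a0 / 4) * (phi x * phi x)).
  apply: Rintegral_ge0 => x /=; rewrite in_itv/= => x01.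
  have q0 : 0 <= q x by apply: q_ge0; rewrite in_itv/=.
  have [x0 x1] := andP x01.
  have ax : a0 <= a x by apply: a_ge; rewrite in_itv/= !ltW.
  by rewrite /w; apply: energy_density_ge0 => //; rewrite ?(ltW x0) ?(ltW x1) ?(ltW a0_gt0).
rewrite (RintegralD (@measurable_itvR R _) iw ip) w0 add0r.
rewrite (RintegralZl (l - a0 / 4) (@measurable_itvR R _) (C0_integrable (C0M cphi cphi))).
by rewrite -/(inner phi phi) norm1 mulr1 subr_ge0.
Qed.

Lemma boundary_value : exists w1 w2, [/\ L2 w1, L2 w2 &
  forall l phi, eigenpair a q l phi ->
    a 0 * phi 0 = l * inner w1 phi - inner w2 phi].
Proof.
have [a1 [a2 [ca ca1 _ da _]]] := Ca; have [cq _] := Qq.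
have c1 : C0_closure (fun x : R => 1 + -1 * x) by C0.
have c2 : C0_closure (fun x => a1 x + q x * (1 + -1 * x)) by C0.
exists (fun x => 1 + -1 * x), (fun x => a1 x + q x * (1 + -1 * x)).
split; [exact: C0_L2|exact: C0_L2|] => l phi.
move=> /eigenpair_flux[phi1 [[cphi cphi1 phi_1 phi1_0] [dphi dflux]]].
(* The summand [a phi] is added so that its [a phi'] cancels the one produced by differentiating
   [1 - x]: only multiples of [phi] remain in [w]. *)
pose W x := a x * phi1 x * (1 + -1 * x) + a x * phi x.
pose w x := (a1 x + q x * (1 + -1 * x)) * phi x + (- l) * ((1 + -1 * x) * phi x).
have cW : C0_closure W by rewrite /W; C0.
have cw : C0_closure w by rewrite /w; C0.
have dW : {in `]0, 1[, forall x : R, is_derive x 1 W (w x)}.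
  move=> x x01; have dp := dphi x x01; have df := dflux x x01.
  apply: (is_derive_eq (is_deriveD
    (is_deriveM df (is_deriveD (is_derive_cst (1 : R) x 1)
       (is_deriveM (is_derive_cst (- 1 : R) x 1) (is_derive_id x 1))))
    (is_deriveM (da x x01) dp))).
  by rewrite /w /GRing.scale/= ?fctE; ring.
have := Rintegral_itvoo_deriv cW cw dW.
have i2 := C0_integrable (C0M c2 cphi); have i1 := C0_integrable (C0M c1 cphi).
have mD := @measurable_itvR R `]0, 1[.
rewrite (RintegralD mD i2 (integrable_scale (- l) mD i1)) (RintegralZl (- l) mD i1).
rewrite -/(inner (fun x => a1 x + q x * (1 + -1 * x)) phi) -/(inner (fun x => 1 + -1 * x) phi).
rewrite /W phi_1 phi1_0 => e.
have -> : a 0 * phi 0 = - (a 1 * phi1 1 * (1 + -1 * 1) + a 1 * 0 -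
  (a 0 * 0 * (1 + -1 * 0) + a 0 * phi 0)) by ring.
by rewrite -e; ring.
Qed.

Section eigensystem.
Variables (lam : nat -> R) (Phi : nat -> R -> R).
Hypothesis eig : eigensystem a q lam Phi.

Let ob : orthonormal_basis Phi. Proof. by case: eig. Qed.

Lemma eigensystem_ge n : a0 / 4 <= lam n.+1.
Proof.
have [_ _ ep [_ on _]] := eig.
by apply: (eigenvalue_ge (ep n.+1 isT)); rewrite on// eqxx.
Qed.

Lemma eigensystem_gt0 n : 0 < lam n.+1.
Proof. by apply: lt_le_trans (eigensystem_ge n); rewrite divr_gt0// ltr0n. Qed.

Lemma summable_divl (u : nat -> R) : abs_summable u ->
  abs_summable (fun n => - (lam n.+1)^-1 * u n).
Proof.
move=> su; apply: (abs_summable_norm_le (abs_summableZ (k := (a0 / 4)^-1) su)) => n.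
rewrite !normrM normrN ler_wpM2r//.
have l0 := eigensystem_gt0 n.
have m0 : 0 < a0 / 4 by rewrite divr_gt0// ltr0n.
rewrite !gtr0_norm ?invr_gt0//; rewrite lef_pV2//.
exact: eigensystem_ge.
Qed.

Lemma summable_boundary f : L2 f ->
  abs_summable (fun n => inner f (Phi n.+1) * Phi n.+1 0 / lam n.+1).
Proof.
move=> Lf; have [w1 [w2 [Lw1 Lw2 bv]]] := boundary_value.
have [_ _ ep _] := eig.
have aa : 0 < a 0 by apply: lt_le_trans a0_gt0 (a_ge _); rewrite in_itv/= lexx ler01.
have s1 := abs_summableZ (k := (a 0)^-1) (summable_inner_mul ob Lf Lw1).
have s2 : abs_summable (fun n => (a 0)^-1 *
    (- (lam n.+1)^-1 * (inner f (Phi n.+1) * inner w2 (Phi n.+1)))).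
  exact/abs_summableZ/summable_divl/summable_inner_mul.
apply: (abs_summable_norm_le (abs_summableD s1 s2)) => n.
have e := bv _ _ (ep n.+1 isT).
have l0 := eigensystem_gt0 n.
have -> : Phi n.+1 0 = (a 0)^-1 * (lam n.+1 * inner w1 (Phi n.+1) - inner w2 (Phi n.+1)).
  by rewrite -e mulKf// gt_eqF.
rewrite le_eqVlt; apply/orP; left; apply/eqP; congr `|_|.
move: (inner f _) (inner w1 _) (inner w2 _) (lam _) l0 (a 0) aa => x y z l l0 b b0.
by field; rewrite !gt_eqF.
Qed.

Lemma summable_boundaryV f : L2 f ->
  abs_summable (fun n => (lam n.+1)^-1 * inner f (Phi n.+1) * Phi n.+1 0).
Proof.
move=> Lf; apply: (abs_summable_norm_le (summable_boundary Lf)) => n.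
by rewrite -mulrA mulrC.
Qed.

Lemma summable_rho f u0 : L2 f -> L2 u0 ->
  abs_summable (fun n => rho lam Phi f u0 n.+1 / lam n.+1).
Proof.
move=> Lf Lu; have s2 := summable_boundary Lu.
have s1 : abs_summable (fun n =>
    - (lam n.+1)^-1 * ((lam n.+1)^-1 * inner f (Phi n.+1) * Phi n.+1 0)).
  exact/summable_divl/summable_boundaryV.
apply: (abs_summable_norm_le (abs_summableD s2 s1)) => n.
rewrite le_eqVlt /rho/=; apply/orP; left; apply/eqP; congr `|_|.
move: (inner f _) (inner u0 _) (Phi _ _) (lam _) (eigensystem_gt0 n) => x y z l l0.
by field; rewrite gt_eqF.
Qed.

End eigensystem.
End eigenfunctions.

(** * The observation as a relaxation series *)

Lemma mittag_leffler_alt (R : realType) (al be lam x : R) :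
  mittag_leffler al be (- lam * x) = ml_sum al be (alt lam) x.
Proof. by apply: eq_sum => k; rewrite /ml_term /alt exprMn. Qed.

(** The kernel of [delta0] at [b = 1] is the constant 1, so plain integration is a convolution. This
    is the response of one mode to a time-independent source. *)
Lemma Rintegral_mlker_alt (R : realType) (al lam t : R) : 0 < al < 1 -> 0 < t ->
  (@lebesgue_measure R).-integrable (`]0, t[ : set R)
    (EFin \o (fun s => mlker al al (alt lam) (t - s))) /\
  lam * \int[@lebesgue_measure R]_(s in `]0, t[) mlker al al (alt lam) (t - s) =
  1 - mlE al (lam * t `^ al).
Proof.
move=> al01 t0; have /andP[al0 _] := al01.
have [int1 int2] := mlker_convolution al0 al0 ltr01 t0
  (geometrically_bounded_alt lam) (@geometrically_bounded_delta0 R).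
have eqf : (fun s => mlker al al (alt lam) (t - s) * mlker al 1 (delta0 R) s) =
    (fun s => mlker al al (alt lam) (t - s)).
  apply/funext => s; rewrite (@mlker_delta0 R al 1) (subrr 1) powRr0 Gamma1 divr1.
  exact: mulr1.
rewrite eqf in int1 int2; split; first exact: int1.
rewrite int2 cauchy_prod_delta0r (mlker1_recl al01 lam t0).
by rewrite opprB addrCA subrr addr0.
Qed.

Lemma sum_from1E (R : realType) (c : nat -> R) :
  sum_from1 c = limn (series (fun n => c n.+1)).
Proof.
congr (limn _); apply/funext => N.
by rewrite seriesEord big_add1 big_mkord.
Qed.

Section observation_relax.
Variable R : realType.
Variables (a q : R -> R) (a0 : R).
Hypothesis Ca : C2_closure a.
Hypothesis a0_gt0 : 0 < a0.
Hypothesis a_ge : {in `[0, 1], forall x : R, a0 <= a x}.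
Hypothesis Qq : classQ q.
Variables (lam : nat -> R) (Phi : nat -> R -> R).
Hypothesis eig : eigensystem a q lam Phi.
Variables (f u0 : R -> R).
Hypotheses (L2f : L2 f) (L2u0 : L2 u0).

Let m0 : 0 < a0 / 4. Proof. by rewrite divr_gt0// ltr0n. Qed.

Lemma solution_relax (al : R) g t : 0 < al < 1 -> 0 < t ->
  (forall s, 0 < s < t -> g s = 0) ->
  solution al lam Phi f u0 g 0 t =
  relax al (fun n => lam n.+1) (fun n => rho lam Phi f u0 n.+1) (rho lam Phi f u0 0) t.
Proof.
move=> al01 t0 g0.
have lge := eigensystem_ge Ca a0_gt0 a_ge Qq eig.
have l0 := eigensystem_gt0 Ca a0_gt0 a_ge Qq eig.
pose E n := mlE al (lam n.+1 * t `^ al).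
pose C n := (lam n.+1)^-1 * inner f (Phi n.+1) * Phi n.+1 0.
pose A n := inner u0 (Phi n.+1) * E n * Phi n.+1 0.
pose B n := (lam n.+1)^-1 * inner f (Phi n.+1) * (1 - E n) * Phi n.+1 0.
pose r n := rho lam Phi f u0 n.+1.
have E0 n : 0 <= E n by apply: mlE_ge0 => //; rewrite mulr_gt0 ?powR_gt0.
have E1 n : E n <= 1 by apply: mlE_le1 => //; rewrite mulr_gt0 ?powR_gt0.
have sC : abs_summable C := summable_boundaryV Ca a0_gt0 a_ge Qq eig L2f.
have sr := summable_rho Ca a0_gt0 a_ge Qq eig L2f L2u0.
have sE : abs_summable (fun n => r n * E n) := relax_summable al01 m0 lge sr t0.
have sB : abs_summable B.
  apply: (abs_summable_norm_le sC) => n.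
  rewrite /B /C mulrAC [leLHS]normrM ler_piMr//.
  by rewrite ger0_norm ?subr_ge0// lerBlDr lerDl.
(* Termwise, initial data and source add up to the stationary part [C], which sums to [rho_0], plus
   the relaxing part [r E]. Summability of [A] is read off this identity, the other three series
   being bounded directly. *)
have AE n : A n = C n + r n * E n + - 1 * B n.
  by rewrite /A /B /C /r /rho/=; ring.
have sA : abs_summable A.
  by rewrite (funext AE); apply: abs_summableD; [exact: abs_summableD|exact: abs_summableZ].
rewrite /solution !sum_from1E /relax /rho/= sum_from1E.
rewrite -[RHS](sumD sC sE).
transitivity (limn (series A) + limn (series B)); last first.
  by rewrite -(sumD sA sB); apply: eq_sum => n; rewrite AE -/(r n); ring.
congr (_ + _); apply: eq_sum => n.
  by rewrite mittag_leffler_alt -mlE_scale.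
rewrite /B; congr (_ * _).
have [ik ek] := Rintegral_mlker_alt (lam n.+1) al01 t0.
transitivity (\int[@lebesgue_measure R]_(s in `]0, t[)
    (inner f (Phi n.+1) * mlker al al (alt (lam n.+1)) (t - s))).
  apply: eq_Rintegral => s; rewrite inE/= in_itv/= => st.
  by rewrite (g0 s st) mulr0 addr0 mittag_leffler_alt mulrC.
rewrite -ek (RintegralZl _ (measurable_itvR _) ik).
by rewrite [RHS]mulrACA mulVf ?mul1r// gt_eqF.
Qed.

End observation_relax.

Lemma spectral_data_sub (R : realType) (lam lam' : nat -> R)
    (Phi Phi' : nat -> R -> R) (f f' u0 u0' : R -> R) :
  (forall n, rho lam Phi f u0 n.+1 != 0 -> exists j, lam' j.+1 = lam n.+1 /\
     rho lam' Phi' f' u0' j.+1 = rho lam Phi f u0 n.+1) ->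
  spectral_data lam Phi f u0 `<=` spectral_data lam' Phi' f' u0'.
Proof.
move=> sub _ [[|n] [// _ rn] <-]; have [j [lj rj]] := sub n rn.
by exists j.+1; [split => //; rewrite rj|rewrite lj rj].
Qed.

Theorem theorem3p1 (R : realType)
  (a : R -> R) (a0 : R)
  (Ca : C2_closure a) (a0_gt0 : 0 < a0)
  (a_ge : {in `[0, 1], forall x : R, a0 <= a x})
  (alpha alpha' : R)
  (alpha01 : 0 < alpha < 1) (alpha'01 : 0 < alpha' < 1)
  (q f u0 q' f' u0' : R -> R)
  (Qq : classQ q) (L2f : L2 f) (L2u0 : L2 u0)
  (Qq' : classQ q') (L2f' : L2 f') (L2u0' : L2 u0')
  (lam lam' : nat -> R) (Phi Phi' : nat -> R -> R)
  (eig : eigensystem a q lam Phi) (eig' : eigensystem a q' lam' Phi')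
  (T1 T2 T : R) (T1_ge0 : 0 <= T1) (T12 : T1 < T2) (T2T : T2 <= T)
  (g g' : R -> R)
  (g_eq0 : forall t : R, 0 <= t <= T2 -> g t = 0 /\ g' t = 0)
  (h h' : R -> R)
  (obs : observation T alpha lam Phi f u0 g h)
  (obs' : observation T alpha' lam' Phi' f' u0' g' h')
  (K_neq0 : setK lam Phi f u0 !=set0)
  (hh' : forall t : R, T1 <= t <= T2 -> 0 < t -> h t = h' t) :
  [/\ rho lam Phi f u0 0 = rho lam' Phi' f' u0' 0,
      spectral_data lam Phi f u0 = spectral_data lam' Phi' f' u0' &
      alpha = alpha'].
Proof.
have m0 : 0 < a0 / 4 by rewrite divr_gt0// ltr0n.
have T2_gt0 : 0 < T2 by exact: le_lt_trans T12.
have lge := eigensystem_ge Ca a0_gt0 a_ge Qq eig.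
have lge' := eigensystem_ge Ca a0_gt0 a_ge Qq' eig'.
have sr := summable_rho Ca a0_gt0 a_ge Qq eig L2f L2u0.
have sr' := summable_rho Ca a0_gt0 a_ge Qq' eig' L2f' L2u0'.
have lS n : lam n.+1 < lam n.+2 by case: eig => _ /(_ n.+1).
have lS' n : lam' n.+1 < lam' n.+2 by case: eig' => _ /(_ n.+1).
have al0 : 0 < alpha by case/andP: alpha01.
have al0' : 0 < alpha' by case/andP: alpha'01.
have exr : exists n, rho lam Phi f u0 n.+1 != 0 by case: K_neq0 => -[|n] [// _ rn]; exists n.
(* Equality is given only for [t > 0] and [T1] may be 0, whereas the continuation starts from a
   closed interval inside the open half-line. *)
pose S1 := Num.max T1 (T2 / 2).
have S1_gt0 : 0 < S1 by rewrite lt_max divr_gt0// ?ltr0n// orbT.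
have S12 : S1 < T2 by rewrite gt_max T12 ltr_pdivrMr// ltr_pMr// ltr1n.
have agree t : S1 <= t <= T2 ->
    relax alpha (fun n => lam n.+1) (fun n => rho lam Phi f u0 n.+1)
      (rho lam Phi f u0 0) t =
    relax alpha' (fun n => lam' n.+1) (fun n => rho lam' Phi' f' u0' n.+1)
      (rho lam' Phi' f' u0' 0) t.
  move=> /andP[St tT]; have t0 := lt_le_trans S1_gt0 St.
  have g0 s : 0 < s < t -> g s = 0 /\ g' s = 0.
    by move=> /andP[s0 st]; apply: g_eq0; rewrite (ltW s0) (le_trans (ltW st) tT).
  have t0T : 0 < t <= T by rewrite t0 (le_trans tT T2T).
  rewrite -(solution_relax Ca a0_gt0 a_ge Qq eig L2f L2u0 alpha01 t0 (fun s hs => (g0 s hs).1)).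
  rewrite -(solution_relax Ca a0_gt0 a_ge Qq' eig' L2f' L2u0' alpha'01 t0 (fun s hs => (g0 s hs).2)).
  rewrite -(obs t t0T) -(obs' t t0T); apply: hh' => //.
  by rewrite tT andbT; apply: le_trans St; rewrite le_max lexx.
have all_times t : 0 < t -> relax alpha _ _ _ t = relax alpha' _ _ _ t :=
  @relax_continuation _ _ _ _ _ _ _ _ _ _ alpha01 alpha'01 m0 lge lge' sr sr' _ _
    S1_gt0 S12 agree t.
have eqz z : 0 < z -> rho lam Phi f u0 0 +
      limn (series (fun n => rho lam Phi f u0 n.+1 / (1 + lam n.+1 * z `^ alpha))) =
    rho lam' Phi' f' u0' 0 +
      limn (series (fun n => rho lam' Phi' f' u0' n.+1 / (1 + lam' n.+1 * z `^ alpha'))).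
  move=> z0.
  rewrite -(relax_laplace _ alpha01 m0 lge sr z0) -(relax_laplace _ alpha'01 m0 lge' sr' z0).
  apply: eq_Rintegral => t; rewrite inE/= in_itv/= andbT => t0.
  by rewrite all_times// mulr_gt0.
(* The reverse inclusion exchanges the two sets of data, and then needs a nonzero [rho] on the other
   side. *)
have eqz' z (z0 : 0 < z) := esym (eqz z z0).
have exr' := other_coef_neq0 al0 al0' m0 lge lge' lS sr sr' exr eqz.
split.
- exact: (limit_identified al0 al0' m0 lge lge' lS lS' sr sr' exr eqz).
- apply/seteqP; split; apply: spectral_data_sub => n.
  + exact: (atoms_identified al0 al0' m0 lge lge' lS lS' sr sr' exr eqz).
  + exact: (atoms_identified al0' al0 m0 lge' lge lS' lS sr' sr exr' eqz').
- exact: (order_identified al0 al0' m0 lge lge' lS lS' sr sr' exr eqz).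
Qed.
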